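(* Let $S\in\Omega_p$ be a price path with market portfolio $\mu$, let $c_\mu$ be a fixed control function on $\{0\le s\le t<\infty\}$ controlling the $p$-variation of $\mu$, and let $M>0$. Let $(\mathcal{K},d_{\mathcal{K}})$ be a compact metric space equipped with a continuous embedding (i.e. a continuous injective map) $\iota\colon(\mathcal{K},d_{\mathcal{K}})\to(\mathcal{A}^{M,q}(c_\mu),d_\beta)$ such that, for some positive function $\lambda$ and some constant $C$ independent of $T$, $$|\log V^{\iota(x)}_T-\log V^{\iota(y)}_T|\le C\,\lambda(T)\,d_{\mathcal{K}}(x,y)\qquad\text{for all }T>0\text{ and }x,y\in\mathcal{K}.$$ Let $V^{\ast,\mathcal{K},\iota}_T:=\sup_{x\in\mathcal{K}}V^{\iota(x)}_T$. Let $m$ be a probability measure on $\mathcal{K}$ with full support, let $\nu=\iota_\ast(m)$ denote the pushforward measure on $\mathcal{A}^{M,q}(c_\mu)$, and let $\pi^\nu$ be the associated universal portfolio. If $\lim_{T\to\infty}\lambda(T)=\infty$, then $$\lim_{T\to\infty}\frac{1}{\lambda(T)}\Big(\log V^{\ast,\mathcal{K},\iota}_T-\log V^{\pi^\nu}_T\Big)=0.$$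
   Context: Parameters: $p\in(2,3)$, $q\ge p$, $r>1$ with $2/p+1/q>1$, $1/r=1/p+1/q$; and $q'>q$, $r'>r$ with $2/p+1/q'>1$, $1/r'=1/p+1/q'$. Notation: $\Delta_{[0,T]}=\{(s,t)\in[0,T]^2:s\le t\}$; $S_{s,t}:=S_t-S_s$; for a path or two-parameter function $A$ and $a\ge1$, $\|A\|_{a,[s,t]}:=\sup_{\mathcal{P}}(\sum_{[u,v]\in\mathcal{P}}|A_{u,v}|^a)^{1/a}$ over finite partitions of $[s,t]$. A control function is a non-negative function $c(s,t)$, $s\le t$, with $c(s,u)+c(u,t)\le c(s,t)$; that $c_\mu$ controls the $p$-variation of $\mu$ means $|\mu_{s,t}|^p\le c_\mu(s,t)$. Convention $0/0:=0$. Products and quotients of vectors are componentwise; $F_sS_{s,t}$ inside integrals is the Euclidean inner product. $\mathbb{R}_+=(0,\infty)$; $\Delta^d=\{x\in\mathbb{R}^d:\sum_ix^i=1\}$. Property (RIE): $S\in C([0,T];\mathbb{R}^d)$ satisfies (RIE) with respect to $p$ and partitions $\mathcal{P}^n=\{0=t^n_0<\cdots<t^n_{N_n}=T\}$ with $|\mathcal{P}^n|\to0$ if, with $S^n_t:=S_T\mathbf{1}_{\{T\}}(t)+\sum_kS_{t^n_k}\mathbf{1}_{[t^n_k,t^n_{k+1})}(t)$, (1) $\int_0^tS^n_u\otimes\mathrm{d}S_u:=\sum_kS_{t^n_k}\otimes S_{t^n_k\wedge t,t^n_{k+1}\wedge t}$ converge uniformly in $t$ to a limit $\int_0^tS_u\otimes\mathrm{d}S_u$,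 and (2) there is a control function $c$ with $\sup_{(s,t)}\frac{|S_{s,t}|^p}{c(s,t)}+\sup_n\sup_{0\le k<\ell\le N_n}\frac{|\int_{t^n_k}^{t^n_\ell}S^n_u\otimes\mathrm{d}S_u-S_{t^n_k}\otimes S_{t^n_k,t^n_\ell}|^{p/2}}{c(t^n_k,t^n_\ell)}\le1$. The associated $p$-rough path is $\mathbf{S}=(S,\mathbb{S})$, $\mathbb{S}_{s,t}:=\int_s^tS_u\otimes\mathrm{d}S_u-S_s\otimes S_{s,t}$, with bracket $[\mathbf{S}]_t:=S_{0,t}\otimes S_{0,t}-2\,\mathrm{Sym}(\mathbb{S}_{0,t})$, of finite variation. Price paths: a partition of $[0,\infty)$ is a strictly increasing sequence $0=t_0<t_1<\dots\to\infty$; $\mathcal{P}([0,T]):=(\mathcal{P}\cup\{T\})\cap[0,T]$. $\Omega_p$ is the set of $S\in C([0,\infty);\mathbb{R}^d_+)$ for which there are partitions $(\mathcal{P}^n_S)_n$ of $[0,\infty)$ with vanishing mesh on compacts such that, for all $T>0$, $S|_{[0,T]}$ satisfies (RIE) with respect to $p$ and $(\mathcal{P}^n_S([0,T]))_n$. The market portfolio is $\mu^i:=S^i/(S^1+\cdots+S^d)$. Controlled paths: for $X$ continuous of finite $p$-variation, $(F,F')\in\mathcal{V}^q_X([0,T];\mathbb{R}^d)$ if $F\colon[0,T]\to\mathbb{R}^d$, $F'\colon[0,T]\to\mathcal{L}(\mathbb{R}^d;\mathbb{R}^d)$ are continuous, $\|F'\|_{q,[0,T]}<\infty$ and $R^F_{s,t}:=F_{s,t}-F'_sX_{s,t}$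 has $\|R^F\|_{r,[0,T]}<\infty$; norm $\|F,F'\|_{\mathcal{V}^q_X,[0,T]}:=|F_0|+|F'_0|+\|F'\|_{q,[0,T]}+\|R^F\|_{r,[0,T]}$. (For $\mathcal{V}^{q'}_X$ replace $(q,r)$ by $(q',r')$.) Smooth functions $f(X)$ are controlled with derivative $\mathrm{D}f(X)$; componentwise products are controlled with $((FG)')^{ij}=(F')^{ij}G^i+F^i(G')^{ij}$. A $\mu$-controlled path is also $S$-controlled. Rough integral: $\int_0^tF_u\,\mathrm{d}\mathbf{S}_u:=\lim_{|\mathcal{P}|\to0}\sum_{[s,v]\in\mathcal{P}}(F_sS_{s,v}+\sum_{i,j}(F'_s)^{ij}\mathbb{S}^{ji}_{s,v})$. Wealth: a portfolio is an $S$-controlled path $\pi$ (on each $[0,T]$) with values in $\Delta^d$; its wealth is $W^\pi_t:=\exp\big(\int_0^t\frac{\pi_s}{S_s}\mathrm{d}\mathbf{S}_s-\frac12\sum_{i,j}\int_0^t\frac{\pi^i_s\pi^j_s}{S^i_sS^j_s}\mathrm{d}[\mathbf{S}]^{ij}_s\big)$ and its relative wealth is $V^\pi:=W^\pi/W^\mu$. Admissible portfolios: $\mathcal{V}^q_\mu([0,\infty);\Delta^d)$ is the set of pairs $(\pi,\pi')$, $\pi$ with values in $\Delta^d$, whose restriction to $[0,T]$ is in $\mathcal{V}^q_\mu$ for all $T>0$. $\mathcal{A}^{M,q}(c_\mu)$ is the set of $(\pi,\pi')\in\mathcal{V}^q_\mu([0,\infty);\Delta^d)$ with $|\frac{\pi_0}{\mu_0}|+|(\frac{\pi}{\mu})'_0|\le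 M$ and $\sup_{s\le t}\frac{|(\frac\pi\mu)'_{s,t}|^q}{c_\mu(s,t)}+\sup_{s\le t}\frac{|R^{\pi/\mu}_{s,t}|^r}{c_\mu(s,t)}\le1$, where $(\pi/\mu,(\pi/\mu)')$ is the product of the $\mu$-controlled paths $\pi$ and $1/\mu$. Seminorms: $p^{\mu,q'}_T((\pi,\pi')):=\|\frac\pi\mu,(\frac\pi\mu)'\|_{\mathcal{V}^{q'}_\mu,[0,T]}$. Metric: given a fixed sequence $\beta_N>0$ with $\beta_N\to\infty$, $d_\beta((\pi,\pi'),(\phi,\phi')):=\sup_{N\ge1}\frac{1}{\beta_N\gamma_N}p^{\mu,q'}_N((\pi,\pi')-(\phi,\phi'))$ with $\gamma_N:=1+M+c_\mu(0,N)^{1/q}+c_\mu(0,N)^{1/r}$. Universal portfolio: for a probability measure $\nu$ on $(\mathcal{A}^{M,q}(c_\mu),d_\beta)$, $\pi^\nu_t:=\frac{\int_{\mathcal{A}^{M,q}(c_\mu)}\pi_tV^\pi_t\,\mathrm{d}\nu(\pi)}{\int_{\mathcal{A}^{M,q}(c_\mu)}V^\pi_t\,\mathrm{d}\nu(\pi)}$, $t\ge0$; this is a portfolio. *)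

(* Defs.v *)
From HB Require Import structures.
From mathcomp Require Import all_boot all_order all_algebra.
From mathcomp Require Import all_classical all_reals all_analysis.

Set Implicit Arguments.
Unset Strict Implicit.
Unset Printing Implicit Defensive.

Import Order.TTheory GRing.Theory Num.Theory.
Import numFieldNormedType.Exports.

Local Open Scope classical_set_scope.
Local Open Scope ring_scope.

(* The library's sigma-algebras live on pointed types; a space carrying a
   probability measure is nonempty, so pointedness is no restriction. *)
#[short(type="pmetricType")]
HB.structure Definition PointedMetric (R : numDomainType) :=
  {M of Metric R M & isPointed M}.

Section generalities.
Context {R : realType}.

(* The library norm on matrices is the sup norm, whence this definition. *)
Definition enorm {m n : nat} (A : 'M[R]_(m, n)) : R :=
  Num.sqrt (\sum_i \sum_j A i j ^+ 2).

(* x / y for x, y >= 0, with 0 / 0 = 0 and x / 0 = +oo for x > 0 *)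
Definition equot (x y : R) : \bar R :=
  if y == 0 then (if x == 0 then 0%E else +oo%E) else (x / y)%:E.

(* supremum over D s t of |A_{s,t}|^a / c(s, t) *)
Definition sup_ratio {m n : nat} (D : R -> R -> Prop) (a : R)
    (A : R -> R -> 'M[R]_(m, n)) (c : R -> R -> R) : \bar R :=
  ereal_sup [set x | exists s t,
    D s t /\ x = equot (enorm (A s t) `^ a) (c s t)].

Definition control_function (D : set R) (c : R -> R -> R) : Prop :=
  (forall s t, D s -> D t -> s <= t -> 0 <= c s t) /\
  (forall s u t, D s -> D u -> D t -> s <= u -> u <= t ->
     c s u + c u t <= c s t).

(* As in [itv_partition], the partition a = t_0 < t_1 < ... < t_N = b is coded
   by the list [:: t_1; ...; t_N]; its intervals are listed by [steps]. *)
Definition steps (a : R) (l : seq R) : seq (R * R) := zip (a :: l) l.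

Definition mesh (a : R) (l : seq R) : R :=
  \big[Num.max/0]_(w <- steps a l) (w.2 - w.1).

Definition mesh_to_0 (a b : R) : set_system (seq R) :=
  filter_from [set e : R | 0 < e]
    (fun e => [set l | itv_partition a b l /\ mesh a l < e]).

Definition mesh_lim (g : R -> R -> R) (t : R) : R :=
  lim (\sum_(w <- steps 0 l) g w.1 w.2 @[l --> mesh_to_0 0 t]).

Definition incr {V : zmodType} (A : R -> V) (s t : R) : V := A t - A s.

Definition pvar {m n : nat} (a : R) (A : R -> R -> 'M[R]_(m, n)) (s t : R)
    : \bar R :=
  ereal_sup [set ((\sum_(w <- steps s l) enorm (A w.1 w.2) `^ a) `^ a^-1)%:E
            | l in [set l | itv_partition s t l]].

(* Riemann-Stieltjes integral of f against g over [0, t]; only used for a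
   continuous integrand and a continuous integrator of finite variation *)
Definition stieltjes (f g : R -> R) (t : R) : R :=
  mesh_lim (fun u v => f u * (g v - g u)) t.

Definition infinite_partition (tau : nat -> R) : Prop :=
  [/\ tau 0%N = 0, {homo tau : m n / (m < n)%N >-> m < n}
    & tau @ \oo --> +oo].

(* (tau `|` {T}) `&` [0, T], as a list *)
Definition partition_upto (tau : nat -> R) (T : R) : seq R :=
  xget [::] [set l | itv_partition 0 T l /\
    [set` 0 :: l] = (range tau `|` [set T]) `&` `[0, T]].

End generalities.

Section paths.
Context {R : realType} {d : nat}.
Implicit Types (S X : R -> 'cV[R]_d) (p q r T M : R).

(* \int_0^t S^n_u (x) dS_u for the partition l; u (x) v is u *m v^T *)
Definition left_sum S (l : seq R) (t : R) : 'M[R]_d :=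
  \sum_(w <- steps 0 l)
    S w.1 *m (S (Num.min w.2 t) - S (Num.min w.1 t))^T.

Definition RIE p T S (P : nat -> seq R) : Prop :=
  [/\ forall n, itv_partition 0 T (P n),
      mesh 0 (P n) @[n --> \oo] --> (0 : R),
      exists I : R -> 'M[R]_d,
        {uniform `[0, T], (fun n => left_sum S (P n)) @ \oo --> I}
    & exists2 c, control_function `[0, T] c &
      (sup_ratio (fun s t => 0 <= s <= t /\ t <= T)%R p (incr S) c +
       ereal_sup (range (fun n =>
         sup_ratio (fun u v => [/\ u \in 0 :: P n, v \in 0 :: P n & u < v])%R
           (p / 2)%R
           (fun u v => left_sum S (P n) v - left_sum S (P n) u
                       - S u *m (incr S u v)^T)%R c))
       <= 1)%E].

(* S belongs to Omega_p, and P is a sequence of partitions of [0, oo[ witnessing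
   it; RIE for every T contains that the mesh of P vanishes on compacts. *)
Definition price_path_along p S (P : nat -> nat -> R) : Prop :=
  [/\ {within `[0, +oo[, continuous S},
      forall t i, 0 <= t -> 0 < S t i ord0,
      forall n, infinite_partition (P n)
    & forall T, 0 < T -> RIE p T S (fun n => partition_upto (P n) T)].

(* \int_0^t S_u (x) dS_u.  For t <= T, the sums along P([0, T]) and along
   P([0, t]) agree at time t, so the limit does not depend on the horizon. *)
Definition SdS S (P : nat -> nat -> R) (t : R) : 'M[R]_d :=
  lim (left_sum S (partition_upto (P n) t) t @[n --> \oo]).

Definition level2 S P (s t : R) : 'M[R]_d :=
  SdS S P t - SdS S P s - S s *m (incr S s t)^T.

Definition Sym (A : 'M[R]_d) : 'M[R]_d := 2^-1 *: (A + A^T).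

Definition bracket S P (t : R) : 'M[R]_d :=
  incr S 0 t *m (incr S 0 t)^T - 2 *: Sym (level2 S P 0 t).

(* pairs (F, F') *)
Definition cpath : Type := ((R -> 'cV[R]_d) * (R -> 'M[R]_d))%type.
Implicit Types F G : cpath.

Definition remainder X F (s t : R) : 'cV[R]_d :=
  incr F.1 s t - F.2 s *m incr X s t.

(* F \in V^q_X([0, T]; R^d), where 1/r = 1/p + 1/q *)
Definition controlled q r X T F : Prop :=
  [/\ {within `[0, T], continuous F.1}, {within `[0, T], continuous F.2},
      (pvar q (incr F.2) 0 T < +oo)%E & (pvar r (remainder X F) 0 T < +oo)%E].

Definition controlled_norm q r X T F : \bar R :=
  ((enorm (F.1 0))%:E + (enorm (F.2 0))%:E +
   pvar q (incr F.2) 0 T + pvar r (remainder X F) 0 T)%E.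

Definition cmul F G : cpath :=
  (fun t => \col_i (F.1 t i ord0 * G.1 t i ord0),
   fun t => \matrix_(i, j)
     (F.2 t i j * G.1 t i ord0 + F.1 t i ord0 * G.2 t i j)).

(* 1/X with its Gubinelli derivative D(1/x)(X) *)
Definition cinv X : cpath :=
  (fun t => \col_i (X t i ord0)^-1,
   fun t => \matrix_(i, j) (- (X t i ord0) ^- 2 *+ (i == j))).

Definition market S (t : R) : 'cV[R]_d :=
  \col_i (S t i ord0 / \sum_k S t k ord0).

(* Jacobian at S_t of x |-> x / (x^1 + ... + x^d) *)
Definition Dmarket S (t : R) : 'M[R]_d :=
  \matrix_(i, j) ((i == j)%:R / (\sum_k S t k ord0)
                  - S t i ord0 / (\sum_k S t k ord0) ^+ 2).

(* a (market S)-controlled path seen as an S-controlled path (chain rule) *)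
Definition to_S_controlled S F : cpath :=
  (F.1, fun t => F.2 t *m Dmarket S t).

Definition rough_integral S P F (t : R) : R :=
  mesh_lim (fun u v => \sum_i F.1 u i ord0 * incr S u v i ord0
              + \sum_i \sum_j F.2 u i j * level2 S P u v j i) t.

Definition in_simplex (x : 'cV[R]_d) : Prop := \sum_i x i ord0 = 1.

Definition portfolio q r S F : Prop :=
  (forall T, 0 < T -> controlled q r S T F) /\
  (forall t, 0 <= t -> in_simplex (F.1 t)).

Definition wealth S P F (t : R) : R :=
  expR (rough_integral S P (cmul F (cinv S)) t
    - 2^-1 * \sum_i \sum_j
        stieltjes (fun s => F.1 s i ord0 * F.1 s j ord0
                            / (S s i ord0 * S s j ord0))
                  (fun s => bracket S P s i j) t).

Definition relative_wealth S P F (t : R) : R :=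
  wealth S P F t / wealth S P (market S, Dmarket S) t.

(* phi / mu, as a product of mu-controlled paths *)
Definition over (mu : R -> 'cV[R]_d) F : cpath := cmul F (cinv mu).

Definition admissible q r (mu : R -> 'cV[R]_d) M (c : R -> R -> R)
    : set cpath :=
  [set F |
    (* a pair of paths on [0, oo[ is coded by its extension by 0 to R *)
    (forall t, t < 0 -> F.1 t = 0 /\ F.2 t = 0) /\
    [/\ forall T, 0 < T -> controlled q r mu T F,
        forall t, 0 <= t -> in_simplex (F.1 t),
        enorm ((over mu F).1 0) + enorm ((over mu F).2 0) <= M
      & (sup_ratio (fun s t => 0 <= s <= t)%R q (incr (over mu F).2) c +
         sup_ratio (fun s t => 0 <= s <= t)%R r (remainder mu (over mu F)) c
         <= 1)%E]].

Definition csub F G : cpath :=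
  (fun t => F.1 t - G.1 t, fun t => F.2 t - G.2 t).

Definition gamma q r M (c : R -> R -> R) (N : nat) : R :=
  1 + M + c 0 N%:R `^ q^-1 + c 0 N%:R `^ r^-1.

(* The exponents q, r enter through gamma, and q', r' through the seminorms. *)
Definition dbeta (beta : nat -> R) q r q' r' (mu : R -> 'cV[R]_d) M
    (c : R -> R -> R) F G : \bar R :=
  ereal_sup [set (((beta N * gamma q r M c N)^-1)%:E *
                  controlled_norm q' r' mu N%:R (over mu (csub F G)))%E
            | N in [set N | (0 < N)%N]].

(* open sets of the subspace A for a distance d *)
Definition open_in (A : set cpath) (dist : cpath -> cpath -> \bar R)
    : set (set cpath) :=
  [set U | U `<=` A /\ forall F, U F -> exists2 e : R, 0 < e &
    forall G, A G -> (dist F G < e%:E)%E -> U G].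

(* The Borel sigma-algebra of the subspace A, carried by the ambient type; its
   trace on A, which is itself measurable, is the Borel sigma-algebra of A. *)
Definition borel_in (A : set cpath) (dist : cpath -> cpath -> \bar R) :=
  g_sigma_algebraType (open_in A dist).

(* Only the path is given by this formula; its Gubinelli derivative, without
   which its wealth is not defined, need not be unique. *)
Definition universal_portfolio S P (A : set cpath)
    (dist : cpath -> cpath -> \bar R) (nu : set (borel_in A dist) -> \bar R)
    (t : R) : 'cV[R]_d :=
  let V F := relative_wealth S P (to_S_controlled S F) t in
  \col_i (fine (\int[nu]_(F in A) (F.1 t i ord0 * V F)%:E)
          / fine (\int[nu]_(F in A) (V F)%:E)).

End paths.

(* Main.v *)
Require Import Defs.
From HB Require Import structures.
From mathcomp Require Import all_boot all_order all_algebra.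
From mathcomp Require Import all_classical all_reals all_analysis.
From mathcomp Require Import measurable_realfun.
From mathcomp Require Import ring lra.

(** The proof compares the supremum of the wealths V_x with their average.  The
    relative wealth of the universal portfolio is the average of the V_x against m
    ([universal_wealth]), so it is at most the supremum.  On the other hand V_x has
    log-Lipschitz constant C lambda(T): on a ball of radius eta around a maximiser,
    V is at least exp(- C lambda(T) eta) times the maximum, and by compactness and
    full support the masses of all balls of radius eta are bounded below by a
    constant kappa > 0.  Hence the gap between the logarithms lies between 0 and
    C lambda(T) eta - log kappa ([log_sup_average]); dividing by lambda(T), letting
    T tend to infinity and then eta to 0 gives the claim.

    The substance is the identity for the wealth of the universal portfolio.
    Everything is expressed through expansions of increments over [s, t] up to
    terms of order th = 1/p + 1/r > 1 with respect to a control.  A control may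
    jump, so a negligible term is required to have both an order above 1 and
    uniform smallness near the diagonal; such terms vanish in the limit
    of fine partitions ([inc_negligible]), and germs with such a defect can be sewn
    ([sewing_cvg], [sewing_ord], [sewing_van]).  For a weight G = pi / S the
    log-wealth L then satisfies
    dL = G dS + (G' + G G) dA - (G dS)^2 / 2 up to negligible terms
    ([ord_wealth_rem]), the bracket completing the square, and the wealth W = exp L
    is controlled with derivative W G ([ctl_wealth]).  All bounds are uniform over
    the admissible portfolios, so they survive averaging over the index x
    ([ctl_average]).  Let N = E(W_x G_x) / E(W_x), with the derivative of this
    quotient, and let L_nu be the log-wealth of the weight N.  In the expansion of
    E(exp(L_x - L_nu)) the first and second order terms cancel by the definition of
    N and N', so this function has negligible increments and is constantly 1:
    E(W_x) = exp L_nu ([mix_wealthE]).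

    The portfolio pi^nu has the weight N, but the wealth in the statement uses an
    arbitrary Gubinelli derivative of it.  Two derivatives of the same path give the
    same rough integral here because property (RIE) makes the integral a limit along
    the grids of sums in which the second-order terms have total contribution
    tending to 0 ([level2_sum_cvg0], [rough_integral_derivative]).

    Finally pi^nu is defined by integrals against the image measure on the
    admissible set, for the Borel sets of the metric d_beta.  The image of K is
    measurable there since evaluations are Lipschitz and separate points, and an
    integral does not see values off a conull set ([integral_conull]), so these
    integrals are averages over K ([integral_iota]); continuity of the wealth in the
    index comes from the Lipschitz hypothesis on its logarithm. *)

Set Implicit Arguments.
Unset Strict Implicit.
Unset Printing Implicit Defensive.

Import Order.TTheory GRing.Theory Num.Theory.
Import numFieldNormedType.Exports.

Local Open Scope classical_set_scope.
Local Open Scope ring_scope.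

(** * Partitions and discrete sewing *)

Section partition_lists.
Context {R : realType}.
Implicit Types (a b : R) (l : seq R) (g w Xi : R -> R -> R) (D : set R).

Definition riemann_sum g a l : R := \sum_(w <- steps a l) g w.1 w.2.

Lemma steps_cons a x l : steps a (x :: l) = (a, x) :: steps x l.
Proof. by []. Qed.

Lemma steps_cat a l1 l2 :
  steps a (l1 ++ l2) = steps a l1 ++ steps (last a l1) l2.
Proof. by elim: l1 a => //= x l1 IH a; rewrite !steps_cons IH. Qed.

Lemma riemann_sum_cons g a x l :
  riemann_sum g a (x :: l) = g a x + riemann_sum g x l.
Proof. by rewrite /riemann_sum steps_cons big_cons. Qed.

Lemma riemann_sum_cat g a l1 l2 :
  riemann_sum g a (l1 ++ l2) = riemann_sum g a l1 + riemann_sum g (last a l1) l2.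
Proof. by rewrite /riemann_sum steps_cat big_cat. Qed.

Lemma path_le_last a l : path <=%R a l -> a <= last a l.
Proof.
by elim: l a => //= x l IH a /andP[ax /IH]; exact: le_trans.
Qed.

Lemma path_lt_le a l : path <%R a l -> path <=%R a l.
Proof. by apply: sub_path => x y /ltW. Qed.

Lemma control_diag D w a : control_function D w -> D a -> w a a = 0.
Proof.
move=> [w0 wD] Da; apply/eqP; rewrite eq_le w0// andbT.
by have := wD a a a Da Da Da (lexx _) (lexx _); rewrite gerDr.
Qed.

(** Superadditivity lets one split a chain at a point where neither side
    carries more than half of the control; this replaces the removal of points
    one at a time in Young's argument and avoids summing a zeta series. *)
Lemma halving D w a l : control_function D w -> D a ->
  (forall x, x \in l -> D x) -> path <=%R a l -> l != [::] ->
  exists l1 x l2, [/\ l = l1 ++ x :: l2,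
    w a (last a l1) <= w a (last a l) / 2 &
    w x (last a l) <= w a (last a l) / 2].
Proof.
move=> hw Da Dl al l0.
have [w0 wD] := hw.
set b := last a l.
have lastD : forall l' : seq R, {subset l' <= l} -> D (last a l').
  move=> l' sl; have := mem_last a l'; rewrite inE => /predU1P[->//|/sl/Dl//].
have Db : D b by exact: lastD.
have ab : a <= b by exact: path_le_last.
have Om0 : 0 <= w a b / 2 by rewrite divr_ge0// w0.
suff H : forall l2 l1, l = l1 ++ l2 -> l2 != [::] -> w a (last a l1) <= w a b / 2 ->
    exists l1 x l2, [/\ l = l1 ++ x :: l2, w a (last a l1) <= w a b / 2 &
                        w x b <= w a b / 2].
  by apply: (H l [::]) => //=; rewrite (control_diag hw).
elim=> // x l2 IH l1 el _ h1.
have Dx : D x by apply: Dl; rewrite el mem_cat mem_head orbT.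
have [l20|l20] := eqVneq l2 [::].
  exists l1, x, l2; split => //.
  have -> : b = x by rewrite /b el l20 last_cat.
  by rewrite (control_diag hw)// in Om0 *; rewrite divr_ge0// w0// (le_trans ab)// /b el l20 last_cat.
have [hx|hx] := leP (w a x) (w a b / 2).
  apply: (IH (rcons l1 x)) => //; first by rewrite cat_rcons.
  by rewrite last_rcons.
exists l1, x, l2; split => //.
move: al; rewrite el cat_path /= => /and3P[/path_le_last al1 l1x xl2].
have xb : x <= b by rewrite /b el last_cat /= path_le_last.
have := wD a x b Da Dx Db (le_trans al1 l1x) xb.
by move: hx; set A := w a x; set B := w a b; set C := w x b; lra.
Qed.

Lemma ler_powR2 (th x y : R) : 0 <= th -> 0 <= x -> x <= y -> x `^ th <= y `^ th.
Proof.
by move=> th0 x0 xy; apply: ge0_ler_powR; rewrite ?nnegrE// (le_trans x0).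
Qed.

Definition sewing_const (th : R) : R := 2 / (1 - 2 * 2^-1 `^ th).

Lemma half_powR_lt (th : R) : 1 < th -> 2 * 2^-1 `^ th < 1 :> R.
Proof.
move=> th1.
rewrite -(@mulr_powRB1 _ 2^-1 th) ?invr_ge0 ?(lt_trans _ th1)// mulrA divff//.
have e1 : (1 : R) `^ (th - 1) = 1 by rewrite powR1.
rewrite mul1r -[ltRHS]e1; apply: gt0_ltr_powR; rewrite ?subr_gt0 ?nnegrE//.
by rewrite invf_lt1// ltr1n.
Qed.

Lemma sewing_const_gt0 (th : R) : 1 < th -> 0 < sewing_const th.
Proof. by move=> /half_powR_lt h; rewrite divr_gt0// subr_gt0. Qed.

(** The discrete sewing lemma.  Cutting at a halving point costs two defects
    and leaves two shorter chains, each of control at most half; the constant is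
    the fixed point of C = 2 C 2^(-th) + 2. *)
Lemma sewing_list D w th K Xi : control_function D w -> 1 < th -> 0 <= K ->
  (forall s u t, D s -> D u -> D t -> s <= u -> u <= t ->
     `|Xi s t - Xi s u - Xi u t| <= K * w s t `^ th) ->
  forall a l, D a -> (forall x, x \in l -> D x) -> path <=%R a l ->
  `|riemann_sum Xi a l - Xi a (last a l)|
    <= K * sewing_const th * w a (last a l) `^ th.
Proof.
move=> hw th1 K0 hXi a l.
have [w0 wD] := hw.
have th0 : 0 < th by exact: lt_trans th1.
have [n] := ubnP (size l).
elim: n a l => // n IH a l; rewrite ltnS => szl Da Dl al.
have [l0|l0] := eqVneq l [::].
  rewrite l0 /= /riemann_sum big_nil sub0r normrN.
  have := hXi a a a Da Da Da (lexx _) (lexx _).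
  rewrite (control_diag hw)// powR0 ?gt_eqF// !mulr0.
  by rewrite subrr sub0r normrN.
have [l1 [x [l2 [el h1 h2]]]] := halving hw Da Dl al l0.
have Dx : D x by apply: Dl; rewrite el mem_cat mem_head orbT.
have D1 : forall y, y \in l1 -> D y by move=> y yl; apply: Dl; rewrite el mem_cat yl.
have D2 : forall y, y \in l2 -> D y.
  by move=> y yl; apply: Dl; rewrite el mem_cat inE yl !orbT.
move: (al); rewrite el cat_path /= => /and3P[al1 l1x xl2].
have elast : last a (l1 ++ x :: l2) = last x l2 by rewrite last_cat.
set z := last a l1 in l1x *; set b := last x l2.
have Db : D b by rewrite /b; have := mem_last x l2; rewrite inE => /predU1P[->//|/D2].
have Dz : D z by rewrite /z; have := mem_last a l1; rewrite inE => /predU1P[->//|/D1].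
have az : a <= z by exact: path_le_last.
have xb : x <= b by exact: path_le_last.
have ab : a <= b by rewrite (le_trans az)// (le_trans l1x).
have s1 : (size l1 < n)%N.
  by apply: leq_trans szl; rewrite el size_cat /= addnS ltnS leq_addr.
have s2 : (size l2 < n)%N.
  by apply: leq_trans szl; rewrite el size_cat /= addnS ltnS leq_addl.
have I1 := IH a l1 s1 Da D1 al1.
have I2 := IH x l2 s2 Dx D2 xl2.
rewrite -/z in I1; rewrite -/b in I2.
rewrite el elast -/b in h1 h2 *; rewrite -/z in h1.
rewrite riemann_sum_cat -/z riemann_sum_cons.
have w_ab0 : 0 <= w a b by exact: w0.
have hh : forall s t, D s -> D t -> s <= t -> w s t <= w a b / 2 ->
    w s t `^ th <= w a b `^ th * 2^-1 `^ th.
  move=> s t Ds Dt st hst; rewrite -powRM ?invr_ge0//.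
  by apply: ler_powR2 => //; [exact: ltW|exact: w0].
have e1 := hXi a z b Da Dz Db az (le_trans l1x xb).
have e2 := hXi z x b Dz Dx Db l1x xb.
have wzb : w z b `^ th <= w a b `^ th.
  apply: ler_powR2; [exact: ltW|by rewrite w0// (le_trans l1x)|].
  have := wD a z b Da Dz Db az (le_trans l1x xb).
  by apply: le_trans; rewrite lerDr w0.
have H1 := hh _ _ Da Dz az h1.
have H2 := hh _ _ Dx Db xb h2.
have C0 := sewing_const_gt0 th1.
have CE : sewing_const th * (2 * 2^-1 `^ th) + 2 = sewing_const th.
  have := half_powR_lt th1; rewrite /sewing_const; set y := 2 * _ => y1.
  by field; rewrite subr_eq0 gt_eqF.
rewrite -/z -/b in e1 e2.
set A := w a b `^ th in H1 H2 wzb e1 *.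
have -> : riemann_sum Xi a l1 + (Xi z x + riemann_sum Xi x l2) - Xi a b =
  (riemann_sum Xi a l1 - Xi a z) + (riemann_sum Xi x l2 - Xi x b)
  - (Xi a b - Xi a z - Xi z b) - (Xi z b - Xi z x - Xi x b) by ring.
have T1 : K * sewing_const th * w a z `^ th <= K * sewing_const th * (A * 2^-1 `^ th).
  by rewrite ler_wpM2l// mulr_ge0// ltW.
have T2 : K * sewing_const th * w x b `^ th <= K * sewing_const th * (A * 2^-1 `^ th).
  by rewrite ler_wpM2l// mulr_ge0// ltW.
have T3 : K * w z b `^ th <= K * A by rewrite ler_wpM2l.
rewrite -[in leRHS]CE.
have -> : K * (sewing_const th * (2 * 2^-1 `^ th) + 2) * A =
  K * sewing_const th * (A * 2^-1 `^ th) + K * sewing_const th * (A * 2^-1 `^ th)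
  + K * A + K * A by ring.
apply: (le_trans (ler_normB _ _)); apply: lerD; last exact: le_trans T3.
apply: (le_trans (ler_normB _ _)); apply: lerD; last exact: e1.
by apply: (le_trans (ler_normD _ _)); apply: lerD; [exact: le_trans T1|exact: le_trans T2].
Qed.

Lemma riemann_sum_control D w g k : control_function D w -> 0 <= k ->
  forall a l, D a -> (forall x, x \in l -> D x) -> path <=%R a l ->
  (forall u v, (u, v) \in steps a l -> `|g u v| <= k * w u v) ->
  `|riemann_sum g a l| <= k * w a (last a l).
Proof.
move=> hw k0 a l; have [w0 wD] := hw.
elim: l a => [|x l IH] a Da Dl al hg.
  by rewrite /riemann_sum big_nil normr0 mulr_ge0// w0//=.
move: al => /= /andP[ax xl].
have Dx : D x by apply: Dl; rewrite mem_head.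
have Dl' : forall y, y \in l -> D y by move=> y yl; apply: Dl; rewrite inE yl orbT.
have Db : D (last x l) by have := mem_last x l; rewrite inE => /predU1P[->//|/Dl'].
rewrite riemann_sum_cons.
apply: (le_trans (ler_normD _ _)).
apply: (@le_trans _ _ (k * w a x + k * w x (last x l))); last first.
  by rewrite -mulrDr ler_wpM2l// wD// path_le_last.
apply: lerD; first by apply: hg; rewrite steps_cons mem_head.
by apply: IH => // u v uv; apply: hg; rewrite steps_cons inE uv orbT.
Qed.

End partition_lists.

Section refinement.
Context {R : realType}.
Implicit Types (a b e : R) (l m : seq R) (g w : R -> R -> R) (D : set R).

Lemma itv_partition_mem a b l x : itv_partition a b l -> x \in l -> a < x <= b.
Proof.
move=> [al /eqP lb] xl; apply/andP; split.
  by have /allP := order_path_min lt_trans al; apply.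
case/splitPr: xl al lb => l1 l2; rewrite last_cat cat_path /=.
by move=> /and3P[_ _ /path_lt_le /path_le_last] + <-.
Qed.

Lemma steps_itv a l u v : path <%R a l -> (u, v) \in steps a l ->
  [/\ a <= u, u < v, v <= last a l, u \in a :: l & v \in l].
Proof.
elim: l a => // x l IH a /= /andP[ax xl].
rewrite steps_cons inE => /predU1P[[-> ->]|uv].
  by rewrite ax mem_head !inE eqxx lexx; split => //; exact/path_le_last/path_lt_le.
have [h1 h2 h3 h4 h5] := IH _ xl uv; split => //.
- by rewrite (le_trans (ltW ax)).
- by rewrite inE h4 orbT.
- by rewrite inE h5 orbT.
Qed.

Lemma mesh_cons a x l : mesh a (x :: l) = Num.max (x - a) (mesh x l).
Proof. by rewrite /mesh steps_cons big_cons. Qed.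

Lemma mesh_ge a l u v : (u, v) \in steps a l -> v - u <= mesh a l.
Proof.
elim: l a => // x l IH a; rewrite steps_cons inE mesh_cons le_max.
by move=> /predU1P[[-> ->]|/IH ->]; rewrite ?lexx ?orbT.
Qed.

Lemma mesh_lt_cat a l m e :
  mesh a l < e -> mesh (last a l) m < e -> mesh a (l ++ m) < e.
Proof.
elim: l a => // x l IH a; rewrite cat_cons !mesh_cons !gt_max /=.
by move=> /andP[-> h1] /(IH _ h1) ->.
Qed.

Lemma exists_fine_partition a b e : a <= b -> 0 < e ->
  exists2 l, itv_partition a b l & mesh a l < e.
Proof.
move=> ab e0; have e20 : 0 < e / 2 by rewrite divr_gt0.
have [n] : exists n : nat, b - a <= n%:R * (e / 2).
  exists (Num.trunc ((b - a) / (e / 2))).+1.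
  by rewrite -ler_pdivrMr// ltW// truncnS_gt.
elim: n a ab => [|n IH] a ab.
  rewrite mul0r subr_le0 => ba; have <- : a = b by apply/le_anti; rewrite ab ba.
  by exists [::]; rewrite /mesh ?big_nil//; split.
move=> h; have [ae|ae] := ltP (b - a) e.
  have [->|nab] := eqVneq a b.
    by exists [::]; rewrite /mesh ?big_nil//; split.
  exists [:: b]; first by apply: itv_partition1; rewrite lt_neqAle nab.
  by rewrite /mesh steps_cons big_cons big_nil /= gt_max ae e0.
have [||l [pl /eqP lb] hl] := IH (a + e / 2).
- by move: ae e0; lra.
- by move: h; rewrite -natr1; lra.
exists (a + e / 2 :: l).
  by split; rewrite /= ?lb// pl andbT ltrDl.
by rewrite mesh_cons gt_max hl andbT; move: e0; lra.
Qed.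

Lemma mesh_to_0_filter a b : a <= b -> ProperFilter (mesh_to_0 a b).
Proof.
move=> ab; apply: filter_from_proper; first apply: filter_from_filter.
- by exists 1; rewrite /= ltr01.
- move=> e1 e2 h1 h2; exists (Num.min e1 e2); first by rewrite /= lt_min h1 h2.
  by move=> l /= [pl]; rewrite lt_min => /andP[].
- by move=> e e0; have [l pl ml] := exists_fine_partition ab e0; exists l.
Qed.

Lemma subseq_cons_split (x : R) l m : subseq (x :: l) m ->
  exists m1 m2, m = m1 ++ x :: m2 /\ subseq l m2.
Proof.
elim: m => //= y m IH; case: eqP => [->|_ /IH[m1 [m2 [-> h]]]].
  by exists [::], m.
by exists (y :: m1), m2.
Qed.

(** Each interval of the coarse partition costs at most its control, and the
    controls add up by superadditivity. *)
Lemma riemann_sum_refine D w g k : control_function D w -> 0 <= k ->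
  forall a l m, D a -> (forall x, x \in m -> D x) -> path <%R a m ->
  subseq l m -> last a l = last a m ->
  (forall s t n, (s, t) \in steps a l -> path <=%R s n -> last s n = t ->
     (forall x, x \in n -> D x) -> `|riemann_sum g s n - g s t| <= k * w s t) ->
  `|riemann_sum g a m - riemann_sum g a l| <= k * w a (last a l).
Proof.
move=> hw k0 a l; have [w0 wD] := hw.
elim: l a => [|x l IH] a m Da Dm am lm la hg.
  have -> : m = [::] by apply: (@itv_partitionxx _ _ a); split => //; rewrite -la.
  by rewrite /riemann_sum big_nil subrr normr0 mulr_ge0// w0.
have [m1 [m2 [em lm2]]] := subseq_cons_split lm.
have Dx : D x by apply: Dm; rewrite em mem_cat mem_head orbT.
have Dm2 : forall y, y \in m2 -> D y.
  by move=> y ym; apply: Dm; rewrite em mem_cat inE ym !orbT.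
have Dm1 : forall y, y \in rcons m1 x -> D y.
  by move=> y ym; apply: Dm; rewrite em -cat_rcons mem_cat ym.
move: am la hg; rewrite em -cat_rcons cat_path last_cat last_rcons /=.
move=> /andP[am1 xm2] la hg.
rewrite riemann_sum_cat last_rcons riemann_sum_cons.
have xm2' := path_lt_le xm2.
have ax : a <= x.
  by rewrite -[x](last_rcons a m1) path_le_last// path_lt_le.
have Db : D (last x l).
  by rewrite la; have := mem_last x m2; rewrite inE => /predU1P[->//|/Dm2].
have h2 : `|riemann_sum g x m2 - riemann_sum g x l| <= k * w x (last x l).
  by apply: IH => // s t n st; apply: hg; rewrite steps_cons inE st orbT.
have h1 : `|riemann_sum g a (rcons m1 x) - g a x| <= k * w a x.
  apply: hg => //; rewrite ?last_rcons ?steps_cons ?mem_head//.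
  exact: path_lt_le.
rewrite opprD addrACA; apply: (le_trans (ler_normD _ _)).
apply: (le_trans (lerD h1 h2)); rewrite -mulrDr ler_wpM2l// wD//.
by rewrite la path_le_last.
Qed.

Lemma common_refinement a b l m :
  itv_partition a b l -> itv_partition a b m ->
  exists n, [/\ itv_partition a b n, subseq l n & subseq m n].
Proof.
move=> pl pm; set n := sort <=%R (undup (l ++ m)).
have nE x : (x \in n) = (x \in l) || (x \in m).
  by rewrite mem_sort mem_undup mem_cat.
have ns : sorted <%R n by rewrite sort_lt_sorted undup_uniq.
have nab x : x \in n -> a < x <= b.
  by rewrite nE => /orP[/(itv_partition_mem pl)|/(itv_partition_mem pm)].
have sub k : {subset k <= n} -> sorted <%R k -> subseq k n.
  move=> kn sk; have -> : k = [seq x <- n | x \in k].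
    apply: lt_sorted_eq => //; first exact: (sorted_filter lt_trans).
    move=> x; rewrite mem_filter; case: (boolP (x \in k)) => //= /kn -> //.
  exact: filter_subseq.
exists n; split; last 2 first.
- by apply: sub (path_sorted pl.1) => x xl; rewrite nE xl.
- by apply: sub (path_sorted pm.1) => x xl; rewrite nE xl orbT.
have an : path <%R a n.
  by rewrite path_min_sorted//; apply/allP => x /nab /andP[].
split => //; rewrite eq_le; apply/andP; split.
  have := mem_last a n; rewrite inE => /predU1P[->|/nab/andP[]//].
  exact: itv_partition_le pl.
have [l0|] := eqVneq l [::].
  have -> : b = a by move: (pl); rewrite l0 => /itv_partition_nil.
  exact/path_le_last/path_lt_le.
case: l pl n nE ns nab sub an => // x l pl n nE ns nab sub an _.
have bn : b \in n by rewrite nE -(eqP pl.2) /= mem_last.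
by have /andP[_] := @itv_partition_mem a (last a n) n b (conj an (eqxx _)) bn.
Qed.

End refinement.

(** * Orders of two-parameter functions *)

Section orders.
Context {R : realType}.
Implicit Types (T al be : R) (w : R -> R -> R).

(** Families of two-parameter functions on 0 <= s <= t <= T, with bounds uniform
    in the index: [ord] compares with a power of a control, [van] is uniform
    smallness near the diagonal.  For a control that may jump, an order above 1
    alone does not make a remainder negligible along fine partitions; together
    with [van] it does. *)
Definition ord {X} T w al (E : X -> R -> R -> R) : Prop :=
  exists2 k, 0 <= k & forall x s t, 0 <= s -> s <= t -> t <= T ->
    `|E x s t| <= k * w s t `^ al.

Definition van {X} T (E : X -> R -> R -> R) : Prop :=
  forall e, 0 < e -> exists2 dl, 0 < dl & forall x s t,
    0 <= s -> s <= t -> t <= T -> t - s < dl -> `|E x s t| <= e.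

Definition bd {X} T (f : X -> R -> R) : Prop :=
  exists2 k, 0 <= k & forall x t, 0 <= t -> t <= T -> `|f x t| <= k.

Definition inc {X} (f : X -> R -> R) (x : X) (s t : R) : R := f x t - f x s.

Section bounded.
Context {X : Type} (T : R).
Implicit Types (f g : X -> R -> R).

Lemma bd_ext f g : (forall x t, 0 <= t -> t <= T -> f x t = g x t) ->
  bd T f -> bd T g.
Proof. by move=> fg [k k0 h]; exists k => // x t t0 tT; rewrite -fg// h. Qed.

Lemma bdD f g : bd T f -> bd T g -> bd T (fun x t => f x t + g x t).
Proof.
move=> [k k0 h] [k' k'0 h']; exists (k + k'); first exact: addr_ge0.
by move=> x t t0 tT; apply: (le_trans (ler_normD _ _)); rewrite lerD ?h ?h'.
Qed.

Lemma bdM f g : bd T f -> bd T g -> bd T (fun x t => f x t * g x t).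
Proof.
move=> [k k0 h] [k' k'0 h']; exists (k * k'); first exact: mulr_ge0.
by move=> x t t0 tT; rewrite normrM ler_pM ?h ?h'.
Qed.

Lemma bdN f : bd T f -> bd T (fun x t => - f x t).
Proof. by move=> [k k0 h]; exists k => // x t t0 tT; rewrite normrN h. Qed.

Lemma bd_cst (k : R) : bd T (fun (_ : X) _ => k).
Proof. by exists `|k|. Qed.

Lemma bd_sum (I : Type) (r : seq I) (f : I -> X -> R -> R) :
  (forall i, bd T (f i)) -> bd T (fun x t => \sum_(i <- r) f i x t).
Proof.
move=> h; elim: r => [|i r IH].
  by apply: bd_ext (bd_cst 0) => x t _ _; rewrite big_nil.
by apply: bd_ext (bdD (h i) IH) => x t _ _; rewrite big_cons.
Qed.

End bounded.

Section order_calculus.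
Context {X : Type} (T : R) (w : R -> R -> R).
Hypothesis hw : control_function `[0, T] w.
Implicit Types (E F : X -> R -> R -> R) (f : X -> R -> R).

Let dom (s t : R) : 0 <= s -> s <= t -> t <= T ->
  [/\ `[0, T]%classic s, `[0, T]%classic t & 0 <= w s t].
Proof.
move=> s0 st tT; have Ds : `[0, T]%classic s by rewrite /= in_itv /= s0 (le_trans st).
have Dt : `[0, T]%classic t by rewrite /= in_itv /= tT (le_trans s0).
by split => //; exact: hw.1.
Qed.

Lemma control_le s u v t : 0 <= s -> s <= u -> u <= v -> v <= t -> t <= T ->
  w u v <= w s t.
Proof.
move=> s0 su uv vt tT; have [w0 wD] := hw.
have [Ds Dt _] := dom s0 (le_trans su (le_trans uv vt)) tT.
have [Du Dv _] := dom (le_trans s0 su) uv (le_trans vt tT).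
have h1 := wD s u t Ds Du Dt su (le_trans uv vt).
have h2 := wD u v t Du Dv Dt uv vt.
have h3 := w0 s u Ds Du su; have h4 := w0 v t Dv Dt vt.
by move: h1 h2 h3 h4; set a := w s u; set b := w u t; set c := w s t;
  set d := w u v; set e := w v t; lra.
Qed.

Lemma control_ge0 s t : 0 <= s -> s <= t -> t <= T -> 0 <= w s t.
Proof. by move=> s0 st tT; have [] := dom s0 st tT. Qed.

Lemma ord_ext al E F :
  (forall x s t, 0 <= s -> s <= t -> t <= T -> E x s t = F x s t) ->
  ord T w al E -> ord T w al F.
Proof. by move=> ef [k k0 h]; exists k => // x s t s0 st tT; rewrite -ef// h. Qed.

Lemma van_ext E F :
  (forall x s t, 0 <= s -> s <= t -> t <= T -> E x s t = F x s t) ->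
  van T E -> van T F.
Proof.
move=> ef h e /h[dl dl0 {}h]; exists dl => // x s t s0 st tT.
by rewrite -ef//; exact: h.
Qed.

Lemma ordD al E F : ord T w al E -> ord T w al F ->
  ord T w al (fun x s t => E x s t + F x s t).
Proof.
move=> [k k0 h] [k' k'0 h']; exists (k + k'); first exact: addr_ge0.
move=> x s t s0 st tT; apply: (le_trans (ler_normD _ _)).
by rewrite mulrDl lerD ?h ?h'.
Qed.

Lemma ordN al E : ord T w al E -> ord T w al (fun x s t => - E x s t).
Proof. by move=> [k k0 h]; exists k => // x s t s0 st tT; rewrite normrN h. Qed.

Lemma ordB al E F : ord T w al E -> ord T w al F ->
  ord T w al (fun x s t => E x s t - F x s t).
Proof. by move=> hE /ordN; exact: ordD. Qed.

Lemma ord_zero al : ord T w al (fun (_ : X) _ _ => 0).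
Proof. by exists 0 => // x s t _ _ _; rewrite normr0 mul0r. Qed.

Lemma ord_sum al (I : Type) (r : seq I) (E : I -> X -> R -> R -> R) :
  (forall i, ord T w al (E i)) -> ord T w al (fun x s t => \sum_(i <- r) E i x s t).
Proof.
move=> h; elim: r => [|i r IH].
  by apply: ord_ext (ord_zero al) => x s t _ _ _; rewrite big_nil.
by apply: ord_ext (ordD (h i) IH) => x s t _ _ _; rewrite big_cons.
Qed.

Lemma ordM al be E F : 0 < al -> 0 < be -> ord T w al E -> ord T w be F ->
  ord T w (al + be) (fun x s t => E x s t * F x s t).
Proof.
move=> al0 be0 [k k0 h] [k' k'0 h']; exists (k * k'); first exact: mulr_ge0.
move=> x s t s0 st tT; rewrite normrM powRD; last first.
  by apply/implyP => /eqP; move: al0 be0; lra.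
by rewrite mulrACA ler_pM ?h ?h'.
Qed.

Lemma ord_bdl al f E : bd T f -> ord T w al E ->
  ord T w al (fun x s t => f x s * E x s t).
Proof.
move=> [k k0 h] [k' k'0 h']; exists (k * k'); first exact: mulr_ge0.
move=> x s t s0 st tT; rewrite normrM -mulrA ler_pM ?h ?h'//.
exact: le_trans tT.
Qed.

Lemma ord_bdr al f E : bd T f -> ord T w al E ->
  ord T w al (fun x s t => f x t * E x s t).
Proof.
move=> [k k0 h] [k' k'0 h']; exists (k * k'); first exact: mulr_ge0.
move=> x s t s0 st tT; rewrite normrM -mulrA ler_pM ?h ?h'//.
exact: le_trans st.
Qed.

Lemma ord_le al be E : 0 < be -> be <= al -> ord T w al E -> ord T w be E.
Proof.
move=> be0 ab [k k0 h]; exists (k * w 0 T `^ (al - be)).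
  by rewrite mulr_ge0// powR_ge0.
move=> x s t s0 st tT; apply: (le_trans (h x s t s0 st tT)).
have -> : al = (al - be) + be by rewrite subrK.
rewrite powRD; last by apply/implyP; rewrite subrK => /eqP; move: be0 ab; lra.
rewrite subrK mulrA ler_wpM2r ?powR_ge0// ler_wpM2l//.
by rewrite ler_powR2 ?subr_ge0 ?control_ge0// control_le.
Qed.

Lemma ord_inc_bd al f : 0 < al -> ord T w al (inc f) ->
  (exists2 k, 0 <= k & forall x, `|f x 0| <= k) -> bd T f.
Proof.
move=> al0 [k k0 h] [k' k'0 h']; exists (k' + k * w 0 T `^ al).
  by rewrite addr_ge0// mulr_ge0// powR_ge0.
move=> x t t0 tT; have -> : f x t = f x 0 + inc f x 0 t by rewrite /inc addrC subrK.
apply: (le_trans (ler_normD _ _)); rewrite lerD//.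
apply: (le_trans (h x 0 t (lexx _) t0 tT)); rewrite ler_wpM2l//.
by rewrite ler_powR2 ?control_ge0 ?control_le// ltW.
Qed.

Lemma vanD E F : van T E -> van T F -> van T (fun x s t => E x s t + F x s t).
Proof.
move=> hE hF e e0; have e20 : 0 < e / 2 by rewrite divr_gt0.
have [d1 d10 h1] := hE _ e20; have [d2 d20 h2] := hF _ e20.
exists (Num.min d1 d2); first by rewrite lt_min d10 d20.
move=> x s t s0 st tT; rewrite lt_min => /andP[l1 l2].
by rewrite [e]splitr (le_trans (ler_normD _ _))// lerD// ?h1 ?h2.
Qed.

Lemma vanN E : van T E -> van T (fun x s t => - E x s t).
Proof.
move=> hE e /hE[dl dl0 h]; exists dl => // x s t s0 st tT l.
by rewrite normrN h.
Qed.

Lemma vanB E F : van T E -> van T F -> van T (fun x s t => E x s t - F x s t).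
Proof. by move=> hE /vanN; exact: vanD. Qed.

Lemma van0 : van T (fun (_ : X) _ _ => 0 : R).
Proof. by move=> e e0; exists 1 => // x s t _ _ _ _; rewrite normr0 ltW. Qed.

Lemma van_sum (I : Type) (r : seq I) (E : I -> X -> R -> R -> R) :
  (forall i, van T (E i)) -> van T (fun x s t => \sum_(i <- r) E i x s t).
Proof.
move=> h; elim: r => [|i r IH].
  by apply: van_ext van0 => x s t _ _ _; rewrite big_nil.
by apply: van_ext (vanD (h i) IH) => x s t _ _ _; rewrite big_cons.
Qed.

Lemma van_bd2 E F :
  (exists2 k, 0 <= k & forall x s t, 0 <= s -> s <= t -> t <= T -> `|E x s t| <= k) ->
  van T F -> van T (fun x s t => E x s t * F x s t).
Proof.
move=> [k k0 h] hF e e0; have k10 : 0 < k + 1 by rewrite ltr_wpDl.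
have [|dl dl0 h'] := hF (e / (k + 1)); first by rewrite divr_gt0.
exists dl => // x s t s0 st tT l; rewrite normrM.
apply: (@le_trans _ _ ((k + 1) * (e / (k + 1)))).
  by rewrite ler_pM ?h'// (le_trans (h _ _ _ s0 st tT))// lerDl.
by rewrite mulrC divfK// gt_eqF.
Qed.

Lemma van_bdl f E : bd T f -> van T E -> van T (fun x s t => f x s * E x s t).
Proof.
move=> [k k0 h]; apply: van_bd2; exists k => // x s t s0 st tT.
by rewrite h// (le_trans st).
Qed.

Lemma van_ordM al E F : 0 < al -> ord T w al E -> van T F ->
  van T (fun x s t => E x s t * F x s t).
Proof.
move=> al0 [k k0 h]; apply: van_bd2; exists (k * w 0 T `^ al).
  by rewrite mulr_ge0 ?powR_ge0.
move=> x s t s0 st tT; apply: (le_trans (h x s t s0 st tT)); rewrite ler_wpM2l//.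
by rewrite ler_powR2 ?control_ge0 ?control_le// ltW.
Qed.

(** Interpolation trades a bit of the order for a small factor. *)
Lemma ord_van_small al th E : 0 < th < al -> ord T w al E -> van T E ->
  forall e, 0 < e -> exists2 dl, 0 < dl & forall x s t,
    0 <= s -> s <= t -> t <= T -> t - s < dl -> `|E x s t| <= e * w s t `^ th.
Proof.
move=> /andP[th0 thal] [k k0 h] hv e e0.
have al0 : 0 < al by exact: lt_trans thal.
set ka := th / al; have ka0 : 0 < ka by rewrite divr_gt0.
have ka1 : 0 < 1 - ka by rewrite subr_gt0 ltr_pdivrMr// mul1r.
set c := k `^ ka + 1; have c0 : 0 < c by rewrite ltr_wpDl// powR_ge0.
have [|dl dl0 {}hv] := hv ((e / c) `^ (1 - ka)^-1).
  by rewrite powR_gt0// divr_gt0.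
exists dl => // x s t s0 st tT l.
have w0 := control_ge0 s0 st tT.
have -> : `|E x s t| = `|E x s t| `^ ka * `|E x s t| `^ (1 - ka).
  rewrite -powRD ?powRr1//; first by rewrite addrC subrK powRr1.
  by apply/implyP; rewrite addrC subrK oner_eq0.
have h1 : `|E x s t| `^ ka <= k `^ ka * w s t `^ th.
  have -> : w s t `^ th = (w s t `^ al) `^ ka.
    by rewrite -powRrM /ka mulrC divfK// gt_eqF.
  by rewrite -powRM ?powR_ge0// ler_powR2// ?h// ltW.
have h2 : `|E x s t| `^ (1 - ka) <= e / c.
  have -> : e / c = ((e / c) `^ (1 - ka)^-1) `^ (1 - ka).
    by rewrite -powRrM mulVf ?powRr1 ?gt_eqF// divr_ge0 ?ltW.
  by rewrite ler_powR2// ?hv// ltW.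
apply: (le_trans (ler_pM _ _ h1 h2)); rewrite ?powR_ge0//.
rewrite mulrAC ler_wpM2r ?powR_ge0// mulrCA ler_piMr ?ltW//.
by rewrite ltr_pdivrMr// mul1r ltrDl.
Qed.

End order_calculus.
End orders.

(** * The sewing lemma *)

Section sewing.
Context {R : realType} {X : Type} (T : R) (w : R -> R -> R).
Hypothesis hw : control_function `[0, T] w.

(** The defect at s <= u <= t is treated as a two-parameter function of (s, t)
    whose index contains u, so that the calculus of orders applies to it;
    clamping lets this index range over all of R. *)
Definition clamp (s t u : R) : R := Num.max s (Num.min u t).

Lemma clamp_itv (s t u : R) : s <= t -> s <= clamp s t u /\ clamp s t u <= t.
Proof. by move=> st; rewrite /clamp le_max lexx ge_max st ge_min lexx orbT. Qed.

Lemma clamp_id (s t u : R) : s <= u -> u <= t -> clamp s t u = u.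
Proof. by move=> su ut; rewrite /clamp min_l// max_r. Qed.

Definition defect (Xi : X -> R -> R -> R) (xu : X * R) (s t : R) : R :=
  Xi xu.1 s t - Xi xu.1 s (clamp s t xu.2) - Xi xu.1 (clamp s t xu.2) t.

Lemma ord_left al (E : X -> R -> R -> R) : 0 < al -> ord T w al E ->
  ord T w al (fun (xu : X * R) s t => E xu.1 s (clamp s t xu.2)).
Proof.
move=> al0 [k k0 h]; exists k => // x s t s0 st tT.
have [su ut] := clamp_itv x.2 st.
apply: (le_trans (h _ _ _ s0 su (le_trans ut tT))); rewrite ler_wpM2l//.
by rewrite ler_powR2 ?(control_ge0 hw) ?(control_le hw) ?(ltW al0)// (le_trans ut).
Qed.

Lemma ord_right al (E : X -> R -> R -> R) : 0 < al -> ord T w al E ->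
  ord T w al (fun (xu : X * R) s t => E xu.1 (clamp s t xu.2) t).
Proof.
move=> al0 [k k0 h]; exists k => // x s t s0 st tT.
have [su ut] := clamp_itv x.2 st.
apply: (le_trans (h _ _ _ (le_trans s0 su) ut tT)); rewrite ler_wpM2l//.
by rewrite ler_powR2 ?(control_ge0 hw) ?(control_le hw) ?(ltW al0)// (le_trans s0).
Qed.

Lemma van_right (E : X -> R -> R -> R) : van T E ->
  van T (fun (xu : X * R) s t => E xu.1 (clamp s t xu.2) t).
Proof.
move=> hE e /hE[dl dl0 h]; exists dl => // x s t s0 st tT l.
have [su ut] := clamp_itv x.2 st.
by rewrite h ?(le_trans s0)// (le_lt_trans _ l)// lerB.
Qed.

Lemma control_sub s t : 0 <= s -> t <= T -> control_function `[s, t] w.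
Proof.
move=> s0 tT; have [w0 wD] := hw.
have sub x : `[s, t]%classic x -> `[0, T]%classic x.
  rewrite /= !in_itv /= => /andP[sx xt].
  by rewrite (le_trans s0)// (le_trans xt).
by split=> [u v /sub + /sub|u v z /sub + /sub + /sub]; [exact: w0|exact: wD].
Qed.

Lemma chain_itv s t (l : seq R) x : path <=%R s l -> last s l = t -> x \in l ->
  `[s, t]%classic x.
Proof.
move=> sl <- xl; rewrite /= in_itv /=; apply/andP; split.
  by have /allP := order_path_min le_trans sl; apply.
case/splitPr: xl sl => l1 l2.
by rewrite cat_path last_cat /= => /and3P[_ _] /path_le_last.
Qed.

Section local.
Variables (Xi : X -> R -> R -> R) (th e : R) (x : X).
Hypotheses (th1 : 1 < th) (e0 : 0 <= e).

Definition local_defect s t : Prop := forall u v z, s <= u -> u <= v -> v <= z ->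
  z <= t -> `|Xi x u z - Xi x u v - Xi x v z| <= e * w u z `^ th.

Lemma sewing_chain s t l : 0 <= s -> s <= t -> t <= T -> local_defect s t ->
  path <=%R s l -> last s l = t ->
  `|riemann_sum (Xi x) s l - Xi x s t| <= e * sewing_const th * w s t `^ th.
Proof.
move=> s0 st tT hd sl lt.
have := @sewing_list R `[s, t]%classic w th e (Xi x) (control_sub s0 tT) th1 e0.
move=> /(_ _ s l); rewrite lt; apply => //; last 2 first.
- by rewrite /= in_itv /= lexx.
- by move=> y; exact: chain_itv.
move=> u v z; rewrite /= !in_itv /= => /andP[su _] _ /andP[_ zt] uv vz.
exact: hd.
Qed.

Lemma riemann_sum_fine dl t l m : 0 <= t -> t <= T ->
  (forall s u, 0 <= s -> s <= u -> u <= T -> u - s < dl -> local_defect s u) ->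
  itv_partition 0 t l -> mesh 0 l < dl -> itv_partition 0 t m -> subseq l m ->
  `|riemann_sum (Xi x) 0 m - riemann_sum (Xi x) 0 l|
    <= e * sewing_const th * w 0 T `^ th.
Proof.
move=> t0 tT hd pl ml pm lm.
have T0 : 0 <= T by exact: le_trans tT.
have C0 := sewing_const_gt0 th1.
have th0 : 0 < th by exact: lt_trans th1.
set k := e * sewing_const th * w 0 T `^ (th - 1).
have eC0 : 0 <= e * sewing_const th by apply: mulr_ge0 => //; exact: ltW.
have k0 : 0 <= k by apply: mulr_ge0; rewrite ?powR_ge0.
have hsub := control_sub (lexx 0) tT.
have D0 : `[0, t]%classic (0 : R) by rewrite /= in_itv /= lexx.
have Dm y : y \in m -> `[0, t]%classic y.
  by apply: chain_itv; [exact: path_lt_le pm.1|exact/eqP/pm.2].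
have el : last 0 l = t by exact/eqP/pl.2.
have := @riemann_sum_refine R _ w (Xi x) k hsub k0 0 l m D0 Dm pm.1 lm.
rewrite el (eqP pm.2) => /(_ erefl) h.
apply: le_trans (h _) _.
  move=> s u n su sn ln _.
  have [h1 h2 h3 _ _] := steps_itv pl.1 su.
  rewrite el in h3; have uT := le_trans h3 tT.
  apply: (le_trans (sewing_chain h1 (ltW h2) uT _ sn ln)).
    apply: hd => //; first exact: ltW.
    exact: le_lt_trans (mesh_ge su) ml.
  have w0 := control_ge0 hw h1 (ltW h2) uT.
  rewrite -(mulr_powRB1 w0 th0) [w s u * _]mulrC mulrA ler_wpM2r//.
  rewrite ler_wpM2l// ler_powR2 ?subr_ge0 ?(ltW th1)//.
  by rewrite (control_le hw) ?(ltW h2).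
rewrite -(mulr_powRB1 _ th0) ?(control_ge0 hw)// /k.
by rewrite [w 0 T * _]mulrC [leRHS]mulrA ler_wpM2l// (control_le hw).
Qed.

End local.

Variables (al : R) (Xi : X -> R -> R -> R).
Hypotheses (al1 : 1 < al) (hord : ord T w al (defect Xi)) (hvan : van T (defect Xi)).

Let th : R := (1 + al) / 2.
Let th1 : 1 < th. Proof. by rewrite /th; move: al1; lra. Qed.
Let thal : 0 < th < al. Proof. by rewrite /th; move: al1; lra. Qed.

Let small e : 0 < e -> exists2 dl, 0 < dl &
  forall x s t, 0 <= s -> s <= t -> t <= T -> t - s < dl -> local_defect Xi th e x s t.
Proof.
move=> /(ord_van_small hw thal hord hvan)[dl dl0 h]; exists dl => // x s t s0 st tT l.
move=> u v z su uv vz zt.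
have := h (x, v) u z (le_trans s0 su) (le_trans uv vz) (le_trans zt tT).
rewrite /defect /= clamp_id//; apply.
by apply: le_lt_trans l; rewrite lerB.
Qed.

(** Two fine partitions have close sums because both are close to the sum along
    a common refinement; the interpolated defect estimate supplies the arbitrarily
    small constant. *)
Lemma sewing_cvg x t : 0 <= t -> t <= T ->
  cvg (riemann_sum (Xi x) 0 l @[l --> mesh_to_0 0 t]).
Proof.
move=> t0 tT; have FF := mesh_to_0_filter t0.
apply/cauchy_cvgP; apply: cauchy_exP => eps eps0.
have C0 := sewing_const_gt0 th1.
set W := sewing_const th * w 0 T `^ th.
have W0 : 0 <= W by rewrite /W mulr_ge0 ?powR_ge0 ?(ltW C0).
set e := eps / (2 * (W + 1)).
have W10 : 0 < 2 * (W + 1) by rewrite mulr_gt0// ltr_wpDl.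
have e0 : 0 < e by rewrite divr_gt0.
have eW : e * W < eps / 2.
  rewrite /e mulrAC ltr_pdivrMr//.
  have -> : eps / 2 * (2 * (W + 1)) = eps * (W + 1) by field.
  by rewrite ltr_pM2l// ltrDl.
have [dl dl0 hd] := small e0.
have [l0 pl0 ml0] := exists_fine_partition t0 dl0.
exists (riemann_sum (Xi x) 0 l0).
exists dl => // l [pl ml]; rewrite /= /ball /=.
have [n [pn l0n ln]] := common_refinement pl0 pl.
have h1 := riemann_sum_fine th1 (ltW e0) t0 tT (hd x) pl0 ml0 pn l0n.
have h2 := riemann_sum_fine th1 (ltW e0) t0 tT (hd x) pl ml pn ln.
rewrite -(mulrA e) -/W in h1 h2.
rewrite distrC.
have -> : riemann_sum (Xi x) 0 l - riemann_sum (Xi x) 0 l0 =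
  (riemann_sum (Xi x) 0 n - riemann_sum (Xi x) 0 l0) -
  (riemann_sum (Xi x) 0 n - riemann_sum (Xi x) 0 l) by ring.
apply: (le_lt_trans (ler_normB _ _)).
by rewrite [ltRHS]splitr ltrD// ?(le_lt_trans h1)// (le_lt_trans h2).
Qed.

Lemma sewing_local e x s t : 0 <= e -> 0 <= s -> s <= t -> t <= T ->
  forall th', 1 < th' -> local_defect Xi th' e x s t ->
  `|inc (fun x => mesh_lim (Xi x)) x s t - Xi x s t|
    <= e * sewing_const th' * w s t `^ th'.
Proof.
move=> e0 s0 st tT th' th'1 hd; set B := leRHS.
have t0 := le_trans s0 st.
have FFs := mesh_to_0_filter s0; have FFt := mesh_to_0_filter t0.
apply/ler_addgt0Pr => r r0; have r20 : 0 < r / 2 by rewrite divr_gt0.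
have := @sewing_cvg x s s0 (le_trans st tT); move/cvgrPdist_lt/(_ _ r20) => [d1 /= d10 h1].
have := @sewing_cvg x t t0 tT; move/cvgrPdist_lt/(_ _ r20) => [d2 /= d20 h2].
have d0 : 0 < Num.min d1 d2 by rewrite lt_min d10 d20.
have [l pl ml] := exists_fine_partition s0 d0.
have [m pm mm] := exists_fine_partition st d0.
have el : last 0 l = s by exact/eqP/pl.2.
have {}h1 : `|mesh_lim (Xi x) s - riemann_sum (Xi x) 0 l| < r / 2.
  by apply: h1; split => //; rewrite (lt_le_trans ml)// ge_min lexx.
have {}h2 : `|mesh_lim (Xi x) t - riemann_sum (Xi x) 0 (l ++ m)| < r / 2.
  apply: h2; split; first exact: itv_partition_cat pl pm.
  apply: (@lt_le_trans _ _ (Num.min d1 d2)); last by rewrite ge_min lexx orbT.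
  by apply: mesh_lt_cat; rewrite ?el.
have h3 := sewing_chain th'1 e0 s0 st tT hd (path_lt_le pm.1) (eqP pm.2).
rewrite -/B riemann_sum_cat el in h2 h3; rewrite /inc.
set a := mesh_lim _ t; set b := mesh_lim _ s.
rewrite -/a -/b in h1 h2.
move: h1 h2 h3; set A := riemann_sum _ _ _; set C := riemann_sum _ _ _.
rewrite ltr_norml ltr_norml !ler_norml => /andP[? ?] /andP[? ?] /andP[? ?].
by apply/andP; split; lra.
Qed.

(** The remainder of the sewn function keeps both the order of the defect and
    its smallness near the diagonal: the first bound uses the global defect
    estimate, the second its interpolated version. *)
Lemma sewing_ord :
  ord T w al (fun x s t => inc (fun x => mesh_lim (Xi x)) x s t - Xi x s t).
Proof.
have [k k0 h] := hord; exists (k * sewing_const al).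
  by rewrite mulr_ge0// ltW// sewing_const_gt0.
move=> x s t s0 st tT; apply: sewing_local => //.
move=> u v z su uv vz zt.
have := h (x, v) u z (le_trans s0 su) (le_trans uv vz) (le_trans zt tT).
by rewrite /defect /= clamp_id.
Qed.

Lemma sewing_van :
  van T (fun x s t => inc (fun x => mesh_lim (Xi x)) x s t - Xi x s t).
Proof.
move=> r r0; set W := sewing_const th * w 0 T `^ th.
have W0 : 0 <= W by rewrite /W mulr_ge0 ?powR_ge0 ?(ltW (sewing_const_gt0 th1)).
have W10 : 0 < W + 1 by rewrite ltr_wpDl.
have e0 : 0 < r / (W + 1) by rewrite divr_gt0.
have [dl dl0 hd] := small e0; exists dl => // x s t s0 st tT l.
apply: (le_trans (sewing_local (ltW e0) s0 st tT th1 (hd x s t s0 st tT l))).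
apply: (@le_trans _ _ (r / (W + 1) * W)).
  rewrite -mulrA ler_wpM2l ?(ltW e0)// ler_wpM2l ?(ltW (sewing_const_gt0 th1))//.
  have := thal => /andP[/ltW ? _].
  by rewrite ler_powR2 ?(control_ge0 hw) ?(control_le hw).
by rewrite mulrAC ler_pdivrMr// ler_wpM2l// ?lerDl// ltW.
Qed.

End sewing.

Section additive_negligible.
Context {R : realType} {X : Type} (T : R) (w : R -> R -> R).
Hypothesis hw : control_function `[0, T] w.

(** f x t - f x 0 telescopes along fine partitions, and each increment is at
    most a small multiple of the control. *)
Lemma inc_negligible al (f : X -> R -> R) : 1 < al ->
  ord T w al (inc f) -> van T (inc f) ->
  forall x t, 0 <= t -> t <= T -> f x t = f x 0.
Proof.
move=> al1 ho hv x t t0 tT; have T0 := le_trans t0 tT.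
have h01 : 0 < (1 : R) < al by rewrite ltr01.
apply/eqP; rewrite -subr_eq0 -normr_eq0 eq_le normr_ge0 andbT.
apply/ler_addgt0Pr => e e0; rewrite add0r.
have W10 : 0 < w 0 T + 1 by rewrite ltr_wpDl// (control_ge0 hw).
have e'0 : 0 < e / (w 0 T + 1) by rewrite divr_gt0.
have [dl dl0 h] := ord_van_small hw h01 ho hv e'0.
have [l pl ml] := exists_fine_partition t0 dl0.
have -> : f x t - f x 0 = riemann_sum (inc f x) 0 l.
  rewrite -(eqP pl.2); elim: (l) (0 : R) => [|y m IH] a.
    by rewrite /riemann_sum big_nil subrr.
  by rewrite riemann_sum_cons /= -IH /inc; ring.
have hsub := control_sub hw (lexx 0) tT.
apply: (@le_trans _ _ (e / (w 0 T + 1) * w 0 t)).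
  have -> : w 0 t = w 0 (last 0 l) by rewrite (eqP pl.2).
  apply: (riemann_sum_control hsub (ltW e'0)).
  - by rewrite /= in_itv /= lexx.
  - by move=> y; apply: chain_itv; [exact: path_lt_le pl.1|exact/eqP/pl.2].
  - exact: path_lt_le pl.1.
  - move=> u v uv; have [h1 h2 h3 _ _] := steps_itv pl.1 uv.
    rewrite (eqP pl.2) in h3.
    have := h x u v h1 (ltW h2) (le_trans h3 tT).
    rewrite powRr1 ?(control_ge0 hw) ?(ltW h2) ?(le_trans h3)//; apply.
    exact: le_lt_trans (mesh_ge uv) ml.
rewrite mulrAC ler_pdivrMr// ler_wpM2l ?(ltW e0)//.
have : w 0 t <= w 0 T by rewrite (control_le hw).
by move=> /le_trans; apply; rewrite lerDl.
Qed.

End additive_negligible.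

(** * Continuity on segments *)

Section continuity_on_segments.
Context {R : realType} (T : R).
Implicit Types f g : R -> R.

(** Continuity on [0, T] in the form in which it is combined with [van]. *)
Definition econt f : Prop := forall t e, 0 <= t -> t <= T -> 0 < e ->
  exists2 dl, 0 < dl & forall s, 0 <= s -> s <= T -> `|s - t| < dl ->
    `|f s - f t| < e.

Lemma near_withinP (t : R) (P : R -> Prop) :
  (\forall s \near within `[0, T]%classic (nbhs t), P s) <->
  exists2 dl, 0 < dl & forall s, 0 <= s -> s <= T -> `|s - t| < dl -> P s.
Proof.
rewrite /prop_near1 /within /=; split.
  move=> /nbhs_ballP[dl /= dl0 h]; exists dl => // s s0 sT st.
  by apply: h; rewrite /ball /= ?in_itv /= ?s0// distrC.
move=> [dl dl0 h]; apply/nbhs_ballP; exists dl => //= s.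
by rewrite /ball /= in_itv /= distrC => st /andP[s0 sT]; exact: h.
Qed.

Lemma within_continuous_mxP m n (F : R -> 'M[R]_(m, n)) :
  {within `[0, T], continuous F} <-> forall i j, econt (fun t => F t i j).
Proof.
split=> h.
  move=> i j t e t0 tT e0.
  have tI : `[0, T]%classic t by rewrite /= in_itv /= t0.
  have := (subspace_continuousP `[0, T]%classic F).1 h t tI.
  move=> /cvg_ballP/(_ e e0)/near_withinP[dl dl0 {}h]; exists dl => // s s0 sT st.
  by have := h s s0 sT st; case=> _ /(_ i j); rewrite /ball /= distrC.
apply/subspace_continuousP => t; rewrite /= in_itv /= => /andP[t0 tT].
apply/cvg_ballP => e e0.
have : \forall s \near within `[0, T]%classic (nbhs t),
    forall ij : 'I_m * 'I_n, ball (F t ij.1 ij.2) e (F s ij.1 ij.2).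
  apply: filter_forall => -[i j]; apply/near_withinP.
  have [dl dl0 {}h] := h i j t e t0 tT e0; exists dl => // s s0 sT st.
  by rewrite /ball /= distrC; exact: h.
by apply: filterS => s hs; split => // i j; exact: (hs (i, j)).
Qed.

Lemma within_continuousP f : {within `[0, T], continuous f} <-> econt f.
Proof.
split=> h.
  move=> t e t0 tT e0.
  have tI : `[0, T]%classic t by rewrite /= in_itv /= t0.
  have := (subspace_continuousP `[0, T]%classic f).1 h t tI.
  move=> /cvg_ballP/(_ e e0)/near_withinP[dl dl0 {}h]; exists dl => // s s0 sT st.
  by have := h s s0 sT st; rewrite /ball /= distrC.
apply/subspace_continuousP => t; rewrite /= in_itv /= => /andP[t0 tT].
apply/cvg_ballP => e e0; apply/near_withinP.
have [dl dl0 {}h] := h t e t0 tT e0; exists dl => // s s0 sT st.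
by rewrite /ball /= distrC; exact: h.
Qed.

Lemma econt_ext f g : (forall t, 0 <= t -> t <= T -> f t = g t) ->
  econt f -> econt g.
Proof.
move=> fg h t e t0 tT e0; have [dl dl0 {}h] := h t e t0 tT e0.
by exists dl => // s s0 sT st; rewrite -!fg// h.
Qed.

Lemma econt_cst (k : R) : econt (fun _ => k).
Proof. by move=> t e t0 tT e0; exists 1 => // s _ _ _; rewrite subrr normr0. Qed.

Lemma econtD f g : econt f -> econt g -> econt (fun t => f t + g t).
Proof.
move=> /within_continuousP hf /within_continuousP hg; apply/within_continuousP.
by move=> t; apply: (@continuousD R R (subspace `[0, T]%classic)); [exact: hf|exact: hg].
Qed.

Lemma econtM f g : econt f -> econt g -> econt (fun t => f t * g t).
Proof.
move=> /within_continuousP hf /within_continuousP hg; apply/within_continuousP.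
by move=> t; apply: (@continuousM R (subspace `[0, T]%classic)); [exact: hf|exact: hg].
Qed.

Lemma econtN f : econt f -> econt (fun t => - f t).
Proof.
move=> h; apply: econt_ext (econtM (econt_cst (-1)) h) => t _ _.
by rewrite mulN1r.
Qed.

Lemma econtB f g : econt f -> econt g -> econt (fun t => f t - g t).
Proof. by move=> hf /econtN; exact: econtD. Qed.

Lemma econt_sum (I : Type) (r : seq I) (f : I -> R -> R) :
  (forall i, econt (f i)) -> econt (fun t => \sum_(i <- r) f i t).
Proof.
move=> h; elim: r => [|i r IH].
  by apply: econt_ext (econt_cst 0) => t _ _; rewrite big_nil.
by apply: econt_ext (econtD (h i) IH) => t _ _; rewrite big_cons.
Qed.

Lemma econt_comp f g : (forall t, 0 <= t -> t <= T -> {for f t, continuous g}) ->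
  econt f -> econt (fun t => g (f t)).
Proof.
move=> hg hf t e t0 tT e0.
have /cvg_ballP/(_ e e0)/nbhs_ballP[eta /= eta0 h] := hg t t0 tT.
have [dl dl0 {}hf] := hf t eta t0 tT eta0; exists dl => // s s0 sT st.
have := h (f s); rewrite /ball /= distrC => /(_ (hf s s0 sT st)).
by rewrite distrC.
Qed.

Lemma econtV f : (forall t, 0 <= t -> t <= T -> f t != 0) -> econt f ->
  econt (fun t => (f t)^-1).
Proof. by move=> h; apply: econt_comp => t t0 tT; exact/inv_continuous/h. Qed.

(** Heine: the family of moduli is indexed by the compact [0, T]. *)
Lemma econt_van f : econt f -> forall X : Type, van T (inc (fun _ : X => f)).
Proof.
move=> hf X e e0.
have := (compact_near_coveringP _).1 (@segment_compact _ 0 T).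
move=> /(_ R (0 : R)^'+
  (fun dl t => forall s, 0 <= t -> t <= T -> 0 <= s -> s <= T -> `|s - t| < dl -> `|f s - f t| < e)).
case.
  move=> t; rewrite /= in_itv /= => /andP[t0 tT].
  have e20 : 0 < e / 2 by rewrite divr_gt0.
  have [dl dl0 h] := hf t _ t0 tT e20.
  have dl20 : 0 < dl / 2 by rewrite divr_gt0.
  exists (ball t (dl / 2), [set u | u < dl / 2]); first split => /=.
  + exact: nbhsx_ballx.
  + exact: nbhs_right_lt.
  move=> [t' u] /= [tt' udl] s t'0 t'T s0 sT st'.
  have tt'2 : `|t' - t| < dl / 2 by rewrite distrC.
  have st : `|s - t| < dl.
    have -> : s - t = (s - t') + (t' - t) by ring.
    by rewrite (le_lt_trans (ler_normD _ _))// [ltRHS]splitr ltrD// (lt_trans st').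
  have -> : f s - f t' = (f s - f t) - (f t' - f t) by ring.
  rewrite (le_lt_trans (ler_normB _ _))// [ltRHS]splitr ltrD// h//.
  by rewrite (lt_trans tt'2)// gtr_pMr// invf_lt1// ltr1n.
move=> r /= r0 h; have r20 : 0 < r / 2 by rewrite divr_gt0.
exists (r / 2) => // x s t s0 st tT ts; rewrite /inc ltW//.
have s_I : `[0, T]%classic s by rewrite /= in_itv /= s0 (le_trans st).
apply: (h (r / 2) _ r20 s s_I) => //; rewrite ?(le_trans s0)//.
- by rewrite /ball_ /= sub0r normrN gtr0_norm// gtr_pMr// invf_lt1// ltr1n.
- exact: le_trans tT.
- by rewrite ger0_norm// subr_ge0.
Qed.

Lemma econt_bd {X : Type} f : 0 <= T -> econt f -> bd T (fun (_ : X) => f).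
Proof.
move=> T0 /within_continuousP hc.
have [M _ hM] := EVT_max T0 hc; have [m _ hm] := EVT_min T0 hc.
exists (`|f M| + `|f m|); first exact: addr_ge0.
move=> _ t t0 tT; have tI : t \in `[0, T] by rewrite in_itv /= t0.
have h1 := hM t tI; have h2 := hm t tI.
have := ler_norm (f M); have := ler_norm (- f m); rewrite normrN.
have := normr_ge0 (f M); have := normr_ge0 (f m).
by move=> ? ? ? ?; rewrite ler_norml; apply/andP; split; move: h1 h2; lra.
Qed.

End continuity_on_segments.

(** * Variation bounds and grids *)

Section sup_ratios.
Context {R : realType}.

Lemma enorm_ge {m n} (A : 'M[R]_(m, n)) i j : `|A i j| <= enorm A.
Proof.
rewrite /enorm -sqrtr_sqr ler_wsqrtr// (bigD1 i)//= (bigD1 j)//= -addrA lerDl.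
apply: addr_ge0; apply: sumr_ge0 => k _; first exact: sqr_ge0.
by apply: sumr_ge0 => ? _; exact: sqr_ge0.
Qed.

Lemma enorm_ge0 {m n} (A : 'M[R]_(m, n)) : 0 <= enorm A.
Proof. exact: sqrtr_ge0. Qed.

Lemma enorm_le {m n} (A : 'M[R]_(m, n)) k : 0 <= k ->
  (forall i j, `|A i j| <= k) -> enorm A <= Num.sqrt (m * n)%:R * k.
Proof.
move=> k0 h; rewrite -[k in _ * k](ger0_norm k0) -sqrtr_sqr -sqrtrM ?ler0n// /enorm.
apply: ler_wsqrtr.
have -> : (m * n)%:R * k ^+ 2 = \sum_(i < m) \sum_(j < n) k ^+ 2.
  under eq_bigr do rewrite sumr_const card_ord.
  by rewrite sumr_const card_ord -mulrnA mulr_natl mulnC.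
apply: ler_sum => i _; apply: ler_sum => j _.
by rewrite -real_normK ?num_real// lerXn2r ?nnegrE.
Qed.

Lemma enorm0 {m n} : enorm (0 : 'M[R]_(m, n)) = 0.
Proof.
by rewrite /enorm big1 ?sqrtr0// => i _; rewrite big1// => j _; rewrite mxE expr0n.
Qed.

Lemma equot_ge0 (x y : R) : 0 <= x -> 0 <= y -> (0 <= equot x y)%E.
Proof.
move=> x0 y0; rewrite /equot; case: ifP => _; last by rewrite lee_fin divr_ge0.
by case: ifP.
Qed.

Lemma equot_le1 (x y : R) : 0 <= y -> (equot x y <= 1)%E -> x <= y.
Proof.
move=> y0; rewrite /equot; case: ifPn => [/eqP->|yn0].
  by case: ifPn => [/eqP->//|_]; rewrite leye_eq.
by rewrite lee_fin ler_pdivrMr ?mul1r// lt_neqAle eq_sym yn0.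
Qed.

Lemma sup_ratio_ge0 {m n} (D : R -> R -> Prop) a (A : R -> R -> 'M[R]_(m, n)) c s t :
  D s t -> 0 <= c s t -> (0 <= sup_ratio D a A c)%E.
Proof.
move=> Dst c0; apply: (@le_trans _ _ (equot (enorm (A s t) `^ a) (c s t))).
  by rewrite equot_ge0// powR_ge0.
by apply: ereal_sup_ubound; exists s, t.
Qed.

Lemma sup_ratio_le1 {m n} (D : R -> R -> Prop) a (A : R -> R -> 'M[R]_(m, n)) c :
  (sup_ratio D a A c <= 1)%E -> forall s t, D s t -> 0 <= c s t ->
  enorm (A s t) `^ a <= c s t.
Proof.
move=> h s t Dst c0; apply: equot_le1 => //; apply: le_trans h.
by apply: ereal_sup_ubound; exists s, t.
Qed.

Lemma powR_le_root (x y a : R) : 0 < a -> 0 <= x -> x `^ a <= y -> x <= y `^ a^-1.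
Proof.
move=> a0 x0 xy; have -> : x = (x `^ a) `^ a^-1.
  by rewrite -powRrM divff ?powRr1// gt_eqF.
by rewrite ler_powR2 ?powR_ge0// invr_ge0 ltW.
Qed.

End sup_ratios.

Section partition_traces.
Context {R : realType}.
Implicit Types (tau : nat -> R) (T t : R).

Lemma partition_upto_spec tau T : 0 < T ->
  itv_partition 0 T (partition_upto tau T) ->
  [set` 0 :: partition_upto tau T] = (range tau `|` [set T]) `&` `[0, T].
Proof.
rewrite /partition_upto => T0; case: xgetP => [l _ [_ ->] //|_].
by move=> /itv_partition_nil T00; rewrite T00 ltxx in T0.
Qed.

Lemma partition_upto_mem tau T : 0 < T ->
  itv_partition 0 T (partition_upto tau T) -> forall x,
  (x \in partition_upto tau T) <-> (0 < x <= T /\ (range tau x \/ x = T)).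
Proof.
move=> T0 pT x; have := partition_upto_spec T0 pT.
set l := partition_upto tau T in pT *; move=> /seteqP[s1 s2].
split=> [xl|[/andP[x0 xT] h]].
  have /andP[x0 xT] := itv_partition_mem pT xl; rewrite x0 xT; split => //.
  by have [] := s1 x; rewrite /= ?inE ?xl ?orbT// => -[]; tauto.
have := s2 x; rewrite /= in_itv /= xT (ltW x0) inE (gt_eqF x0) /=; apply.
by split => //; case: h; tauto.
Qed.

(** The grids on [0, t] and [0, T] agree below t; hence integrals built on
    different horizons are consistent. *)
Lemma partition_upto_restrict tau T t : 0 < t -> t <= T ->
  itv_partition 0 T (partition_upto tau T) ->
  itv_partition 0 t (partition_upto tau t) ->
  partition_upto tau t = rcons [seq x <- partition_upto tau T | x < t] t.
Proof.
move=> t0 tT pT pt; have T0 := lt_le_trans t0 tT.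
have mT := partition_upto_mem T0 pT; have mt := partition_upto_mem t0 pt.
set lT := partition_upto tau T in pT mT *; set lt := partition_upto tau t in pt mt *.
have slT := path_sorted pT.1.
apply: lt_sorted_eq; first exact: path_sorted pt.1.
  have [->//|b] := eqVneq lT [::].
  apply: (@path_sorted _ _ 0); rewrite rcons_path; apply/andP; split.
    by rewrite path_filter//; [exact: lt_trans|exact: pT.1].
  have := mem_last 0 [seq x <- lT | x < t]; rewrite inE => /predU1P[->//|].
  by rewrite mem_filter => /andP[].
move=> x; rewrite mem_rcons inE mem_filter; apply/idP/idP.
  move=> /mt[/andP[x0 xt]] h; have [//|xnt /=] := eqVneq x t.
  rewrite lt_neqAle xnt xt /=; apply/mT; rewrite x0 (le_trans xt)//; split => //.
  by case: h => [|/eqP]; [left|rewrite (negbTE xnt)].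
move=> /predU1P[->|/andP[xt /mT[/andP[x0 xT] h]]]; apply/mt.
  by rewrite t0 lexx; split => //; right.
rewrite x0 ltW//; split => //; case: h => [|xT']; first by left.
by move: xt; rewrite xT' ltNge tT.
Qed.

Lemma stopped_past (f g : R -> R) x l t : path <%R x l -> t <= x ->
  \sum_(w <- steps x l) f w.1 * (g (Num.min w.2 t) - g (Num.min w.1 t)) = 0.
Proof.
elim: l x => [|y m IH] x; first by rewrite big_nil.
move=> /= /andP[xy ym] tx; have ty := le_trans tx (ltW xy).
by rewrite steps_cons big_cons /= IH// !min_r// subrr mulr0 addr0.
Qed.

(** The increments stopped at t vanish beyond t, so that only the trace of the
    partition on [0, t] contributes. *)
Lemma stopped_sum (f g : R -> R) a l t : path <%R a l -> a < t -> t <= last a l ->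
  \sum_(w <- steps a l) f w.1 * (g (Num.min w.2 t) - g (Num.min w.1 t)) =
  \sum_(w <- steps a (rcons [seq x <- l | x < t] t)) f w.1 * (g w.2 - g w.1).
Proof.
elim: l a => [|x l IH] a /=; first by move=> _ at_ /(lt_le_trans at_); rewrite ltxx.
move=> /andP[ax xl] at_ tl; rewrite !steps_cons !big_cons /= (min_l (ltW at_)).
case: (ltP x t) => xt.
  by rewrite rcons_cons steps_cons big_cons /= IH.
rewrite stopped_past// addr0.
have -> : [seq y <- l | y < t] = [::].
  apply/eqP; rewrite -size_eq0 size_filter -leqn0 leqNgt -has_count.
  apply/hasPn => y yl; rewrite -leNgt (le_trans xt)// ltW//.
  by have /allP := order_path_min lt_trans xl; apply.
by rewrite steps_cons big_cons big_nil /= addr0.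
Qed.

End partition_traces.

(** * The rough path of a price path *)

Section rough_path_lift.
Context {R : realType} {d : nat}.
Variables (p : R) (S : R -> 'cV[R]_d) (P : nat -> nat -> R).
Hypotheses (p2 : 2 < p) (hS : price_path_along p S P).

Let p0 : 0 < p. Proof. exact: lt_trans p2. Qed.

Lemma left_sumE l t i j : left_sum S l t i j =
  \sum_(w <- steps 0 l) S w.1 i ord0 *
    (S (Num.min w.2 t) j ord0 - S (Num.min w.1 t) j ord0).
Proof.
rewrite /left_sum summxE; apply: eq_bigr => w _.
by rewrite !mxE big_ord1 !mxE.
Qed.

Lemma level2E s t i j : level2 S P s t i j =
  SdS S P t i j - SdS S P s i j - S s i ord0 * (S t j ord0 - S s j ord0).
Proof. by rewrite /level2 /incr !mxE big_ord1 !mxE. Qed.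

Lemma bracketE t i j : bracket S P t i j =
  (S t i ord0 - S 0 i ord0) * (S t j ord0 - S 0 j ord0)
  - level2 S P 0 t i j - level2 S P 0 t j i.
Proof.
rewrite /bracket /Sym /incr !mxE big_ord1 !mxE.
set a := level2 S P 0 t i j; set b := level2 S P 0 t j i.
by rewrite mulrA divff ?pnatr_eq0// mul1r opprD addrA.
Qed.

Lemma chen s u t i j : level2 S P s t i j =
  level2 S P s u i j + level2 S P u t i j
  + (S u i ord0 - S s i ord0) * (S t j ord0 - S u j ord0).
Proof.
have alg (l l1 l2 x y z si ui sj uj tj : R) : l = z - x - si * (tj - sj) ->
    l1 = y - x - si * (uj - sj) -> l2 = z - y - ui * (tj - uj) ->
    l = l1 + l2 + (ui - si) * (tj - uj).
  by move=> -> -> ->; ring.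
exact: alg (level2E s t i j) (level2E s u i j) (level2E u t i j).
Qed.

Lemma bracket_inc s t i j : bracket S P t i j - bracket S P s i j =
  (S t i ord0 - S s i ord0) * (S t j ord0 - S s j ord0)
  - level2 S P s t i j - level2 S P s t j i.
Proof.
have alg (bt bs l l1 l2 l' l1' l2' i0 si ti j0 sj tj : R) :
    bt = (ti - i0) * (tj - j0) - l - l' -> bs = (si - i0) * (sj - j0) - l1 - l1' ->
    l = l1 + l2 + (si - i0) * (tj - sj) -> l' = l1' + l2' + (sj - j0) * (ti - si) ->
    bt - bs = (ti - si) * (tj - sj) - l2 - l2'.
  by move=> -> -> -> ->; ring.
exact: alg (bracketE t i j) (bracketE s i j) (chen 0 s t i j) (chen 0 s t j i).
Qed.

Let pu n T := partition_upto (P n) T.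

Lemma pu_itv n T : 0 < T -> itv_partition 0 T (pu n T).
Proof. by move=> T0; have [_ _ _ /(_ T T0)[h _ _ _]] := hS; exact: h. Qed.

Lemma left_sum_upto n t T : 0 <= t -> t <= T -> 0 < T ->
  left_sum S (pu n t) t = left_sum S (pu n T) t.
Proof.
move=> t0 tT T0; apply/matrixP => i j; rewrite !left_sumE.
have pT := pu_itv n T0.
have [t00|tn0] := eqVneq t 0.
  have -> : pu n t = [::].
    rewrite t00 /pu /partition_upto; case: xgetP => [l _ [pl _]|//].
    exact: itv_partitionxx pl.
  rewrite big_nil big_seq big1// => -[u v] /(steps_itv pT.1)[h1 h2 _ _ _] /=.
  have v0 := le_trans h1 (ltW h2).
  by rewrite t00 !min_r// subrr mulr0.
have {}t0 : 0 < t by rewrite lt_neqAle eq_sym tn0.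
have pt := pu_itv n t0.
rewrite (stopped_sum (fun u => S u i ord0) (fun u => S u j ord0) pt.1 t0)//; last first.
  by rewrite (eqP pt.2).
rewrite (stopped_sum (fun u => S u i ord0) (fun u => S u j ord0) pT.1 t0)//; last first.
  by rewrite (eqP pT.2).
have := partition_upto_restrict t0 tT pT pt; rewrite -/(pu n t) -/(pu n T) => <-.
have := partition_upto_restrict t0 (lexx t) pt pt; rewrite -/(pu n t) => <-//.
Qed.

(** The integral up to t is the limit along the grids of horizon t, but it
    agrees with the uniform limit given by (RIE) on any larger horizon. *)
Lemma SdS_uniform T e : 0 < T -> 0 < e ->
  \forall n \near \oo, forall t i j, 0 <= t -> t <= T ->
    `|SdS S P t i j - left_sum S (pu n T) t i j| < e.
Proof.
move=> T0 e0; have [_ _ _ /(_ T T0)[_ _ [I hI] _]] := hS.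
have near_I e' : 0 < e' -> \forall n \near \oo, forall t, 0 <= t -> t <= T ->
    ball (I t) e' (left_sum S (pu n T) t).
  move=> e'0.
  apply: (hI [set g : R -> 'M[R]_d | forall t, 0 <= t -> t <= T -> ball (I t) e' (g t)]).
  apply/uniform_nbhs; exists [set xy | ball xy.1 e' xy.2]; split.
      exact: (@entourage_ball R 'M[R]_d (PosNum e'0)).
  by move=> g hg t t0 tT /=; apply: hg; rewrite /= in_itv /= t0.
have SdSI t : 0 <= t -> t <= T -> SdS S P t = I t.
  move=> t0 tT; rewrite /SdS; apply/cvg_lim; first exact: norm_hausdorff.
  apply/cvg_ballP => e' e'0; have := near_I _ e'0.
  by apply: filterS => n /(_ t t0 tT); rewrite -(left_sum_upto n t0 tT T0).
have := near_I _ e0; apply: filterS => n h t i j t0 tT.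
by have [_ /(_ i j)] := h t t0 tT; rewrite SdSI.
Qed.

Lemma econt_S T i : econt T (fun t => S t i ord0).
Proof.
have [h _ _ _] := hS; apply: (within_continuous_mxP T S).1.
by apply: continuous_subspaceW h => t; rewrite /= !in_itv /= andbT => /andP[].
Qed.

Lemma van_S {X : Type} T i : van T (inc (fun (_ : X) t => S t i ord0)).
Proof. exact/econt_van/econt_S. Qed.

Lemma bd_S {X : Type} T i : bd T (fun (_ : X) t => S t i ord0).
Proof.
have [T0|T0] := leP 0 T; last first.
  by exists 0 => // x t t0 /(le_trans t0); rewrite leNgt T0.
exact: econt_bd T0 (@econt_S T i).
Qed.

Lemma van_left_sum {X : Type} T l i j : 0 < T -> itv_partition 0 T l ->
  van T (inc (fun (_ : X) t => left_sum S l t i j)).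
Proof.
move=> T0 pl.
have stop (v : R) : 0 <= v ->
    van T (inc (fun (_ : X) t => S (Num.min v t) j ord0)).
  move=> v0 e e0; have [dl dl0 h] := @van_S X T j e e0; exists dl => // x s t s0 st tT l0.
  have m0 u : s <= u -> 0 <= Num.min v u by move=> su; rewrite le_min v0 (le_trans s0).
  apply: h; rewrite ?m0//.
  - by rewrite le_min !ge_min lexx st orbT.
  - by rewrite ge_min tT orbT.
  - apply: le_lt_trans l0; case: (leP v t) => h1; case: (leP v s) => h2; move: st h1 h2; lra.
pose E (w : R * R) (_ : X) s t := (if (0 <= w.1) && (0 <= w.2) then S w.1 i ord0 else 0) *
    ((S (Num.min w.2 t) j ord0 - S (Num.min w.2 s) j ord0)
   - (S (Num.min w.1 t) j ord0 - S (Num.min w.1 s) j ord0)).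
have hE w : van T (E w).
  rewrite /E; case: ifPn => [/andP[w1 w2]|_]; last first.
    by apply: van_ext (@van0 R X T) => x s t _ _ _; rewrite mul0r.
  apply: (@van_bdl R X T (fun _ _ => S w.1 i ord0)); first exact: bd_cst.
  by apply: vanB; exact: stop.
apply: van_ext (van_sum (steps 0 l) hE) => x s t s0 st tT.
rewrite /inc !left_sumE -sumrB; apply: eq_big_seq => -[u v] uv.
have [h1 h2 _ _ _] := steps_itv pl.1 uv.
by rewrite /E /= h1 (le_trans h1 (ltW h2)) /=; ring.
Qed.

Lemma van_SdS {X : Type} T i j : 0 < T -> van T (inc (fun (_ : X) t => SdS S P t i j)).
Proof.
move=> T0 e e0; have e30 : 0 < e / 3 by rewrite divr_gt0.
have [n hn] := filter_ex (SdS_uniform T0 e30).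
have [dl dl0 h] := @van_left_sum X T (pu n T) i j T0 (pu_itv n T0) _ e30.
have three_eps (x x' y y' : R) : `|x - x'| < e / 3 -> `|y - y'| < e / 3 ->
    `|y' - x'| <= e / 3 -> `|y - x| <= e.
  by rewrite !ltr_norml !ler_norml => /andP[? ?] /andP[? ?] /andP[? ?]; apply/andP; split; lra.
exists dl => // x s t s0 st tT l.
apply: three_eps (h x s t s0 st tT l); first exact: hn s i j s0 (le_trans st tT).
exact: hn t i j (le_trans s0 st) tT.
Qed.

Lemma van_level2 {X : Type} T i j : 0 < T -> van T (fun (_ : X) s t => level2 S P s t i j).
Proof.
move=> T0; apply: van_ext (vanB (@van_SdS X T i j T0)
  (van_bdl (@bd_S X T i) (@van_S X T j))) => x s t _ _ _.
by rewrite level2E.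
Qed.

Lemma straddling_step a (l : seq R) t : a <= t -> t <= last a l -> l != [::] ->
  exists u v, (u, v) \in steps a l /\ u <= t <= v.
Proof.
elim: l a => // x l IH a at_ tb _.
have [tx|xt] := leP t x.
  by exists a, x; rewrite steps_cons mem_head at_ tx.
have l0 : l != [::] by apply: contraTneq xt => l0; rewrite -leNgt; move: tb; rewrite l0.
have [u [v [uv h]]] := IH x (ltW xt) tb l0.
by exists u, v; rewrite steps_cons inE uv orbT.
Qed.

(** (RIE) bounds the second level only between grid points of the discretised
    integral.  For arbitrary s < t one takes a grid point just after s and one
    just before t, splits by Chen's relation and lets the mesh tend to 0:
    the boundary terms vanish because S and its integral are continuous, while
    monotonicity of c handles the inner grid interval. *)
Lemma rough_path_bound T : 0 < T -> exists c, [/\ control_function `[0, T] c,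
  forall s t i, 0 <= s -> s <= t -> t <= T ->
    `|S t i ord0 - S s i ord0| <= c s t `^ p^-1,
  forall s t i j, 0 <= s -> s <= t -> t <= T ->
    `|level2 S P s t i j| <= c s t `^ (2 / p) &
  forall n u v i j, u \in 0 :: pu n T -> v \in 0 :: pu n T -> u <= v ->
    `|left_sum S (pu n T) v i j - left_sum S (pu n T) u i j
      - S u i ord0 * (S v j ord0 - S u j ord0)| <= c u v `^ (2 / p)].
Proof.
move=> T0; have [_ _ _ /(_ T T0)[_ hmesh _ [c hc hsup]]] := hS.
exists c.
have DT u v : 0 <= u -> u <= v -> v <= T -> 0 <= c u v.
  by move=> *; exact: (control_ge0 hc).
have mem n x : x \in 0 :: pu n T -> 0 <= x /\ x <= T.
  rewrite inE => /predU1P[->|/(itv_partition_mem (pu_itv n T0))/andP[/ltW]//].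
  by rewrite lexx ltW.
set sr1 := sup_ratio _ _ _ _ in hsup; set sr2 := ereal_sup _ in hsup.
have sr10 : (0 <= sr1)%E by apply: (@sup_ratio_ge0 _ _ _ _ _ _ _ 0 0); [by rewrite lexx ltW|by apply: DT => //; exact: ltW].
pose D2 n u v := [/\ u \in 0 :: pu n T, v \in 0 :: pu n T & u < v].
pose A2 n u v := left_sum S (pu n T) v - left_sum S (pu n T) u - S u *m (incr S u v)^T.
pose sr2n n := sup_ratio (D2 n) (p / 2) (A2 n) c.
have sr2n0 n : (0 <= sr2n n)%E.
  apply: (@sup_ratio_ge0 _ _ _ _ _ _ _ 0 T); last by rewrite DT// ltW.
  split => //; first exact: mem_head.
  by have := mem_last 0 (pu n T); rewrite (eqP (pu_itv n T0).2).
have sr2le n : (sr2n n <= sr2)%E by apply: ereal_sup_ubound; exists n.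
have sr20 : (0 <= sr2)%E by exact: le_trans (sr2n0 0%N) (sr2le 0%N).
have sr11 : (sr1 <= 1)%E by apply: le_trans hsup; rewrite leeDl.
have sr21 n : (sr2n n <= 1)%E.
  by apply: le_trans (sr2le n) _; apply: le_trans hsup; rewrite leeDr.
have grid n u v i j : u \in 0 :: pu n T -> v \in 0 :: pu n T -> u <= v ->
    `|left_sum S (pu n T) v i j - left_sum S (pu n T) u i j
      - S u i ord0 * (S v j ord0 - S u j ord0)| <= c u v `^ (2 / p).
  move=> un vn; rewrite le_eqVlt => /predU1P[->|uv].
    by rewrite !subrr mulr0 subrr normr0 powR_ge0.
  have [u0 uT] := mem n u un; have [v0 vT] := mem n v vn.
  have h := sup_ratio_le1 (sr21 n) (And3 un vn uv) (DT u v u0 (ltW uv) vT).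
  have p20 : 0 < p / 2 by rewrite divr_gt0.
  have := powR_le_root p20 (enorm_ge0 _) h; rewrite invf_div.
  by apply: le_trans; apply: le_trans (enorm_ge _ i j); rewrite /A2 /incr !mxE big_ord1 !mxE.
split => //.
  move=> s t i s0 st tT.
  have Dst : (fun s t => 0 <= s <= t /\ t <= T) s t by rewrite s0 st.
  have := powR_le_root p0 (enorm_ge0 _) (sup_ratio_le1 sr11 Dst (DT s t s0 st tT)).
  by apply: le_trans; apply: le_trans (enorm_ge _ i ord0); rewrite /incr !mxE.
have third (x y x' y' z : R) : x' - x < z -> y - y' < z -> x < y -> z <= (y - x) / 3 ->
    x' <= y' by lra.
move=> s t i j s0; rewrite le_eqVlt => /predU1P[->|st] tT.
  by rewrite level2E !subrr mulr0 subrr normr0 powR_ge0.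
apply/ler_addgt0Pr => e e0.
have e80 : 0 < e / 8 by rewrite divr_gt0.
have st0 : 0 < (t - s) / 3 by rewrite divr_gt0// subr_gt0.
have [k k0 hk] := @bd_S unit T i; have [k' k'0 hk'] := @bd_S unit T j.
have k10 : 0 < 8 * (k + k' + 1) by rewrite mulr_gt0// ltr_wpDl// addr_ge0.
set eta := e / (8 * (k + k' + 1)).
have eta0 : 0 < eta by rewrite divr_gt0.
have [d1 d10 h1] := @van_level2 unit T i j T0 _ e80.
have [d2 d20 h2] := @van_S unit T i _ eta0.
have [d3 d30 h3] := @van_S unit T j _ eta0.
set dl := Num.min (Num.min d1 d2) (Num.min d3 ((t - s) / 3)).
have dl0 : 0 < dl by rewrite !lt_min d10 d20 d30.
have hB : \forall n \near \oo, mesh 0 (pu n T) < dl.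
  have /cvgrPdist_lt/(_ _ dl0) := hmesh.
  by apply: filterS => n; rewrite sub0r normrN; apply: le_lt_trans; exact: ler_norm.
have [n [hn hmn]] := filter_ex (filterI (SdS_uniform T0 e80) hB).
have pT := pu_itv n T0.
have t0 := le_trans s0 (ltW st).
have sT := le_trans (ltW st) tT.
have pn0 : pu n T != [::].
  by apply: contraTneq T0 => p0'; move: pT; rewrite p0' => /itv_partition_nil <-; rewrite ltxx.
have [|u1 [u [uv1 /andP[u1s su]]]] := @straddling_step 0 (pu n T) s s0 _ pn0.
  by rewrite (eqP pT.2).
have [|v [v1 [vv1 /andP[vt tv1]]]] := @straddling_step 0 (pu n T) t t0 _ pn0.
  by rewrite (eqP pT.2).
have := mesh_ge uv1; have := mesh_ge vv1.
have [_ _ uT _ un'] := steps_itv pT.1 uv1; have [v0 _ _ vn _] := steps_itv pT.1 vv1.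
rewrite (eqP pT.2) in uT.
have un : u \in 0 :: pu n T by rewrite inE un' orbT.
move=> mv mu.
have sdl : u - s < dl by exact: le_lt_trans (le_trans (lerB (lexx u) u1s) mu) hmn.
have tdl : t - v < dl by exact: le_lt_trans (le_trans (lerB tv1 (lexx v)) mv) hmn.
have uv : u <= v.
  have : dl <= (t - s) / 3 by rewrite !ge_min lexx !orbT.
  exact: third sdl tdl st.
have u0 := le_trans s0 su; have vT := le_trans vt tT.
move: sdl tdl; rewrite !lt_min => /andP[/andP[su1 su2] /andP[su3 _]] /andP[/andP[tv1' tv2] /andP[tv3 _]].
have g := grid n u v i j un vn uv.
have w_uv : c u v `^ (2 / p) <= c s t `^ (2 / p).
  by rewrite ler_powR2 ?DT ?(control_le hc)// divr_ge0// ltW.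
have a1 := h1 tt s u s0 su uT su1; have a2 := h1 tt v t v0 vt tT tv1'.
have b1 := h2 tt s u s0 su uT su2; have b3 := h3 tt v t v0 vt tT tv3.
have c1 := hn u i j u0 uT; have c2 := hn v i j v0 vT.
have e1 := hk' tt u u0 uT; have e2 := hk' tt v v0 vT.
have e3 := hk tt s s0 sT; have e4 := hk tt v v0 vT.
have -> : level2 S P s t i j =
    (left_sum S (pu n T) v i j - left_sum S (pu n T) u i j - S u i ord0 * (S v j ord0 - S u j ord0))
  + (SdS S P v i j - left_sum S (pu n T) v i j) - (SdS S P u i j - left_sum S (pu n T) u i j)
  + level2 S P s u i j + level2 S P v t i j
  + (S u i ord0 - S s i ord0) * (S v j ord0 - S u j ord0)
  + (S v i ord0 - S s i ord0) * (S t j ord0 - S v j ord0).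
  have alg (lst lsu lvt zs zu zv zt a b si ui vi sj uj vj tj : R) :
      lst = zt - zs - si * (tj - sj) -> lsu = zu - zs - si * (uj - sj) ->
      lvt = zt - zv - vi * (tj - vj) ->
      lst = (a - b - ui * (vj - uj)) + (zv - a) - (zu - b) + lsu + lvt
        + (ui - si) * (vj - uj) + (vi - si) * (tj - vj).
    by move=> -> -> ->; ring.
  exact: alg (level2E s t i j) (level2E s u i j) (level2E v t i j).
have m1 : `|(S u i ord0 - S s i ord0) * (S v j ord0 - S u j ord0)| <= eta * (2 * k').
  rewrite normrM ler_pM// (le_trans (ler_normB _ _))//.
  by rewrite mulr2n mulrDl mul1r lerD.
have m2 : `|(S v i ord0 - S s i ord0) * (S t j ord0 - S v j ord0)| <= 2 * k * eta.
  rewrite normrM ler_pM// (le_trans (ler_normB _ _))//.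
  by rewrite mulr2n mulrDl mul1r lerD.
have m3 : eta * (2 * k') + 2 * k * eta <= e / 4.
  have -> : e / 4 = eta * (2 * (k + k' + 1)).
    by rewrite /eta; field; rewrite gt_eqF// ltr_wpDl// addr_ge0.
  have -> : eta * (2 * (k + k' + 1)) = eta * (2 * k') + 2 * k * eta + 2 * eta by ring.
  by rewrite lerDl mulr_ge0// ltW.
move: g w_uv a1 a2 c1 c2 m1 m2 m3; rewrite /inc; clear.
move: (left_sum _ _ _ _ _ - _ - _) (SdS S P v i j - _) (SdS S P u i j - _).
move: (level2 _ _ _ _ _ _) (level2 _ _ _ _ _ _) (_ * _) (_ * (_ - _)).
move=> x1 x2 x3 x4 x5 x6 x7.
move: (_ * (_ - _)) (c u v `^ x3) (c s t `^ x3) => x8 w1 w2.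
rewrite !ltr_norml !ler_norml => /andP[? ?] ? /andP[? ?] /andP[? ?] /andP[? ?] /andP[? ?].
by move=> /andP[? ?] /andP[? ?] ?; apply/andP; split; lra.
Qed.

End rough_path_lift.

(** * Second-order sums along the grids *)

Section stepwise_integral.
Context {R : realType}.
Implicit Types (f g : R -> R).

Lemma stopped_step f g a l u v : path <%R a l -> (u, v) \in steps a l ->
  \sum_(w <- steps a l) f w.1 * (g (Num.min w.2 v) - g (Num.min w.1 v)) -
  \sum_(w <- steps a l) f w.1 * (g (Num.min w.2 u) - g (Num.min w.1 u)) =
  f u * (g v - g u).
Proof.
elim: l a => // x l IH a /= /andP[ax xl].
rewrite steps_cons inE !big_cons => /predU1P[[-> ->]|uv] /=.
  rewrite !stopped_past// ?(ltW ax)// minxx (min_l (ltW ax)) (min_r (ltW ax)) minxx.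
  by ring.
have [h1 h2 _ _ _] := steps_itv xl uv.
have xv := le_trans h1 (ltW h2).
rewrite (min_l h1) (min_l xv) (min_l (le_trans (ltW ax) h1)) (min_l (le_trans (ltW ax) xv)).
by rewrite -(IH x xl uv); ring.
Qed.

End stepwise_integral.

Section derivative_independence.
Context {R : realType} {d : nat}.
Variables (p : R) (S : R -> 'cV[R]_d) (P : nat -> nat -> R).
Hypotheses (p2 : 2 < p) (hS : price_path_along p S P).

Let pu n T := partition_upto (P n) T.

(** A control of the path and of its lift on [0, T], which also controls the
    lift of the discretised paths along their own grids. *)
Definition lift_control (T : R) (w : R -> R -> R) : Prop :=
  [/\ control_function `[0, T] w,
  forall s t i, 0 <= s -> s <= t -> t <= T ->
    `|S t i ord0 - S s i ord0| <= w s t `^ p^-1,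
  forall s t i j, 0 <= s -> s <= t -> t <= T ->
    `|level2 S P s t i j| <= w s t `^ (2 / p) &
  forall n u v i j, u \in 0 :: pu n T -> v \in 0 :: pu n T -> u <= v ->
    `|left_sum S (pu n T) v i j - left_sum S (pu n T) u i j
      - S u i ord0 * (S v j ord0 - S u j ord0)| <= w u v `^ (2 / p)].

Let p0 : 0 < p. Proof. exact: lt_trans p2. Qed.

Lemma controlD (D : set R) (w1 w2 : R -> R -> R) : control_function D w1 ->
  control_function D w2 -> control_function D (fun s t => w1 s t + w2 s t).
Proof.
move=> [a1 b1] [a2 b2]; split=> [s t Ds Dt st|s u t Ds Du Dt su ut].
  by rewrite addr_ge0 ?a1 ?a2.
by rewrite addrACA lerD ?b1 ?b2.
Qed.

Lemma grid_itv n T u : 0 < T -> u \in 0 :: pu n T -> 0 <= u /\ u <= T.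
Proof.
move=> T0; rewrite inE => /predU1P[->|]; first by rewrite lexx ltW.
by move=> /(itv_partition_mem (pu_itv hS n T0))/andP[/ltW].
Qed.

Lemma lift_control_le T w w' : 0 < T -> lift_control T w ->
  control_function `[0, T] w' ->
  (forall s t, 0 <= s -> s <= t -> t <= T -> w s t <= w' s t) ->
  lift_control T w'.
Proof.
move=> T0 [hw h1 h2 h3] hw' ww'.
have mono a s t : 0 <= a -> 0 <= s -> s <= t -> t <= T -> w s t `^ a <= w' s t `^ a.
  by move=> a0 s0 st tT; rewrite ler_powR2 ?ww' ?(control_ge0 hw).
have ip0 : 0 <= p^-1 by rewrite invr_ge0 ltW.
have ip20 : 0 <= 2 / p by rewrite divr_ge0// ltW.
split => //.
- by move=> s t i s0 st tT; apply: le_trans (h1 _ _ _ s0 st tT) (mono _ _ _ ip0 s0 st tT).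
- by move=> s t i j s0 st tT; apply: le_trans (h2 _ _ _ _ s0 st tT) (mono _ _ _ ip20 s0 st tT).
- move=> n u v i j un vn uv; apply: le_trans (h3 _ _ _ _ _ un vn uv) _.
  by apply: mono => //; [case: (grid_itv T0 un)|case: (grid_itv T0 vn)].
Qed.

(** Between consecutive grid points the left-point sum is S_u (x) S_uv, the
    very term subtracted in the second level. *)
Lemma level2_grid n T i j u v : 0 < T -> (u, v) \in steps 0 (pu n T) ->
  level2 S P u v i j =
  (SdS S P v i j - left_sum S (pu n T) v i j) - (SdS S P u i j - left_sum S (pu n T) u i j).
Proof.
move=> T0 uv; rewrite level2E !left_sumE.
have := stopped_step (fun u => S u i ord0) (fun u => S u j ord0) (pu_itv hS n T0).1 uv.
by move=> /= <-; ring.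
Qed.

(** On the grids of the partition sequence the second-order terms are the
    increments of the error of the left-point sums, which tends to 0 uniformly
    while its p/2-variation stays bounded; a discrete Young estimate against an
    integrand of finite q-variation then makes their weighted sum vanish. *)
Lemma level2_sum_cvg0 T w b (D : R -> R) i j : 0 < T -> lift_control T w ->
  0 < b < 1 -> 1 < 2 / p + b -> ord T w b (inc (fun _ : unit => D)) ->
  (\sum_(x <- steps 0 (pu n T)) D x.1 * level2 S P x.1 x.2 i j) @[n --> \oo] --> 0.
Proof.
move=> T0 [hw _ hl2 hgrid] /andP[b0 b1] th11 [kD kD0 hD].
apply/cvgrPdist_le => eps eps0.
set al := 2 / p in th11 hl2 hgrid *.
have al0 : 0 < al by rewrite divr_gt0.
(* J = y^ka J^(1 - ka) gives up a power ka of the p/2-variation bound to gain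
   smallness; ka leaves the exponent th = (1 + al + b) / 2 > 1. *)
set ka := (al + b - 1) / 2 / al.
have kaal : ka * al = (al + b - 1) / 2 by rewrite /ka divfK// gt_eqF.
have ka0 : 0 < ka by rewrite !divr_gt0// subr_gt0.
have ka1 : ka < 1.
  by rewrite /ka ltr_pdivrMr// mul1r ltr_pdivrMr//; move: b1 al0; lra.
set th := (1 + (al + b)) / 2.
have th1 : 1 < th by rewrite /th; move: th11; lra.
have thE : th = b + al * (1 - ka).
  by rewrite mulrBr mulr1 [al * ka]mulrC kaal /th; field.
set W := w 0 T.
have W0 : 0 <= W by rewrite (control_ge0 hw)// ltW.
set k1 := kD * 2 `^ (1 - ka) * sewing_const th * W `^ th.
have C0 := sewing_const_gt0 th1.
have k10 : 0 <= k1.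
  by apply: mulr_ge0; rewrite ?powR_ge0//; apply: mulr_ge0; rewrite ?(ltW C0)// mulr_ge0// powR_ge0.
set kk := k1 + `|D 0| + 1.
have kk0 : 0 < kk by rewrite ltr_wpDl// addr_ge0.
set y := Num.min 1 ((eps / kk) `^ ka^-1).
have y0 : 0 < y by rewrite lt_min ltr01 powR_gt0// divr_gt0.
have yka : y `^ ka <= eps / kk.
  have -> : eps / kk = ((eps / kk) `^ ka^-1) `^ ka.
    by rewrite -powRrM mulVf ?powRr1 ?gt_eqF// divr_ge0// ltW.
  by rewrite ler_powR2 ?(ltW y0) ?(ltW ka0)// ge_min lexx orbT.
have yy : y <= y `^ ka by rewrite ger1_powR ?(ltW ka1)// y0 ge_min lexx.
have y20 : 0 < y / 2 by rewrite divr_gt0.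
have := SdS_uniform hS T0 y20; apply: filterS => n hn.
set l := pu n T; have pl := pu_itv hS n T0; rewrite -/(pu n T) -/l in pl.
pose E t := SdS S P t i j - left_sum S l t i j.
pose J s t := E t - E s.
pose G := [set x : R | x \in 0 :: l].
have GT u : G u -> 0 <= u /\ u <= T by exact: grid_itv.
have hwG : control_function G w.
  have inT x : G x -> `[0, T]%classic x by move=> /GT[? ?]; rewrite /= in_itv /=; apply/andP.
  have [c1 c2] := hw; split=> [s t /inT ? /inT ?|s u t /inT ? /inT ? /inT ?].
    exact: c1.
  exact: c2.
have Jy s t : G s -> G t -> `|J s t| <= y.
  move=> /GT[s0 sT] /GT[t0 tT]; rewrite (le_trans (ler_normB _ _))//.
  by rewrite [leRHS]splitr lerD// ltW// hn.
have Jw s t : G s -> G t -> s <= t -> `|J s t| <= 2 * w s t `^ al.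
  move=> Gs Gt st; have [s0 sT] := GT s Gs; have [t0 tT] := GT t Gt.
  have -> : J s t = level2 S P s t i j
     - (left_sum S l t i j - left_sum S l s i j - S s i ord0 * (S t j ord0 - S s j ord0)).
    by rewrite level2E /J /E; ring.
  rewrite (le_trans (ler_normB _ _))// mulr2n mulrDl !mul1r lerD//; first exact: hl2.
  exact: hgrid.
have Jint s t : G s -> G t -> s <= t ->
    `|J s t| <= y `^ ka * (2 `^ (1 - ka) * w s t `^ (al * (1 - ka))).
  move=> Gs Gt st; have [s0 sT] := GT s Gs; have [t0 tT] := GT t Gt.
  have -> : `|J s t| = `|J s t| `^ ka * `|J s t| `^ (1 - ka).
    have e1 : ka + (1 - ka) = 1 by ring.
    by rewrite -powRD e1 ?powRr1// oner_eq0.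
  rewrite (powRrM (w s t)) -(powRM (1 - ka)) ?powR_ge0// ler_pM ?powR_ge0//.
    by rewrite ler_powR2 ?(ltW ka0) ?Jy.
  by rewrite ler_powR2 ?subr_ge0 ?(ltW ka1) ?Jw.
have Gl : forall x, x \in l -> G x by move=> x xl; rewrite /G /= inE xl orbT.
have G0 : G 0 by exact: mem_head.
have := @sewing_list R G w th (kD * 2 `^ (1 - ka) * y `^ ka) (fun s t => D s * J s t) hwG th1.
move=> /(_ _ _ 0 l G0 Gl (path_lt_le pl.1)); rewrite (eqP pl.2) => h.
have eS : riemann_sum (fun s t => D s * J s t) 0 l =
    \sum_(x <- steps 0 l) D x.1 * level2 S P x.1 x.2 i j.
  by apply: eq_big_seq => -[u v] uv /=; rewrite (level2_grid i j T0 uv).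
rewrite eS in h.
have {}h : `|\sum_(x <- steps 0 l) D x.1 * level2 S P x.1 x.2 i j - D 0 * J 0 T| <= k1 * y `^ ka.
  rewrite /k1; apply: (le_trans (h _ _)); last first.
  - by rewrite -/W le_eqVlt; apply/orP; left; apply/eqP; ring.
  - move=> s u t Gs Gu Gt su ut; have [s0 sT] := GT s Gs; have [t0 tT] := GT t Gt.
    have [u0 uT] := GT u Gu.
    have -> : D s * J s t - D s * J s u - D u * J u t = - (D u - D s) * J u t.
      by rewrite /J; ring.
    rewrite normrM normrN.
    apply: (le_trans (ler_pM _ _ (hD tt s u s0 su uT) (Jint u t Gu Gt ut))) => //.
    have -> : kD * w s u `^ b * (y `^ ka * (2 `^ (1 - ka) * w u t `^ (al * (1 - ka)))) =
       (kD * 2 `^ (1 - ka) * y `^ ka) * (w s u `^ b * w u t `^ (al * (1 - ka))) by ring.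
    have hal : 0 < al * (1 - ka) by rewrite mulr_gt0// subr_gt0.
    rewrite ler_wpM2l ?mulr_ge0 ?powR_ge0// thE powRD; last first.
      by apply/implyP; rewrite gt_eqF// addr_gt0.
    by rewrite ler_pM ?powR_ge0// ler_powR2 ?(ltW b0) ?(ltW hal) ?(control_ge0 hw) ?(control_le hw).
  - by rewrite !mulr_ge0 ?powR_ge0.
have hJ : `|D 0 * J 0 T| <= `|D 0| * y `^ ka.
  rewrite normrM ler_wpM2l// (le_trans _ yy)// Jy//.
  by rewrite /G /= -(eqP pl.2) mem_last.
rewrite sub0r normrN.
set Sm := \sum_(x <- _) _ in h *.
have -> : Sm = (Sm - D 0 * J 0 T) + D 0 * J 0 T by rewrite subrK.
apply: (le_trans (ler_normD _ _)); apply: (le_trans (lerD h hJ)).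
rewrite -mulrDl; apply: (@le_trans _ _ (kk * (eps / kk))).
  by rewrite ler_pM ?powR_ge0 ?addr_ge0// lerDl.
by rewrite mulrC divfK// gt_eqF.
Qed.

End derivative_independence.

(** * Calculus of controlled paths *)

Section controlled_calculus.
Context {R : realType} {d : nat} {X : Type}.
Variables (S : R -> 'cV[R]_d) (T : R) (w : R -> R -> R) (a b : R).
Hypotheses (hw : control_function `[0, T] w).
Hypotheses (b0 : 0 < b) (ba : b <= a).
Implicit Types (f g : X -> R -> R) (df dg : 'I_d -> X -> R -> R).

Definition coord (i : 'I_d) : X -> R -> R := fun _ t => S t i ord0.

Hypothesis ordS : forall i, ord T w a (inc (coord i)).
Hypothesis bdS : forall i, bd T (coord i).

Let a0 : 0 < a. Proof. exact: lt_le_trans ba. Qed.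

(** The remainder R^f of a family of S-controlled paths with Gubinelli
    derivatives df. *)
Definition rem f df (x : X) (s t : R) : R :=
  inc f x s t - \sum_j df j x s * inc (coord j) x s t.

(** Controlled families with bounds uniform in the index: b = 1/q is the order
    of the derivatives and a + b = 1/r that of the remainder. *)
Definition ctl f df : Prop :=
  [/\ bd T f, forall j, bd T (df j), forall j, ord T w b (inc (df j))
    & ord T w (a + b) (rem f df)].

Lemma ctl_ext f g df dg : (forall x t, 0 <= t -> t <= T -> f x t = g x t) ->
  (forall j x t, 0 <= t -> t <= T -> df j x t = dg j x t) ->
  ctl f df -> ctl g dg.
Proof.
move=> fg fdg [h1 h2 h3 h4]; split.
- exact: bd_ext h1.
- by move=> j; apply: bd_ext (h2 j) => x t t0 tT; exact: fdg.
- move=> j; apply: ord_ext (h3 j) => x s t s0 st tT.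
  by rewrite /inc !fdg// ?(le_trans s0)// (le_trans st).
- apply: ord_ext h4 => x s t s0 st tT; rewrite /rem.
  rewrite {1 3}/inc !fg// ?(le_trans s0)// ?(le_trans st)//.
  by congr (_ - _); apply: eq_bigr => j _; rewrite fdg// (le_trans st).
Qed.

Lemma ctl_inc f df : ctl f df -> ord T w a (inc f).
Proof.
move=> [h1 h2 h3 h4].
have h5 : ord T w a (rem f df) by apply: (ord_le hw a0 _ h4); rewrite lerDl ltW.
have h6 : ord T w a (fun x s t => \sum_j df j x s * inc (coord j) x s t).
  by apply: ord_sum => j; exact: ord_bdl.
by apply: ord_ext (ordD h5 h6) => x s t _ _ _; rewrite /rem subrK.
Qed.

Lemma ctl_coord i : ctl (coord i) (fun j _ _ => (i == j)%:R).
Proof.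
split; [exact: bdS|by move=> j; exact: bd_cst| |].
  by move=> j; apply: ord_ext (ord_zero _ _ _) => x s t _ _ _; rewrite /inc subrr.
apply: ord_ext (ord_zero _ _ _) => x s t _ _ _.
rewrite /rem (bigD1 i)//= eqxx mul1r big1 ?addr0 ?subrr// => j ji.
by rewrite eq_sym (negbTE ji) mul0r.
Qed.

Lemma ctl_cst (k : R) : ctl (fun _ _ => k) (fun _ _ _ => 0).
Proof.
split; try by move=> *; exact: bd_cst.
  by move=> j; apply: ord_ext (ord_zero _ _ _) => x s t _ _ _; rewrite /inc subrr.
apply: ord_ext (ord_zero _ _ _) => x s t _ _ _.
by rewrite /rem /inc subrr big1 ?subrr// => j _; rewrite mul0r.
Qed.

Lemma ctlD f g df dg : ctl f df -> ctl g dg ->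
  ctl (fun x t => f x t + g x t) (fun j x t => df j x t + dg j x t).
Proof.
move=> [h1 h2 h3 h4] [k1 k2 k3 k4]; split; first exact: bdD.
- by move=> j; exact: bdD.
- move=> j; apply: ord_ext (ordD (h3 j) (k3 j)) => x s t _ _ _.
  by rewrite /inc; ring.
- apply: ord_ext (ordD h4 k4) => x s t _ _ _; rewrite /rem /inc.
  under [in RHS]eq_bigr do rewrite mulrDl.
  by rewrite big_split /=; ring.
Qed.

Lemma ctl_sum (I : Type) (r : seq I) (f : I -> X -> R -> R)
    (df : I -> 'I_d -> X -> R -> R) : (forall i, ctl (f i) (df i)) ->
  ctl (fun x t => \sum_(i <- r) f i x t) (fun j x t => \sum_(i <- r) df i j x t).
Proof.
move=> h; elim: r => [|i r IH].
  by apply: ctl_ext (ctl_cst 0) => *; rewrite big_nil.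
by apply: ctl_ext (ctlD (h i) IH) => *; rewrite big_cons.
Qed.

Lemma ctlM f g df dg : ctl f df -> ctl g dg ->
  ctl (fun x t => f x t * g x t) (fun j x t => df j x t * g x t + f x t * dg j x t).
Proof.
move=> hf hg; have fi := ctl_inc hf; have gi := ctl_inc hg.
move: hf hg => [h1 h2 h3 h4] [k1 k2 k3 k4].
have fib := ord_le hw b0 ba fi; have gib := ord_le hw b0 ba gi.
split; first exact: bdM.
- by move=> j; apply: bdD; exact: bdM.
- move=> j.
  have e1 := ordD (ord_bdr k1 (h3 j)) (ord_bdl (h2 j) gib).
  have e2 := ordD (ord_bdr h1 (k3 j)) (ord_bdl (k2 j) fib).
  by apply: ord_ext (ordD e1 e2) => x s t _ _ _; rewrite /inc; ring.
- have ab : a + b <= a + a by rewrite lerD2l.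
  have ab0 : 0 < a + b by rewrite addr_gt0.
  have e1 := ordD (ord_bdl h1 k4) (ord_bdl k1 h4).
  have e2 := ord_le hw ab0 ab (ordM a0 a0 fi gi).
  apply: ord_ext (ordD e1 e2) => x s t _ _ _; rewrite /rem /inc.
  under [in RHS]eq_bigr do rewrite mulrDl.
  rewrite big_split /= !mulrBr !mulr_sumr.
  under [in RHS]eq_bigr do rewrite [_ * g x s]mulrC -mulrA.
  under [X in _ = _ - (_ + X)]eq_bigr do rewrite -mulrA.
  set A := \sum_j _; set B := \sum_j _.
  by ring.
Qed.

Lemma ctlV f df k : 0 < k -> (forall x t, 0 <= t -> t <= T -> k <= `|f x t|) ->
  ctl f df ->
  ctl (fun x t => (f x t)^-1) (fun j x t => - df j x t / f x t ^+ 2).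
Proof.
move=> k0 hk hf; have fi := ctl_inc hf; move: hf => [h1 h2 h3 h4].
have f0 x t : 0 <= t -> t <= T -> f x t != 0.
  by move=> t0 tT; rewrite -normr_gt0 (lt_le_trans k0)// hk.
have bV : bd T (fun x t => (f x t)^-1).
  exists k^-1; first by rewrite invr_ge0 ltW.
  move=> x t t0 tT; rewrite normfV lef_pV2 ?hk// posrE.
  by rewrite (lt_le_trans k0)// hk.
have bV2 := bdM bV bV.
have Vi : ord T w a (inc (fun x t => (f x t)^-1)).
  apply: ord_ext (ordN (ord_bdl bV (ord_bdr bV fi))) => x s t s0 st tT.
  rewrite /inc; have := f0 x s s0 (le_trans st tT); have := f0 x t (le_trans s0 st) tT.
  by move=> ? ?; field; apply/andP.
have Vib := ord_le hw b0 ba Vi.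
split => //.
- move=> j; apply: bd_ext (bdN (bdM (h2 j) bV2)) => x t t0 tT.
  by have := f0 x t t0 tT => ?; field.
- move=> j.
  have e1 := ord_bdr bV2 (h3 j).
  have e2 := ord_bdl (h2 j) (ordD (ord_bdl bV Vib) (ord_bdr bV Vib)).
  apply: ord_ext (ordN (ordD e1 e2)) => x s t s0 st tT; rewrite /inc.
  have := f0 x s s0 (le_trans st tT); have := f0 x t (le_trans s0 st) tT.
  by move=> ? ?; field; apply/andP.
- have ab : a + b <= a + a by rewrite lerD2l.
  have ab0 : 0 < a + b by rewrite addr_gt0.
  have e1 := ord_bdl bV2 h4.
  have e2 := ord_bdl bV2 (ord_bdr bV (ord_le hw ab0 ab (ordM a0 a0 fi fi))).
  apply: ord_ext (ordB e2 e1) => x s t s0 st tT; rewrite /rem.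
  have -> : \sum_j (- df j x s / f x s ^+ 2) * inc (coord j) x s t =
      - (f x s ^+ 2)^-1 * \sum_j df j x s * inc (coord j) x s t.
    by rewrite mulr_sumr; apply: eq_bigr => j _; ring.
  set A := \sum_j _; rewrite /inc.
  have := f0 x s s0 (le_trans st tT); have := f0 x t (le_trans s0 st) tT.
  by move=> ? ?; field; apply/andP.
Qed.

(** A first-order expansion of f along the paths y becomes one along S when the
    expansions of y are substituted in it. *)
Lemma ctl_chain f (fd : 'I_d -> X -> R -> R) (y : 'I_d -> X -> R -> R)
    (y' : 'I_d -> 'I_d -> X -> R -> R) :
  bd T f -> (forall k, bd T (fd k)) -> (forall k, ord T w b (inc (fd k))) ->
  ord T w (a + b) (fun x s t => inc f x s t - \sum_k fd k x s * inc (y k) x s t) ->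
  (forall k, ctl (y k) (y' k)) ->
  ctl f (fun j x t => \sum_k fd k x t * y' k j x t).
Proof.
move=> h1 h2 h3 h4 hy; split => //.
- by move=> j; apply: bd_sum => k; apply: bdM => //; case: (hy k).
- move=> j; apply: ord_ext (ord_sum (index_enum 'I_d)
    (E := fun k x s t => y' k j x t * inc (fd k) x s t + fd k x s * inc (y' k j) x s t) _) => [x s t _ _ _|k].
    by rewrite /inc -sumrB; apply: eq_bigr => k _; ring.
  by have [_ g2 g3 _] := hy k; apply: ordD; [exact: ord_bdr|exact: ord_bdl].
- have h5 : ord T w (a + b) (fun x s t => \sum_k fd k x s * rem (y k) (y' k) x s t).
    by apply: ord_sum => k; apply: ord_bdl => //; case: (hy k).
  apply: ord_ext (ordD h4 h5) => x s t _ _ _.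
  have -> : \sum_k fd k x s * rem (y k) (y' k) x s t = \sum_k fd k x s * inc (y k) x s t
      - \sum_k \sum_j fd k x s * y' k j x s * inc (coord j) x s t.
    rewrite -sumrB; apply: eq_bigr => k _; rewrite /rem mulrBr mulr_sumr.
    by congr (_ - _); apply: eq_bigr => j _; rewrite mulrA.
  rewrite addrA subrK /rem exchange_big /=; congr (_ - _).
  by apply: eq_bigr => j _; rewrite mulr_suml.
Qed.

End controlled_calculus.

(** * Expansions of the exponential *)

Section exponential_expansion.
Context {R : realType}.

(** Taylor's estimates for exp follow by integrating this bound, once per
    order. *)
Lemma derivative_bound (f df : R -> R) (M z : R) :
  (forall y : R, is_derive y (1 : R) f (df y)) -> f 0 = 0 ->
  (forall y, `|y| <= `|z| -> `|df y| <= M) -> `|f z| <= M * `|z|.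
Proof.
move=> hd f0 hM.
have cf : continuous f.
  by move=> y; apply/differentiable_continuous/derivable1_diffP; exact: (@ex_derive _ _ _ _ _ _ _ (hd y)).
have [z0|z0|<-] := ltgtP 0 z; last by rewrite f0 normr0 mulr0.
- have [c + e] : exists2 c, c \in `]0, z[ & f z - f 0 = df c * (z - 0).
    by apply: MVT => //; exact: continuous_subspaceT.
  rewrite in_itv /= => /andP[c0 cz]; move: e; rewrite f0 !subr0 => ->.
  by rewrite normrM ler_wpM2r// hM// !gtr0_norm// ltW.
- have [c + e] : exists2 c, c \in `]z, 0[ & f 0 - f z = df c * (0 - z).
    by apply: MVT => //; exact: continuous_subspaceT.
  rewrite in_itv /= => /andP[cz c0]; move: e; rewrite f0 !sub0r mulrN => /oppr_inj ->.
  by rewrite normrM ler_wpM2r// hM// !ltr0_norm// lerN2 ltW.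
Qed.

Let exp_le (B y z : R) : `|z| <= B -> `|y| <= `|z| -> expR y <= expR B.
Proof.
by move=> zB yz; rewrite ler_expR (le_trans (ler_norm _))// (le_trans yz).
Qed.

Lemma expR_bound1 (B z : R) : `|z| <= B -> `|expR z - 1| <= expR B * `|z|.
Proof.
move=> zB; apply: (@derivative_bound (fun z => expR z - 1) expR).
- by move=> y; apply: is_derive_eq; rewrite subr0.
- by rewrite expR0 subrr.
- by move=> y yz; rewrite ger0_norm ?expR_ge0// (exp_le zB).
Qed.

Lemma expR_bound2 (B z : R) : `|z| <= B -> `|expR z - 1 - z| <= expR B * `|z| ^+ 2.
Proof.
move=> zB; rewrite expr2 mulrA.
apply: (@derivative_bound (fun z => expR z - 1 - z) (fun z => expR z - 1)).
- by move=> y; apply: is_derive_eq; rewrite subr0.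
- by rewrite expR0 subrr subr0.
- move=> y yz; apply: (le_trans (expR_bound1 (le_trans yz zB))).
  by rewrite ler_wpM2l// expR_ge0.
Qed.

Lemma expR_bound3 (B z : R) : `|z| <= B ->
  `|expR z - 1 - z - 2^-1 * z ^+ 2| <= expR B * `|z| ^+ 3.
Proof.
move=> zB; rewrite [`|z| ^+ 3]exprSr [leRHS]mulrA.
apply: (@derivative_bound (fun z => expR z - 1 - z - 2^-1 * z ^+ 2) (fun z => expR z - 1 - z)).
- move=> y; apply: is_derive_eq; rewrite subr0 /GRing.scale /=; by field.
- by rewrite expR0 subrr !subr0 expr0n mulr0 subr0.
- move=> y yz; apply: (le_trans (expR_bound2 (le_trans yz zB))).
  by rewrite ler_wpM2l ?expR_ge0// lerXn2r ?nnegrE.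
Qed.

Section orders_of_exponential.
Context {X : Type} (T : R) (w : R -> R -> R) (a : R).
Hypotheses (hw : control_function `[0, T] w) (a0 : 0 < a).
Implicit Types E : X -> R -> R -> R.

Lemma ord_bound E : ord T w a E ->
  exists2 B, 0 <= B & forall x s t, 0 <= s -> s <= t -> t <= T -> `|E x s t| <= B.
Proof.
move=> [k k0 h]; exists (k * w 0 T `^ a); first by rewrite mulr_ge0// powR_ge0.
move=> x s t s0 st tT; apply: (le_trans (h x s t s0 st tT)); rewrite ler_wpM2l//.
by rewrite ler_powR2 ?(control_ge0 hw) ?(control_le hw)// ltW.
Qed.

Lemma van_ord_big E F : (exists2 k, 0 <= k & forall x s t, 0 <= s -> s <= t -> t <= T ->
    `|F x s t| <= k * `|E x s t|) -> van T E -> van T F.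
Proof.
move=> [k k0 h] hE e e0; have k10 : 0 < k + 1 by rewrite ltr_wpDl.
have [|dl dl0 h'] := hE (e / (k + 1)); first by rewrite divr_gt0.
exists dl => // x s t s0 st tT l; apply: (le_trans (h x s t s0 st tT)).
apply: (@le_trans _ _ ((k + 1) * (e / (k + 1)))).
  by rewrite ler_pM ?h'// lerDl.
by rewrite mulrC divfK// gt_eqF.
Qed.

Lemma ord_dom be E F : (exists2 k, 0 <= k & forall x s t, 0 <= s -> s <= t -> t <= T ->
    `|F x s t| <= k * `|E x s t|) -> ord T w be E -> ord T w be F.
Proof.
move=> [k k0 h] [k' k'0 h']; exists (k * k'); first exact: mulr_ge0.
move=> x s t s0 st tT; apply: (le_trans (h x s t s0 st tT)).
by rewrite -mulrA ler_wpM2l// h'.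
Qed.

Lemma ord_expR2 E : ord T w a E ->
  ord T w (a + a) (fun x s t => expR (E x s t) - 1 - E x s t).
Proof.
move=> hE; have [B B0 hB] := ord_bound hE.
apply: ord_dom (ordM a0 a0 hE hE); exists (expR B); first exact: expR_ge0.
move=> x s t s0 st tT; apply: (le_trans (expR_bound2 (hB x s t s0 st tT))).
by rewrite normrM expr2.
Qed.

Lemma ord_expR3 E : ord T w a E ->
  ord T w (a + a + a) (fun x s t => expR (E x s t) - 1 - E x s t - 2^-1 * E x s t ^+ 2).
Proof.
move=> hE; have [B B0 hB] := ord_bound hE.
apply: ord_dom (ordM _ a0 (ordM a0 a0 hE hE) hE); last by rewrite addr_gt0.
exists (expR B); first exact: expR_ge0.
move=> x s t s0 st tT; apply: (le_trans (expR_bound3 (hB x s t s0 st tT))).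
by rewrite !normrM exprS expr2 mulrA.
Qed.

Lemma van_expR3 E : ord T w a E -> van T E ->
  van T (fun x s t => expR (E x s t) - 1 - E x s t - 2^-1 * E x s t ^+ 2).
Proof.
move=> hE vE; have [B B0 hB] := ord_bound hE.
apply: van_ord_big vE; exists (expR B * B ^+ 2); first by rewrite mulr_ge0 ?expR_ge0 ?exprn_ge0.
move=> x s t s0 st tT; have h := hB x s t s0 st tT.
apply: (le_trans (expR_bound3 h)).
have -> : expR B * `|E x s t| ^+ 3 = expR B * `|E x s t| ^+ 2 * `|E x s t| by ring.
apply: ler_wpM2r => //; apply: ler_wpM2l; first exact: expR_ge0.
by rewrite lerXn2r ?nnegrE.
Qed.

End orders_of_exponential.
End exponential_expansion.

(** * Expansion of the log-wealth *)

Section log_wealth.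
Context {R : realType} {d : nat} {X : Type}.
Variables (p : R) (S : R -> 'cV[R]_d) (P : nat -> nat -> R).
Hypotheses (p2 : 2 < p) (hS : price_path_along p S P).
Variables (T b : R) (w : R -> R -> R).
Hypotheses (T0 : 0 < T) (hlift : lift_control p S P T w).
Hypotheses (b0 : 0 < b) (ba : b <= p^-1) (th1 : 1 < p^-1 + p^-1 + b).

Local Notation a := (p^-1).
Local Notation th := (p^-1 + p^-1 + b).
Local Notation crd := (coord (X := X) S).

Let hw : control_function `[0, T] w. Proof. by case: hlift. Qed.
Let a0 : 0 < a. Proof. exact: lt_le_trans ba. Qed.
Let th_gt0 : 0 < th. Proof. exact: lt_trans th1. Qed.
Let th3a : th <= a + a + a. Proof. by rewrite lerD2l. Qed.
Let aa0 : 0 < a + a. Proof. by rewrite addr_gt0. Qed.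

Definition area (i j : 'I_d) : X -> R -> R -> R := fun _ s t => level2 S P s t i j.

Lemma ord_coord i : ord T w a (inc (crd i)).
Proof.
have [_ h _ _] := hlift; exists 1 => // x s t s0 st tT.
by rewrite mul1r; exact: h.
Qed.

Lemma ord_area i j : ord T w (a + a) (area i j).
Proof.
have [_ _ h _] := hlift; exists 1 => // x s t s0 st tT.
have -> : a + a = 2 / p by rewrite mulr2n mulrDl mul1r.
by rewrite mul1r; exact: h.
Qed.

Lemma van_coord i : van T (inc (crd i)).
Proof. exact: (van_S hS). Qed.

Lemma van_area i j : van T (area i j).
Proof. exact: (van_level2 hS). Qed.

Let brk i j (x : X) t := bracket S P t i j.

Lemma brkE i j x s t : inc (brk i j) x s t =
  inc (crd i) x s t * inc (crd j) x s t - area i j x s t - area j i x s t.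
Proof. exact: bracket_inc. Qed.

Lemma ord_brk i j : ord T w (a + a) (inc (brk i j)).
Proof.
apply: ord_ext (ordB (ordB (ordM a0 a0 (ord_coord i) (ord_coord j)) (ord_area i j))
  (ord_area j i)) => x s t _ _ _.
by rewrite brkE.
Qed.

Lemma van_brk i j : van T (inc (brk i j)).
Proof.
apply: van_ext (vanB (vanB (van_ordM hw a0 (ord_coord i) (van_coord j))
  (van_area i j)) (van_area j i)) => x s t _ _ _.
by rewrite brkE.
Qed.

Variables (G : 'I_d -> X -> R -> R) (G' : 'I_d -> 'I_d -> X -> R -> R).
Hypothesis hG : forall i, ctl S T w a b (G i) (G' i).

Definition rough_germ (x : X) (s t : R) : R :=
  \sum_i G i x s * inc (crd i) x s t + \sum_i \sum_j G' i j x s * area j i x s t.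

Definition bracket_germ i j (x : X) (s t : R) : R :=
  G i x s * G j x s * inc (brk i j) x s t.

(** By Chen's relation the defect of the compensated sum pairs the remainder of
    G with S and the increment of G' with the area, both of order above 1. *)
Lemma rough_defect x u s t : s <= t ->
  defect rough_germ (x, u) s t =
  - (\sum_i rem S (G i) (G' i) x s (clamp s t u) * inc (crd i) x (clamp s t u) t
     + \sum_i \sum_j inc (G' i j) x s (clamp s t u) * area j i x (clamp s t u) t).
Proof.
move=> st; rewrite /defect /rough_germ /=; set v := clamp s t u.
have -> : \sum_i rem S (G i) (G' i) x s v * inc (crd i) x v t =
    \sum_i inc (G i) x s v * inc (crd i) x v t
    - \sum_i \sum_j G' i j x s * inc (crd j) x s v * inc (crd i) x v t.
  rewrite -sumrB; apply: eq_bigr => i _; rewrite /rem mulrBl mulr_suml.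
  by [].
have -> : \sum_i \sum_j G' i j x s * area j i x s t =
    \sum_i \sum_j G' i j x s * area j i x s v
    + \sum_i \sum_j G' i j x s * area j i x v t
    + \sum_i \sum_j G' i j x s * inc (crd j) x s v * inc (crd i) x v t.
  rewrite -!big_split; apply: eq_bigr => i _ /=; rewrite -!big_split.
  by apply: eq_bigr => j _ /=; rewrite /area (chen _ _ s v t) /inc /coord; ring.
have -> : \sum_i G i x s * inc (crd i) x s t =
    \sum_i G i x s * inc (crd i) x s v + \sum_i G i x v * inc (crd i) x v t
    - \sum_i inc (G i) x s v * inc (crd i) x v t.
  by rewrite -big_split -sumrB; apply: eq_bigr => i _ /=; rewrite /inc; ring.
have -> : \sum_i \sum_j inc (G' i j) x s v * area j i x v t =
    \sum_i \sum_j G' i j x v * area j i x v t - \sum_i \sum_j G' i j x s * area j i x v t.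
  rewrite -sumrB; apply: eq_bigr => i _; rewrite -sumrB; apply: eq_bigr => j _.
  by rewrite /inc mulrBl.
by ring.
Qed.

Lemma ord_rough_defect : ord T w th (defect rough_germ).
Proof.
apply: ord_ext (ordN (ordD
  (ord_sum (index_enum 'I_d) (E := fun i (xu : X * R) s t =>
     rem S (G i) (G' i) xu.1 s (clamp s t xu.2) * inc (crd i) xu.1 (clamp s t xu.2) t) _)
  (ord_sum (index_enum 'I_d) (E := fun i (xu : X * R) s t => \sum_j
     inc (G' i j) xu.1 s (clamp s t xu.2) * area j i xu.1 (clamp s t xu.2) t) _)))
  => [[x u] s t _ st _|i|i].
- by rewrite rough_defect.
- have [_ _ _ h4] := hG i; have ab0 : 0 < a + b by rewrite addr_gt0.
  have -> : th = (a + b) + a by rewrite addrAC.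
  by apply: ordM => //; [exact: ord_left|exact/ord_right/ord_coord].
- have [_ _ h3 _] := hG i; apply: ord_sum => j.
  have -> : th = b + (a + a) by rewrite addrC.
  by apply: ordM => //; [exact: ord_left|exact/ord_right/ord_area].
Qed.

Lemma van_rough_defect : van T (defect rough_germ).
Proof.
apply: van_ext (vanN (vanD
  (van_sum (index_enum 'I_d) (E := fun i (xu : X * R) s t =>
     rem S (G i) (G' i) xu.1 s (clamp s t xu.2) * inc (crd i) xu.1 (clamp s t xu.2) t) _)
  (van_sum (index_enum 'I_d) (E := fun i (xu : X * R) s t => \sum_j
     inc (G' i j) xu.1 s (clamp s t xu.2) * area j i xu.1 (clamp s t xu.2) t) _)))
  => [[x u] s t _ st _|i|i].
- by rewrite rough_defect.
- have [_ _ _ h4] := hG i; have ab0 : 0 < a + b by rewrite addr_gt0.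
  by apply: (van_ordM hw ab0); [exact: ord_left|exact/van_right/van_coord].
- have [_ _ h3 _] := hG i; apply: van_sum => j.
  by apply: (van_ordM hw b0); [exact: ord_left|exact/van_right/van_area].
Qed.

Lemma bracket_defect i j x u s t : s <= t ->
  defect (bracket_germ i j) (x, u) s t =
  - (inc (fun x t => G i x t * G j x t) x s (clamp s t u) * inc (brk i j) x (clamp s t u) t).
Proof.
move=> st; rewrite /defect /bracket_germ; cbn [fst snd]; rewrite /inc.
move: (brk i j x s) (brk i j x t) (brk i j x (clamp s t u)) => y1 y2 y3.
by ring.
Qed.

Let ctl_ord i : ord T w a (inc (G i)).
Proof. by apply: (ctl_inc hw b0 ba _ (hG i)) => k; exact: ord_coord. Qed.

Let ord_GG i j : ord T w a (inc (fun x t => G i x t * G j x t)).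
Proof.
have [h1 _ _ _] := hG i; have [k1 _ _ _] := hG j.
apply: ord_ext (ordD (ord_bdl h1 (ctl_ord j)) (ord_bdr k1 (ctl_ord i))) => x s t _ _ _.
by rewrite /inc; ring.
Qed.

Lemma ord_bracket_defect i j : ord T w th (defect (bracket_germ i j)).
Proof.
have h : ord T w (a + (a + a)) (defect (bracket_germ i j)).
  apply: ord_ext (ordN (ordM a0 aa0 (ord_left hw a0 (ord_GG i j))
    (ord_right hw aa0 (ord_brk i j)))) => -[x u] s t _ st _.
  by rewrite bracket_defect.
by apply: (ord_le hw th_gt0 _ h); rewrite addrA.
Qed.

Lemma van_bracket_defect i j : van T (defect (bracket_germ i j)).
Proof.
apply: van_ext (vanN (van_ordM hw a0 (ord_left hw a0 (ord_GG i j))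
    (van_right (van_brk i j)))) => -[x u] s t _ st _.
by rewrite bracket_defect.
Qed.

Definition log_wealth (x : X) (t : R) : R :=
  mesh_lim (rough_germ x) t - 2^-1 * \sum_i \sum_j mesh_lim (bracket_germ i j x) t.

(** The increment of log W is lin + quad - lin^2 / 2 up to a negligible term. *)
Definition lin (x : X) (s t : R) : R := \sum_i G i x s * inc (crd i) x s t.

Definition quad (x : X) (s t : R) : R :=
  \sum_i \sum_j (G' i j x s + G i x s * G j x s) * area j i x s t.

Definition wealth_rem (x : X) (s t : R) : R :=
  inc log_wealth x s t - (lin x s t + quad x s t - 2^-1 * lin x s t ^+ 2).

(** Since the bracket increment is S_st S_st - A_st - A_st^T for the area A,
    the bracket term completes the square. *)
Lemma wealth_remE x s t : wealth_rem x s t =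
  (inc (fun x => mesh_lim (rough_germ x)) x s t - rough_germ x s t)
  - 2^-1 * \sum_i \sum_j (inc (fun x => mesh_lim (bracket_germ i j x)) x s t
                          - bracket_germ i j x s t).
Proof.
have lin2 : lin x s t ^+ 2 = \sum_i \sum_j
    G i x s * G j x s * (inc (crd i) x s t * inc (crd j) x s t).
  rewrite expr2 /lin mulr_suml; apply: eq_bigr => i _; rewrite mulr_sumr.
  by apply: eq_bigr => j _; ring.
have sb : \sum_i \sum_j bracket_germ i j x s t = lin x s t ^+ 2
    - 2 * \sum_i \sum_j G i x s * G j x s * area j i x s t.
  rewrite lin2 mulr2n mulrDl mul1r opprD addrA.
  have e : \sum_i \sum_j G i x s * G j x s * area j i x s t =
           \sum_i \sum_j G i x s * G j x s * area i j x s t.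
    rewrite exchange_big; apply: eq_bigr => i _; apply: eq_bigr => j _.
    by rewrite [G j x s * _]mulrC.
  rewrite {1}e -!sumrB; apply: eq_bigr => i _; rewrite -!sumrB; apply: eq_bigr => j _.
  by rewrite /bracket_germ brkE; ring.
have sm : \sum_i \sum_j (inc (fun x => mesh_lim (bracket_germ i j x)) x s t
     - bracket_germ i j x s t) =
  \sum_i \sum_j mesh_lim (bracket_germ i j x) t - \sum_i \sum_j mesh_lim (bracket_germ i j x) s
  - \sum_i \sum_j bracket_germ i j x s t.
  rewrite -!sumrB; apply: eq_bigr => i _; rewrite -!sumrB; apply: eq_bigr => j _.
  by [].
rewrite sm sb /wealth_rem /quad.
have -> : \sum_i \sum_j (G' i j x s + G i x s * G j x s) * area j i x s t =
    \sum_i \sum_j G' i j x s * area j i x s t + \sum_i \sum_j G i x s * G j x s * area j i x s t.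
  rewrite -big_split; apply: eq_bigr => i _ /=; rewrite -big_split.
  by apply: eq_bigr => j _ /=; rewrite mulrDl.
rewrite /rough_germ -/(lin x s t) /log_wealth /inc.
set q1 := \sum_i \sum_j G' i j x s * _; set q2 := \sum_i \sum_j G i x s * _ * _.
by field.
Qed.

Lemma ord_wealth_rem : ord T w th wealth_rem.
Proof.
have h1 := sewing_ord hw th1 ord_rough_defect van_rough_defect.
have h2 i j := sewing_ord hw th1 (ord_bracket_defect i j) (van_bracket_defect i j).
apply: ord_ext (ordB h1 (ord_bdl (bd_cst T 2^-1) (ord_sum (index_enum 'I_d) (fun i =>
  ord_sum (index_enum 'I_d) (h2 i))))) => x s t _ _ _.
by rewrite wealth_remE.
Qed.

Lemma van_wealth_rem : van T wealth_rem.
Proof.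
have h1 := sewing_van hw th1 ord_rough_defect van_rough_defect.
have h2 i j := sewing_van hw th1 (ord_bracket_defect i j) (van_bracket_defect i j).
apply: van_ext (vanB h1 (van_bdl (bd_cst T 2^-1) (van_sum (index_enum 'I_d) (fun i =>
  van_sum (index_enum 'I_d) (h2 i))))) => x s t _ _ _.
by rewrite wealth_remE.
Qed.

Lemma mesh_lim0 (g : R -> R -> R) : mesh_lim g 0 = 0.
Proof.
have FF := mesh_to_0_filter (lexx (0 : R)).
apply/cvg_lim; first exact: Rhausdorff.
apply/cvgrPdist_lt => e e0; exists 1 => //= l [/itv_partitionxx -> _].
by rewrite big_nil subrr normr0.
Qed.

Lemma log_wealth0 x : log_wealth x 0 = 0.
Proof.
rewrite /log_wealth mesh_lim0 big1 ?mulr0 ?subr0// => i _.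
by rewrite big1// => j _; exact: mesh_lim0.
Qed.

Lemma ord_lin : ord T w a lin.
Proof.
apply: ord_sum => i; apply: ord_bdl; last exact: ord_coord.
by case: (hG i).
Qed.

Lemma van_lin : van T lin.
Proof.
apply: van_sum => i; apply: van_bdl; last exact: van_coord.
by case: (hG i).
Qed.

Let bd_GG i j : bd T (fun x t => G' i j x t + G i x t * G j x t).
Proof.
by have [h1 h2 _ _] := hG i; have [k1 _ _ _] := hG j; apply: bdD => //; exact: bdM.
Qed.

Lemma ord_quad : ord T w (a + a) quad.
Proof.
apply: ord_sum => i; apply: ord_sum => j.
by apply: (ord_bdl (bd_GG i j)); exact: ord_area.
Qed.

Lemma van_quad : van T quad.
Proof.
apply: van_sum => i; apply: van_sum => j.
by apply: (van_bdl (bd_GG i j)); exact: van_area.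
Qed.

Lemma log_wealth_inc x s t : inc log_wealth x s t =
  lin x s t + (quad x s t - 2^-1 * (lin x s t * lin x s t) + wealth_rem x s t).
Proof. by rewrite /wealth_rem; ring. Qed.

Lemma ord_log_wealth2 : ord T w (a + a) (fun x s t => inc log_wealth x s t - lin x s t).
Proof.
have h3 : ord T w (a + a) wealth_rem.
  by apply: (ord_le hw aa0 _ ord_wealth_rem); rewrite lerDl ltW.
apply: ord_ext (ordD (ordB ord_quad (ord_bdl (bd_cst T 2^-1) (ordM a0 a0 ord_lin ord_lin))) h3)
  => x s t _ _ _.
by rewrite log_wealth_inc; ring.
Qed.

Lemma ord_log_wealth : ord T w a (inc log_wealth).
Proof.
have h : ord T w a (fun x s t => inc log_wealth x s t - lin x s t).
  by apply: (ord_le hw a0 _ ord_log_wealth2); rewrite lerDl ltW.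
by apply: ord_ext (ordD ord_lin h) => x s t _ _ _; rewrite addrC subrK.
Qed.

Lemma van_log_wealth : van T (inc log_wealth).
Proof.
apply: van_ext (vanD van_lin (vanD (vanB van_quad (van_bdl (bd_cst T 2^-1)
  (van_ordM hw a0 ord_lin van_lin))) van_wealth_rem)) => x s t _ _ _.
by rewrite log_wealth_inc.
Qed.

Lemma bd_log_wealth : bd T log_wealth.
Proof.
apply: (ord_inc_bd hw a0 ord_log_wealth); exists 0 => // x.
by rewrite log_wealth0 normr0.
Qed.

Lemma bd_expR (f : X -> R -> R) : bd T f -> bd T (fun x t => expR (f x t)).
Proof.
move=> [k k0 h]; exists (expR k); first exact: expR_ge0.
move=> x t t0 tT; rewrite ger0_norm ?expR_ge0// ler_expR.
by rewrite (le_trans (ler_norm _))// h.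
Qed.

(** Wealth solves dW = W G dS, at the level of first-order expansions. *)
Lemma ctl_wealth : ctl S T w a b (fun x t => expR (log_wealth x t))
  (fun j x t => expR (log_wealth x t) * G j x t).
Proof.
have bW := bd_expR bd_log_wealth.
have oe := ord_expR2 hw a0 ord_log_wealth.
have incW x s t : inc (fun x t => expR (log_wealth x t)) x s t =
    expR (log_wealth x s) * (expR (inc log_wealth x s t) - 1).
  by rewrite mulrBr mulr1 -expRD {2}/inc (addrC (log_wealth x s)) subrK.
have oW : ord T w b (inc (fun x t => expR (log_wealth x t))).
  apply: (ord_le hw b0 ba).
  have oe1 : ord T w a (fun x s t => expR (inc log_wealth x s t) - 1 - inc log_wealth x s t).
    by apply: (ord_le hw a0 _ oe); rewrite lerDl ltW.
  apply: ord_ext (ord_bdl bW (ordD oe1 ord_log_wealth)) => x s t _ _ _.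
  by rewrite incW subrK.
split => //.
- by move=> j; apply: bdM => //; case: (hG j).
- move=> j; have [h1 _ _ _] := hG j.
  apply: ord_ext (ordD (ord_bdl bW (ord_le hw b0 ba (ctl_ord j))) (ord_bdr h1 oW)) => x s t _ _ _.
  by rewrite /inc; ring.
- have ab : a + b <= a + a by rewrite lerD2l.
  apply: (ord_le hw (addr_gt0 a0 b0) ab).
  apply: ord_ext (ordD (ord_bdl bW oe) (ord_bdl bW ord_log_wealth2)) => x s t _ _ _.
  rewrite /rem incW.
  have -> : \sum_j expR (log_wealth x s) * G j x s * inc (coord S j) x s t =
      expR (log_wealth x s) * lin x s t.
    by rewrite mulr_sumr; apply: eq_bigr => j _; rewrite mulrA.
  by ring.
Qed.

End log_wealth.

(** * Independence of the Gubinelli derivative, and ratios of wealths *)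

Lemma cvg_sum {R : realType} (I : Type) (r : seq I) (f : I -> nat -> R) (l : I -> R) :
  (forall i, f i n @[n --> \oo] --> l i) ->
  \sum_(i <- r) f i n @[n --> \oo] --> \sum_(i <- r) l i.
Proof.
move=> h; elim: r => [|i r IH].
  by under eq_fun do rewrite big_nil; rewrite big_nil; exact: cvg_cst.
by under eq_fun do rewrite big_cons; rewrite big_cons; apply: cvgD.
Qed.

Section derivative_choice.
Context {R : realType} {d : nat}.
Variables (p : R) (S : R -> 'cV[R]_d) (P : nat -> nat -> R).
Hypotheses (p2 : 2 < p) (hS : price_path_along p S P).
Variables (T b : R) (w : R -> R -> R).
Hypotheses (T0 : 0 < T) (hlift : lift_control p S P T w).
Hypotheses (b0 : 0 < b) (ba : b <= p^-1) (th1 : 1 < p^-1 + p^-1 + b).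

Lemma grid_mesh_to_0 : partition_upto (P n) T @[n --> \oo] --> mesh_to_0 0 T.
Proof.
move=> A [e /= e0 hA]; have [_ _ _ /(_ T T0)[_ + _ _]] := hS.
move=> /cvgrPdist_lt/(_ _ e0); apply: filterS => n; rewrite sub0r normrN => h.
apply: hA; split; first exact: pu_itv hS n T T0.
by apply: le_lt_trans h; exact: ler_norm.
Qed.

(** The integral of a controlled path does not depend on its Gubinelli
    derivative: both integrals are limits along the grids, where they differ by
    weighted sums of second-order terms. *)
Lemma rough_integral_derivative (G : 'I_d -> unit -> R -> R)
    (G1 G2 : 'I_d -> 'I_d -> unit -> R -> R) :
  (forall i, ctl S T w p^-1 b (G i) (G1 i)) ->
  (forall i, ctl S T w p^-1 b (G i) (G2 i)) ->
  mesh_lim (rough_germ S P G G1 tt) T = mesh_lim (rough_germ S P G G2 tt) T.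
Proof.
move=> h1 h2; have [hw _ _ _] := hlift.
have cv Gd (h : forall i, ctl S T w p^-1 b (G i) (Gd i)) :
    riemann_sum (rough_germ S P G Gd tt) 0 (partition_upto (P n) T) @[n --> \oo] -->
    mesh_lim (rough_germ S P G Gd tt) T.
  apply: cvg_comp grid_mesh_to_0 _.
  by apply: (sewing_cvg hw th1 (ord_rough_defect hlift b0 ba h)
    (van_rough_defect hS T0 hlift b0 ba h)) => //; exact: ltW.
have c12 := cvgB (cv _ h1) (cv _ h2).
have c0 : riemann_sum (rough_germ S P G G1 tt) 0 (partition_upto (P n) T) -
    riemann_sum (rough_germ S P G G2 tt) 0 (partition_upto (P n) T) @[n --> \oo] -->
    \sum_(i < d) \sum_(j < d) (0 : R).
  have E n : riemann_sum (rough_germ S P G G1 tt) 0 (partition_upto (P n) T) -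
      riemann_sum (rough_germ S P G G2 tt) 0 (partition_upto (P n) T) =
    \sum_i \sum_j \sum_(x <- steps 0 (partition_upto (P n) T))
      (G1 i j tt x.1 - G2 i j tt x.1) * level2 S P x.1 x.2 j i.
    under [RHS]eq_bigr do rewrite exchange_big.
    rewrite exchange_big /riemann_sum -sumrB; apply: eq_bigr => x _.
    rewrite /rough_germ opprD addrACA subrr add0r -sumrB; apply: eq_bigr => i _.
    by rewrite -sumrB; apply: eq_bigr => j _; rewrite /area; ring.
  under eq_fun do rewrite E.
  pose u i j n := \sum_(x <- steps 0 (partition_upto (P n) T))
      (G1 i j tt x.1 - G2 i j tt x.1) * level2 S P x.1 x.2 j i.
  apply: (@cvg_sum R 'I_d _ (fun i n => \sum_j u i j n)) => i.
  apply: (@cvg_sum R 'I_d _ (u i)) => j; rewrite /u.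
  have p0 : 0 < p by apply: lt_trans p2; rewrite ltr0n.
  apply: (@level2_sum_cvg0 _ _ p S P p2 hS T w b (fun t => G1 i j tt t - G2 i j tt t)) => //.
  - rewrite b0 (le_lt_trans ba)// invf_lt1//; by apply: lt_trans p2; rewrite ltr1n.
  - by rewrite mulr2n mulrDl mul1r.
  - have [_ _ k1 _] := h1 i; have [_ _ k2 _] := h2 i.
    apply: ord_ext (ordB (k1 j) (k2 j)) => -[] s t _ _ _.
    by rewrite /inc; ring.
have := cvg_unique (@Rhausdorff R) (c12 _) c0.
rewrite (_ : \sum_(i < d) \sum_(j < d) 0 = 0); last by rewrite big1// => i _; rewrite big1.
by move=> h; apply: subr0_eq; exact: h.
Qed.

End derivative_choice.

Section wealth_ratio.
Context {R : realType} {d : nat} {X : Type}.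
Variables (p : R) (S : R -> 'cV[R]_d) (P : nat -> nat -> R).
Hypotheses (hS : price_path_along p S P).
Variables (T b : R) (w : R -> R -> R).
Hypotheses (T0 : 0 < T) (hlift : lift_control p S P T w).
Hypotheses (b0 : 0 < b) (ba : b <= p^-1) (th1 : 1 < p^-1 + p^-1 + b).
Variables (G H : 'I_d -> X -> R -> R) (G' H' : 'I_d -> 'I_d -> X -> R -> R).
Hypothesis hG : forall i, ctl S T w p^-1 b (G i) (G' i).
Hypothesis hH : forall i, ctl S T w p^-1 b (H i) (H' i).

Local Notation a := (p^-1).
Local Notation th := (p^-1 + p^-1 + b).
Local Notation LG := (log_wealth S P G G').
Local Notation LH := (log_wealth S P H H').

(** The error of the second-order expansion of exp(L_G - L_H).  Up
    to negligible terms the exponent is z = l + (q_G - q_H) - (lin_G^2 - lin_H^2) / 2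
    with l = lin_G - lin_H, and adding the term z^2 / 2 ~ l^2 / 2 of the exponential
    turns the difference of squares into - l lin_H. *)
Definition ratio_rem (x : X) (s t : R) : R :=
  expR (inc LG x s t - inc LH x s t) - 1
  - ((lin S G x s t - lin S H x s t) + (quad S P G G' x s t - quad S P H H' x s t)
     - (lin S G x s t - lin S H x s t) * lin S H x s t).

Let hw : control_function `[0, T] w. Proof. by case: hlift. Qed.
Let a0 : 0 < a. Proof. exact: lt_le_trans ba. Qed.
Let aa0 : 0 < a + a. Proof. by rewrite addr_gt0. Qed.

Let z (x : X) s t := inc LG x s t - inc LH x s t.
Let l (x : X) s t := lin S G x s t - lin S H x s t.

Let oz : ord T w a z.
Proof. by apply: ordB; apply: (ord_log_wealth hS T0 hlift b0 ba th1). Qed.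

Let vz : van T z.
Proof. by apply: vanB; apply: (van_log_wealth hS T0 hlift b0 ba th1). Qed.

Let ol : ord T w a l.
Proof. by apply: ordB; [exact: (ord_lin hlift hG)|exact: (ord_lin hlift hH)]. Qed.

Let vl : van T l.
Proof. by apply: vanB; [exact: (van_lin hS hG)|exact: (van_lin hS hH)]. Qed.

Let ozl : ord T w (a + a) (fun x s t => z x s t - l x s t).
Proof.
apply: ord_ext (ordB (ord_log_wealth2 hS T0 hlift b0 ba th1 hG)
  (ord_log_wealth2 hS T0 hlift b0 ba th1 hH)) => x s t _ _ _.
by rewrite /z /l; ring.
Qed.

Let ratio_remE x s t : ratio_rem x s t =
  (expR (z x s t) - 1 - z x s t - 2^-1 * z x s t ^+ 2)
  + (wealth_rem S P G G' x s t - wealth_rem S P H H' x s t)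
  + 2^-1 * ((z x s t - l x s t) * (z x s t + l x s t)).
Proof.
rewrite /ratio_rem /wealth_rem -/(z x s t) /l.
have -> : inc LG x s t = z x s t + inc LH x s t by rewrite /z subrK.
by field.
Qed.

Lemma ord_ratio_rem : ord T w th ratio_rem.
Proof.
have le3 E : ord T w (a + a + a) E -> ord T w th E.
  by apply: (ord_le hw); [exact: lt_trans th1|rewrite lerD2l].
have e1 := le3 _ _ (ord_expR3 hw a0 oz).
have e2 := ordB (ord_wealth_rem hS T0 hlift b0 ba th1 hG)
  (ord_wealth_rem hS T0 hlift b0 ba th1 hH).
have e3 := ord_bdl (bd_cst T 2^-1) (le3 _ _ (ordM aa0 a0 ozl (ordD oz ol))).
apply: ord_ext (ordD (ordD e1 e2) e3) => x s t _ _ _.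
by rewrite ratio_remE.
Qed.

Lemma van_ratio_rem : van T ratio_rem.
Proof.
apply: van_ext (vanD (vanD (van_expR3 hw a0 oz vz)
  (vanB (van_wealth_rem hS T0 hlift b0 ba th1 hG) (van_wealth_rem hS T0 hlift b0 ba th1 hH)))
  (van_bdl (bd_cst T 2^-1) (van_ordM hw aa0 ozl (vanD vz vl)))) => x s t _ _ _.
by rewrite ratio_remE.
Qed.

End wealth_ratio.

(** * Averages over a compact space *)

Section compact_averages.
Context {R : realType} {K : pmetricType R}.
Hypothesis hK : compact [set: K].
Variable m : probability (g_sigma_algebraType (@open K)) R.
Implicit Types f g : K -> R.

Local Notation M := (g_sigma_algebraType (@open K)).

Definition average f : R := fine (\int[m]_(x in [set: M]) (f x)%:E)%E.

Lemma measurable_continuous f : continuous f -> measurable_fun [set: M] (f : M -> R).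
Proof.
move=> /continuousP cf; apply: (measurability _ (RGenOInfty.measurableE R)).
move=> _ [_ [a ->] <-]; rewrite setTI; apply: sub_sigma_algebra.
apply: cf; exact: interval_open.
Qed.

Lemma continuous_bounded f : continuous f -> exists2 k, 0 <= k & forall x, `|f x| <= k.
Proof.
move=> cf.
have cw : {within [set: K], continuous (fun x => `|f x|)}.
  apply: continuous_subspaceT => x; apply: continuous_comp; first exact: cf.
  exact: norm_continuous.
have [|c _ hc] := compact_EVT_max _ hK cw; first by exists point.
by exists `|f c| => // x; apply: hc; rewrite inE.
Qed.

Lemma integrable_continuous f : continuous f ->
  m.-integrable [set: M] (EFin \o (f : M -> R)).
Proof.
move=> cf; have [k k0 hk] := continuous_bounded cf.
apply: measurable_bounded_integrable => //.
- by rewrite (le_lt_trans (probability_le1 _ _))// ltry.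
- exact: measurable_continuous.
- exists k; split; first exact: num_real.
  by move=> y ky x _; exact: le_trans (hk x) (ltW ky).
Qed.

Lemma averageD f g : continuous f -> continuous g ->
  average (fun x => f x + g x) = average f + average g.
Proof. by move=> cf cg; apply: RintegralD => //; exact: integrable_continuous. Qed.

Lemma averageZ k f : continuous f -> average (fun x => k * f x) = k * average f.
Proof. by move=> cf; apply: RintegralZl => //; exact: integrable_continuous. Qed.

Lemma average_cst k : average (fun _ => k) = k.
Proof.
have := @Rintegral_cst _ M R m setT measurableT k; rewrite /Rintegral /average => ->.
exact: etrans (congr1 (fun y => k * fine y) (probability_setT m)) (mulr1 k).
Qed.

Lemma average_le f g : continuous f -> continuous g -> (forall x, f x <= g x) ->
  average f <= average g.
Proof.
by move=> cf cg fg; apply: le_Rintegral => //; exact: integrable_continuous.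
Qed.

Lemma averageN f : continuous f -> average (fun x => - f x) = - average f.
Proof.
move=> cf; have := averageZ (-1) cf; rewrite mulN1r => <-.
by congr average; apply/funext => x; rewrite mulN1r.
Qed.

Lemma continuous_opp f : continuous f -> continuous (fun x => - f x).
Proof. by move=> cf x; apply: continuousN; exact: cf. Qed.

Lemma continuous_add f g : continuous f -> continuous g -> continuous (fun x => f x + g x).
Proof. by move=> cf cg x; apply: continuousD; [exact: cf|exact: cg]. Qed.

Lemma continuous_mul f g : continuous f -> continuous g -> continuous (fun x => f x * g x).
Proof. by move=> cf cg x; apply: continuousM; [exact: cf|exact: cg]. Qed.

Lemma continuous_sum (I : Type) (r : seq I) (f : I -> K -> R) :
  (forall i, continuous (f i)) -> continuous (fun x => \sum_(i <- r) f i x).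
Proof.
move=> h; elim: r => [|i r IH].
  have -> : (fun x => \sum_(i <- [::]) f i x) = cst 0 by apply/funext => x; rewrite big_nil.
  exact: cst_continuous.
have -> : (fun x => \sum_(j <- i :: r) f j x) = (fun x => f i x + \sum_(j <- r) f j x).
  by apply/funext => x; rewrite big_cons.
exact: continuous_add.
Qed.

Lemma averageB f g : continuous f -> continuous g ->
  average (fun x => f x - g x) = average f - average g.
Proof.
by move=> cf cg; rewrite averageD ?averageN//; exact: continuous_opp.
Qed.

Lemma average_sum (I : Type) (r : seq I) (f : I -> K -> R) :
  (forall i, continuous (f i)) ->
  average (fun x => \sum_(i <- r) f i x) = \sum_(i <- r) average (f i).
Proof.
move=> h; elim: r => [|i r IH].
  rewrite big_nil -[RHS](average_cst 0); congr average.
  by apply/funext => x; rewrite big_nil.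
rewrite big_cons -IH -averageD//; last exact: continuous_sum.
by congr average; apply/funext => x; rewrite big_cons.
Qed.

Lemma average_norm f k : continuous f -> (forall x, `|f x| <= k) -> `|average f| <= k.
Proof.
move=> cf hk; have h x : - k <= f x <= k by rewrite -ler_norml.
rewrite ler_norml -{1}(average_cst (- k)) -{2}(average_cst k).
apply/andP; split; apply: average_le => //; try exact: cst_continuous.
  by move=> x; case/andP: (h x).
by move=> x; case/andP: (h x).
Qed.

Lemma average_eq f g : f =1 g -> average f = average g.
Proof. by move=> fg; congr average; apply/funext. Qed.

(** Averages of a uniformly bounded family of continuous paths are continuous,
    by dominated convergence. *)
Lemma econt_average (T : R) (f : K -> R -> R) : bd T f ->
  (forall t, 0 <= t -> t <= T -> continuous (f ^~ t)) ->
  (forall x, econt T (f x)) -> econt T (fun t => average (f ^~ t)).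
Proof.
move=> [k k0 hk] cK cT.
have [T0|T0] := ltP T 0; first by move=> t e t0 tT; move: (le_lt_trans t0 (le_lt_trans tT T0)); rewrite ltxx.
pose cl (t : R) := Num.max 0 (Num.min t T).
have cl0 t : 0 <= cl t by rewrite /cl le_max lexx.
have clT t : cl t <= T by rewrite /cl ge_max T0 ge_min lexx orbT.
have clE t : 0 <= t -> t <= T -> cl t = t by move=> t0 tT; rewrite /cl min_l// max_r.
have cl_lip s t : `|cl s - cl t| <= `|s - t|.
  wlog st : s t / s <= t => [hw|].
    by have [st|/ltW ts] := leP s t; [exact: hw|rewrite distrC (distrC s); exact: hw].
  rewrite ler0_norm ?subr_le0 ?ge_max// ?le_max ?lexx//=; last first.
    by rewrite le_min !ge_min lexx st !orbT.
  rewrite ler0_norm ?subr_le0// !opprB /cl; case: (leP s T) => h1; case: (leP t T) => h2;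
    rewrite ?(max_r T0); case: (leP 0 s) => h3; case: (leP 0 t) => h4; lra.
have inI t : 0 <= t -> t <= T -> t \in `]-1, (T + 1)[%classic.
  by move=> t0 tT; rewrite inE /= in_itv /=; apply/andP; split; move: t0 tT T0; lra.
have hint t : m.-integrable [set: M] (EFin \o ((fun x => f x (cl t)) : M -> R)).
  by apply: integrable_continuous; exact: cK.
have hcf x : continuous (fun t => f x (cl t)).
  move=> t; apply/cvgrPdist_lt => e e0.
  have [dl dl0 h] := cT x (cl t) e (cl0 t) (clT t) e0.
  apply/nbhs_ballP; exists dl => //= s; rewrite /ball /= => ts.
  rewrite distrC; apply: h => //.
  by apply: (le_lt_trans (cl_lip _ _)); rewrite distrC.
have := @continuity_under_integral R _ M m (fun t x => f x (cl t)) setT measurableT (-1) (T + 1).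
move=> /(_ (fun t _ => hint t) _ (fun _ => k) _ _) h t e t0 tT e0.
have {}h : {in `]-1, (T + 1)[%classic, continuous (fun t => average (fun x => f x (cl t)))}.
  apply: h.
  - by apply: aeW => x _ s _; exact: hcf.
  - apply: (@integrable_continuous (fun _ => k)); exact: cst_continuous.
  - by move=> s _; apply: aeW => x _; exact: hk.
have /cvgrPdist_lt/(_ e e0)/nbhs_ballP[dl /= dl0 {}h] := h t (inI t t0 tT).
exists dl => // s s0 sT st; have := h s; rewrite /ball /= distrC => /(_ st).
by rewrite !clE// distrC.
Qed.

End compact_averages.

(** * Integration against the image measure *)

Section conull_integral.
Context d (T : measurableType d) {R : realType}.
Variable mu : {measure set T -> \bar R}.
Local Open Scope ereal_scope.

Import HBNNSimple.

(** Integrals of functions that agree on a conull set agree, measurable or not: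
    a simple function below one can be cut down to the conull set without
    changing its integral. *)
Lemma integral_conull (D E : set T) (f g : T -> \bar R) : measurable E ->
  mu (~` E) = 0 -> (forall x, E x -> f x = g x) ->
  \int[mu]_(x in D) f x = \int[mu]_(x in D) g x.
Proof.
move=> mE E0 fg.
suff H (u v : T -> \bar R) : (forall x, 0 <= v x) -> (forall x, E x -> u x = v x) ->
    ereal_sup [set sintegral mu h | h in [set h : {nnsfun T >-> R} | forall x, (h x)%:E <= u x]]
    <= ereal_sup [set sintegral mu h | h in [set h : {nnsfun T >-> R} | forall x, (h x)%:E <= v x]].
  have fgD x : E x -> (f \_ D) x = (g \_ D) x by move=> Ex; rewrite /patch fg.
  rewrite /integral; congr (_ - _); apply/eqP; rewrite eq_le; apply/andP; split; apply: H => x;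
    rewrite ?funepos_ge0 ?funeneg_ge0// => Ex; by rewrite ?funeposE ?funenegE fgD.
move=> v0 uv; apply: ge_ereal_sup => _ [h hu <-].
pose h' : {nnsfun T >-> R} := proj_nnsfun h mE.
have h'E x : h' x = (h \_ E) x by rewrite (mrestrict h mE).
have -> : sintegral mu h = sintegral mu h'.
  rewrite -!integralT_nnsfun; apply: ge0_ae_eq_integral.
  - exact: measurableT.
  - by apply/measurable_EFinP.
  - by apply/measurable_EFinP.
  - by move=> x _; rewrite lee_fin.
  - by move=> x _; rewrite lee_fin.
  exists (~` E); split => //; first exact: measurableC.
  move=> x hx Ex; apply: hx => _; congr EFin.
  by rewrite h'E /patch mem_set.
apply: ereal_sup_ubound; exists h' => // x; rewrite h'E /patch.
by case: ifPn => [/set_mem Ex|_]; [rewrite -uv|exact: v0].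
Qed.

End conull_integral.

Section embedded_compact.
Context {R : realType} {d : nat} {K : pmetricType R}.
Hypothesis hK : compact [set: K].
Variable m : probability (g_sigma_algebraType (@open K)) R.
Variables (A : set (@cpath R d)) (dist : @cpath R d -> @cpath R d -> \bar R).
Variables (J : Type) (phi : J -> @cpath R d -> R) (iota : K -> @cpath R d).
Hypothesis iotaA : forall x, A (iota x).
Hypothesis iota_inj : injective iota.
Hypothesis iota_cont : forall x (e : R), 0 < e ->
  \forall y \near x, (dist (iota x) (iota y) < e%:E)%E.

(** The functionals phi stand for evaluation at all times. *)
Hypothesis phi_lip : forall j, exists2 k, 0 <= k & forall F G e, 0 < e ->
  (dist F G < e%:E)%E -> `|phi j F - phi j G| <= k * e.
Hypothesis phi_sep : forall F G, A F -> A G -> (forall j, phi j F = phi j G) -> F = G.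

Local Notation M := (g_sigma_algebraType (@open K)).
Local Notation B := (borel_in A dist).

Lemma continuous_functional j : continuous (phi j \o iota).
Proof.
move=> x; apply/cvgrPdist_le => e e0; have [k k0 hk] := phi_lip j.
have k10 : 0 < k + 1 by rewrite ltr_wpDl.
have ek0 : 0 < e / (k + 1) by rewrite divr_gt0.
have := iota_cont x ek0; apply: filterS => y /(hk _ _ _ ek0) h /=.
apply: (le_trans h); rewrite mulrCA ger_pMr// ler_pdivrMr// mul1r lerDl//.
Qed.

(** A point F outside the image of the compact C is separated from each point of
    it by some functional, hence by a ball around F; finitely many such
    separations cover C. *)
Lemma image_closed_open (C : set K) : closed C -> open_in A dist (A `\` (iota @` C)).
Proof.
move=> cC; split; first by move=> F [].
move=> F [AF FC].
have := (compact_near_coveringP _).1 hK R (0 : R)^'+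
  (fun e x => ~ (C x /\ (dist F (iota x) < e%:E)%E)).
case.
  move=> x _; have [Cx|nCx] := pselect (C x); last first.
    exists (~` C, setT); first split => /=; last by move=> [y e] /= [nCy _] [].
      by apply: open_nbhs_nbhs; split => //; exact: closed_openC.
    exact: filterT.
  have [j hj] : exists j, phi j F <> phi j (iota x).
    apply: contrapT => h; apply: FC; exists x => //; apply: phi_sep => // j.
    by apply: contrapT => hj; apply: h; exists j => /esym.
  have [k k0 hk] := phi_lip j.
  have k10 : 0 < 2 * (k + 1) by rewrite mulr_gt0// ltr_wpDl.
  set eta := `|phi j F - phi j (iota x)|.
  have eta0 : 0 < eta by rewrite normr_gt0 subr_eq0; exact/eqP.
  have eta20 : 0 < eta / 2 by rewrite divr_gt0.
  have /cvgrPdist_lt/(_ _ eta20) hx := @continuous_functional j x.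
  exists ([set y | `|phi j (iota x) - phi j (iota y)| < eta / 2],
          [set e | 0 < e < eta / (2 * (k + 1))]); first split => //=.
    have r1 : \forall e \near (0 : R)^'+, 0 < e by exact: nbhs_right_gt.
    have r2 : \forall e \near (0 : R)^'+, e < eta / (2 * (k + 1)).
      by apply: nbhs_right_lt; rewrite divr_gt0.
    by apply: filterS2 r1 r2 => e h1 h2; rewrite /= h1 h2.
  move=> [y e] /= [hy /andP[e0 he]] [_ /(hk _ _ _ e0) hd].
  have : eta < eta.
    have ke : k * e <= eta / 2.
      apply: (@le_trans _ _ ((k + 1) * (eta / (2 * (k + 1))))).
        by rewrite ler_pM ?(ltW e0) ?(ltW he)// lerDl.
      by rewrite le_eqVlt; apply/orP; left; apply/eqP; field; rewrite gt_eqF// ltr_wpDl.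
    have : eta <= `|phi j F - phi j (iota y)| + `|phi j (iota x) - phi j (iota y)|.
      have e1 : phi j F - phi j (iota x) =
          (phi j F - phi j (iota y)) - (phi j (iota x) - phi j (iota y)) by ring.
      by rewrite /eta e1; exact: ler_normB.
    by move: hy hd ke; move: `|_| `|_| (k * e) => u v z; lra.
  by rewrite ltxx.
move=> r /= r0 h; have r20 : 0 < r / 2 by rewrite divr_gt0.
exists (r / 2) => // G AG FG; split => // -[x Cx xG].
apply: (h (r / 2) _ r20 x I); last by rewrite xG.
by rewrite /ball_ /= sub0r normrN gtr0_norm// gtr_pMr// invf_lt1// ltr1n.
Qed.

Lemma measurable_A : measurable (A : set B).
Proof.
apply: sub_sigma_algebra; split => // F AF; exists 1 => // G AG _.
Qed.

Lemma measurable_image (C : set K) : closed C -> measurable (iota @` C : set B).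
Proof.
move=> cC; have -> : (iota @` C : set B) = (A : set B) `\` (A `\` (iota @` C)).
  apply/seteqP; split=> [_ [x Cx <-]|F [AF h]].
    by split => //= -[_ h]; apply: h; exists x.
  by apply: contrapT => nF; apply: h.
apply: measurableD; first exact: measurable_A.
by apply: sub_sigma_algebra; exact: image_closed_open.
Qed.

Lemma measurable_iota : measurable_fun [set: M] (iota : M -> B).
Proof.
apply: (@measurability _ _ M B setT iota (open_in A dist) erefl) => _ [U [UA hU] <-].
rewrite setTI; apply: sub_sigma_algebra; rewrite openE => x Ux.
have [e e0 he] := hU _ Ux.
by have := iota_cont x e0; apply: filterS => y; exact: he.
Qed.

(** A measurable retraction onto K, through which functions on the admissible
    set are replaced by measurable ones. *)
Definition iota_inv (F : @cpath R d) : K :=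
  if pselect (exists x, iota x = F) is left h then projT1 (cid h) else point.

Lemma iotaK : cancel iota iota_inv.
Proof.
move=> x; rewrite /iota_inv; case: pselect => [h|[]]; last by exists x.
by apply: iota_inj; exact: projT2 (cid h).
Qed.

Lemma measurable_iota_inv : measurable_fun [set: B] (iota_inv : B -> M).
Proof.
apply: (@measurability _ _ B M setT iota_inv (@open K) erefl) => _ [U oU <-]; rewrite setTI.
have mC : measurable (iota_inv @^-1` (~` U) : set B).
  have -> : (iota_inv @^-1` (~` U) : set B) = (iota @` (~` U) : set B) `|`
      (if pselect ((~` U) point) then ~` (iota @` [set: K]) else set0).
    apply/seteqP; split=> F /=.
      have [[x <-]|nF] := pselect (exists x, iota x = F).
        by rewrite iotaK => nU; left; exists x.
      rewrite {1}/iota_inv; case: pselect => // _ nU; right.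
      by case: pselect => //= _ [x _ xF]; apply: nF; exists x.
    move=> [[x nU <-]|]; first by rewrite iotaK.
    case: pselect => //= nU nF; rewrite /iota_inv; case: pselect => // -[x xF].
    by exfalso; apply: nF; exists x.
  apply: measurableU; first by apply: measurable_image; exact: open_closedC.
  case: pselect => h /=; last exact: measurable0.
  apply: measurableC; apply: measurable_image.
  exact: closedT.
by rewrite -[X in measurable X]setCK; exact: measurableC.
Qed.

Let nu : set B -> \bar R := pushforward m (iota : M -> B).

(** The integrand is only known to be well behaved on the image of iota: off it,
    nothing makes f measurable.  The image is measurable of full mass, so f may
    be replaced by its composite with the retraction. *)
Lemma integral_iota (f : @cpath R d -> R) : continuous (f \o iota) ->
  fine (\int[nu]_(F in (A : set B)) (f F)%:E)%E = average m (f \o iota).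
Proof.
move=> cf; pose g : B -> R := f \o iota \o iota_inv.
pose nuM : {measure set B -> \bar R} := pushforward m (iota : M -> B).
pose nu' : {measure set B -> \bar R} := nuM measurable_iota.
have mg : measurable_fun [set: B] (EFin \o g).
  apply/measurable_EFinP.
  by apply: measurableT_comp measurable_iota_inv; exact: measurable_continuous.
have fg : (\int[nu]_(F in (A : set B)) (f F)%:E = \int[nu']_(F in (A : set B)) (g F)%:E)%E.
  apply: (@integral_conull _ _ _ nu' _ (iota @` [set: K])).
  - by apply: measurable_image; exact: closedT.
  - rewrite /nu' /nuM /= /pushforward [X in m X](_ : _ = set0) ?measure0//.
    by apply/seteqP; split=> // x /= h; apply: h; exists x.
  - by move=> _ [x _ <-]; rewrite /g /= iotaK.
rewrite fg /average (integral_pushforward measurable_iota mg).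
- congr fine.
  have -> : (iota @^-1` A : set M) = [set: M] by apply/seteqP; split => // x _; exact: iotaA.
  by apply: eq_integral => x _; rewrite /g /= iotaK.
- have -> : (EFin \o g) \o iota = EFin \o (f \o iota).
    by apply/funext => x; rewrite /g /= iotaK.
  have -> : (iota @^-1` A : set M) = [set: M] by apply/seteqP; split => // x _; exact: iotaA.
  exact: integrable_continuous.
- exact: measurable_A.
Qed.

End embedded_compact.

(** * Evaluation functionals on admissible portfolios *)

Section variation_norms.
Context {R : realType}.

Lemma pvar_ge0 {m n} a (A : R -> R -> 'M[R]_(m, n)) s t : s <= t -> (0 <= pvar a A s t)%E.
Proof.
move=> st; have [l pl _] := exists_fine_partition st ltr01.
apply: (@le_trans _ _ ((\sum_(w <- steps s l) enorm (A w.1 w.2) `^ a) `^ a^-1)%:E).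
  by rewrite lee_fin powR_ge0.
by apply: ereal_sup_ubound; exists l.
Qed.

Lemma pvar_sum_le {m n} a (A : R -> R -> 'M[R]_(m, n)) s t k l : 0 < a ->
  (pvar a A s t <= k%:E)%E -> itv_partition s t l ->
  \sum_(w <- steps s l) enorm (A w.1 w.2) `^ a <= k `^ a.
Proof.
move=> a0 hk pl; set x := \sum_(w <- _) _.
have x0 : 0 <= x by apply: sumr_ge0 => w _; exact: powR_ge0.
have h : x `^ a^-1 <= k.
  by rewrite -lee_fin; apply: le_trans hk; apply: ereal_sup_ubound; exists l.
rewrite [leLHS](_ : x = (x `^ a^-1) `^ a); last by rewrite -powRrM mulVf ?powRr1// gt_eqF.
by apply: ler_powR2 => //; [exact: ltW|exact: powR_ge0].
Qed.

Lemma pvar_initial_le {m n} a (A : R -> R -> 'M[R]_(m, n)) s t T k : 0 < a -> 0 <= k ->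
  (pvar a A s T <= k%:E)%E -> s < t -> t <= T -> enorm (A s t) <= k.
Proof.
move=> a0 k0 hk st tT.
have [l pl _] := exists_fine_partition tT ltr01.
have ptl : itv_partition s T (t :: l).
  by have [h1 h2] := pl; split => //=; rewrite st.
have := pvar_sum_le a0 hk ptl; rewrite steps_cons big_cons /= => h.
have {h} : enorm (A s t) `^ a <= k `^ a.
  by apply: le_trans h; rewrite lerDl; apply: sumr_ge0 => w _; exact: powR_ge0.
move=> /(powR_le_root a0 (enorm_ge0 _)).
by rewrite -powRrM divff ?powRr1// gt_eqF.
Qed.

End variation_norms.

Section evaluations.
Context {R : realType} {d : nat}.
Variables (q r q' r' M : R) (mu : R -> 'cV[R]_d) (c : R -> R -> R) (beta : nat -> R).
Hypotheses (q'0 : 0 < q') (r'0 : 0 < r') (M0 : 0 < M).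
Hypothesis beta0 : forall N, (0 < N)%N -> 0 < beta N.
Hypothesis mu0 : forall t i, 0 <= t -> 0 < mu t i ord0.

(** An admissible pair vanishes before time 0, so that its values at the times
    max(0, t) determine it. *)
Definition evaluation (j : R * ('I_d + 'I_d * 'I_d)) (F : @cpath R d) : R :=
  match j.2 with
  | inl i => F.1 (Num.max 0 j.1) i ord0
  | inr ij => F.2 (Num.max 0 j.1) ij.1 ij.2
  end.

Lemma overE1 F t i : (Defs.over mu F).1 t i ord0 = F.1 t i ord0 / mu t i ord0.
Proof. by rewrite /Defs.over /= !mxE. Qed.

Lemma overE2 F t i j : (Defs.over mu F).2 t i j =
  F.2 t i j / mu t i ord0 - F.1 t i ord0 * (mu t i ord0) ^- 2 *+ (i == j).
Proof. by rewrite /Defs.over /= !mxE; case: eqP => _; rewrite ?mulr1n ?mulr0n; ring. Qed.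

Lemma gamma_gt0 N : 0 < gamma q r M c N.
Proof. by rewrite /gamma -!addrA ltr_wpDr// !addr_ge0 ?powR_ge0// ltW. Qed.

Lemma dbeta_norm_le F G e N : (0 < N)%N -> 0 < e ->
  (dbeta beta q r q' r' mu M c F G < e%:E)%E ->
  (controlled_norm q' r' mu N%:R (Defs.over mu (csub F G)) <= (e * (beta N * gamma q r M c N))%:E)%E.
Proof.
move=> N0 e0 h; have bg0 : 0 < beta N * gamma q r M c N by rewrite mulr_gt0 ?beta0 ?gamma_gt0.
have : (((beta N * gamma q r M c N)^-1)%:E *
    controlled_norm q' r' mu N%:R (Defs.over mu (csub F G)) <= e%:E)%E.
  by apply: le_trans (ltW h); apply: ereal_sup_ubound; exists N.
by rewrite lee_pdivrMl// -EFinM mulrC.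
Qed.

Let adde4_ge (x1 x2 x3 x4 : \bar R) : (0 <= x1)%E -> (0 <= x2)%E -> (0 <= x3)%E ->
  (0 <= x4)%E -> [/\ (x1 <= x1 + x2 + x3 + x4)%E, (x2 <= x1 + x2 + x3 + x4)%E,
    (x3 <= x1 + x2 + x3 + x4)%E & (x4 <= x1 + x2 + x3 + x4)%E].
Proof.
move=> h1 h2 h3 h4; have h12 := adde_ge0 h1 h2; have h123 := adde_ge0 h12 h3.
split; last by rewrite leeDr.
- by rewrite -!addeA leeDl// addeA adde_ge0// adde_ge0.
- by apply: le_trans (leeDl _ h4); apply: le_trans (leeDl _ h3); exact: leeDr.
- by apply: le_trans (leeDl _ h4); exact: leeDr.
Qed.

Lemma controlled_norm_parts F T k : 0 <= T -> (controlled_norm q' r' mu T F <= k%:E)%E ->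
  [/\ enorm (F.1 0) <= k, enorm (F.2 0) <= k, (pvar q' (incr F.2) 0 T <= k%:E)%E
    & (pvar r' (remainder mu F) 0 T <= k%:E)%E].
Proof.
move=> T0; rewrite /controlled_norm.
have h1 : (0 <= (enorm (F.1 0))%:E)%E by rewrite lee_fin enorm_ge0.
have h2 : (0 <= (enorm (F.2 0))%:E)%E by rewrite lee_fin enorm_ge0.
have h3 := @pvar_ge0 R _ _ q' (incr F.2) 0 T T0.
have h4 := @pvar_ge0 R _ _ r' (remainder mu F) 0 T T0.
have [g1 g2 g3 g4] := adde4_ge h1 h2 h3 h4.
move=> h; split; last 2 first.
- exact: le_trans g3 h.
- exact: le_trans g4 h.
- by rewrite -lee_fin; exact: le_trans g1 h.
- by rewrite -lee_fin; exact: le_trans g2 h.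
Qed.

(** The distance dominates the norm of the quotient by mu on [0, N] for N > t,
    and the norm dominates its values at t through those at 0 and one increment;
    multiplying by mu recovers the path. *)
Lemma evaluation_lip j : exists2 k, 0 <= k & forall F G e, 0 < e ->
  (dbeta beta q r q' r' mu M c F G < e%:E)%E ->
  `|evaluation j F - evaluation j G| <= k * e.
Proof.
case: j => t0 ij; set t := Num.max 0 t0.
have tge0 : 0 <= t by rewrite le_max lexx.
pose N := (Num.trunc t).+1.
have tN : t <= N%:R by rewrite ltW// truncnS_gt.
set bg := beta N * gamma q r M c N.
have bg0 : 0 < bg by rewrite mulr_gt0 ?beta0 ?gamma_gt0.
set v := \sum_j `|mu t j ord0 - mu 0 j ord0|.
have v0 : 0 <= v by exact: sumr_ge0.
have main F G e : 0 < e -> (dbeta beta q r q' r' mu M c F G < e%:E)%E ->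
    let D := Defs.over mu (csub F G) in
    (forall i, `|D.1 t i ord0| <= (2 + v) * (e * bg)) /\
    (forall i j, `|D.2 t i j| <= 2 * (e * bg)).
  move=> e0 h D; have := @dbeta_norm_le F G e N (ltn0Sn _) e0 h; rewrite -/bg -/D.
  set k := e * bg; have k0 : 0 <= k by rewrite mulr_ge0// ltW.
  move=> hk; have [h1 h2 h3 h4] := controlled_norm_parts (ler0n R N) hk.
  have inc0 m n (A : R -> R -> 'M[R]_(m, n)) a : 0 < a -> A 0 0 = 0 ->
      (pvar a A 0 N%:R <= k%:E)%E -> enorm (A 0 t) <= k.
    move=> a0 A0 hA; move: tge0; rewrite le_eqVlt => /predU1P[<-|tgt0].
      by rewrite A0 enorm0.
    exact: (pvar_initial_le a0 k0 hA).
  have {}h3 : enorm (incr D.2 0 t) <= k by apply: inc0 h3; rewrite // /incr subrr.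
  have {}h4 : enorm (remainder mu D 0 t) <= k.
    by apply: inc0 h4; rewrite // /remainder /incr !subrr mulmx0 subrr.
  split=> [i|i j].
    have e1 : D.1 t i ord0 = D.1 0 i ord0 + \sum_j D.2 0 i j * (mu t j ord0 - mu 0 j ord0)
        + remainder mu D 0 t i ord0.
      rewrite /remainder /incr !mxE.
      under eq_bigr do rewrite !mxE.
      under [X in _ = _ + (_ - _ - X)]eq_bigr do rewrite !mxE.
      by ring.
    rewrite e1 (le_trans (ler_normD _ _))//.
    have b1 : `|D.1 0 i ord0| <= k by apply: le_trans h1; exact: enorm_ge.
    have b2 : `|remainder mu D 0 t i ord0| <= k by apply: le_trans h4; exact: enorm_ge.
    have b3 : `|\sum_j D.2 0 i j * (mu t j ord0 - mu 0 j ord0)| <= v * k.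
      apply: (le_trans (ler_norm_sum _ _ _)); rewrite /v mulr_suml; apply: ler_sum => j _.
      rewrite normrM mulrC ler_wpM2l//; apply: le_trans h2; exact: enorm_ge.
    have -> : (2 + v) * k = k + v * k + k by ring.
    by rewrite lerD// (le_trans (ler_normD _ _))// lerD.
  have e2 : D.2 t i j = D.2 0 i j + incr D.2 0 t i j by rewrite /incr !mxE; ring.
  rewrite e2 (le_trans (ler_normD _ _))// mulr2n mulrDl !mul1r lerD//.
    by apply: le_trans h2; exact: enorm_ge.
  by apply: le_trans h3; exact: enorm_ge.
case: ij => [i|[i j]].
  exists (mu t i ord0 * (2 + v) * bg).
    apply: mulr_ge0 _ (ltW bg0); apply: mulr_ge0 (ltW (mu0 i tge0)) _.
    exact: addr_ge0.
  move=> F G e e0 /(main _ _ _ e0)[/(_ i) + _]; rewrite overE1 /evaluation /= -/t.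
  rewrite !mxE normrM normfV [`|mu t i ord0|]gtr0_norm ?mu0//.
  rewrite ler_pdivrMr ?mu0// => /le_trans; apply.
  by rewrite le_eqVlt; apply/orP; left; apply/eqP; ring.
have m0 := mu0 i tge0.
exists (mu t i ord0 * (2 + (2 + v) / mu t i ord0) * bg).
  apply: mulr_ge0 _ (ltW bg0); apply: mulr_ge0 (ltW m0) _.
  by rewrite addr_ge0// divr_ge0 ?addr_ge0 ?(ltW m0).
move=> F G e e0 /(main _ _ _ e0)[/(_ i) + /(_ i j)].
set D := Defs.over mu (csub F G) => h1 h2; rewrite /evaluation /= -/t.
have -> : F.2 t i j - G.2 t i j = mu t i ord0 * (D.2 t i j + D.1 t i ord0 / mu t i ord0 *+ (i == j)).
  rewrite overE1 overE2 /= !mxE.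
  by case: (i == j); rewrite ?mulr1n ?mulr0n; field; rewrite gt_eqF.
have -> : mu t i ord0 * (2 + (2 + v) / mu t i ord0) * bg * e =
    mu t i ord0 * (2 * (e * bg) + (2 + v) * (e * bg) / mu t i ord0) by ring.
rewrite normrM (gtr0_norm m0) ler_wpM2l ?(ltW m0)//.
apply: (le_trans (ler_normD _ _)).
rewrite lerD//; case: (i == j); rewrite ?mulr1n ?mulr0n.
  by rewrite normrM normfV (gtr0_norm m0) ler_wpM2r// invr_ge0 ltW.
rewrite normr0 divr_ge0 ?(ltW m0)//; apply: mulr_ge0; first exact: addr_ge0.
by apply: mulr_ge0; exact: ltW.
Qed.

Lemma evaluation_sep F G : admissible q r mu M c F -> admissible q r mu M c G ->
  (forall j, evaluation j F = evaluation j G) -> F = G.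
Proof.
move=> [F0 _] [G0 _] h.
have h1 t i : 0 <= t -> F.1 t i ord0 = G.1 t i ord0.
  by move=> t0; have := h (t, inl i); rewrite /evaluation /= max_r.
have h2 t i j : 0 <= t -> F.2 t i j = G.2 t i j.
  by move=> t0; have := h (t, inr (i, j)); rewrite /evaluation /= max_r.
case: F G F0 G0 h h1 h2 => [F F'] [G G'] /= F0 G0 _ h1 h2; congr pair; apply/funext => t.
  have [t0|t0] := leP 0 t; last by rewrite (F0 t t0).1 (G0 t t0).1.
  by apply/matrixP => i j; rewrite (ord1 j) h1.
have [t0|t0] := leP 0 t; last by rewrite (F0 t t0).2 (G0 t t0).2.
by apply/matrixP => i j; rewrite h2.
Qed.

End evaluations.

(** * Finite variation and controls *)

Section variation_controls.
Context {R : realType} {m n : nat}.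
Variables (a T : R) (A : R -> R -> 'M[R]_(m, n)).
Hypotheses (a0 : 0 < a).

(** The a-variation to the power a over [s, t], as a control. *)
Definition variation_control (s t : R) : R :=
  sup [set \sum_(w <- steps s l) enorm (A w.1 w.2) `^ a | l in [set l | itv_partition s t l]].

Lemma variation_sum_bound : (pvar a A 0 T < +oo)%E ->
  exists k, forall s t l, 0 <= s -> t <= T -> itv_partition s t l ->
    \sum_(w <- steps s l) enorm (A w.1 w.2) `^ a <= k.
Proof.
move=> hf.
have [k hk] : exists k, (pvar a A 0 T <= k%:E)%E.
  case: (pvar a A 0 T) hf => [k _||] //; first by exists k.
  by exists 0; rewrite leNye.
exists (k `^ a) => s t l s0 tT pl.
have [l1 pl1 _] := exists_fine_partition s0 ltr01.
have [l2 pl2 _] := exists_fine_partition tT ltr01.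
have pp := itv_partition_cat pl1 (itv_partition_cat pl pl2).
apply: le_trans (pvar_sum_le a0 hk pp).
rewrite !steps_cat !big_cat /= (eqP pl1.2) addrCA lerDl.
by apply: addr_ge0; apply: sumr_ge0 => w _; exact: powR_ge0.
Qed.

Hypothesis hfin : (pvar a A 0 T < +oo)%E.

Let sums s t := [set \sum_(w <- steps s l) enorm (A w.1 w.2) `^ a | l in [set l | itv_partition s t l]].

Let sums_has_sup s t : 0 <= s -> s <= t -> t <= T -> has_sup (sums s t).
Proof.
move=> s0 st tT; split.
  have [l pl _] := exists_fine_partition st ltr01.
  by exists (\sum_(w <- steps s l) enorm (A w.1 w.2) `^ a), l.
have [k hk] := variation_sum_bound hfin.
by exists k => _ [l pl <-]; exact: (hk _ _ _ s0 tT pl).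
Qed.

Lemma variation_control_ge s t l : 0 <= s -> s <= t -> t <= T -> itv_partition s t l ->
  \sum_(w <- steps s l) enorm (A w.1 w.2) `^ a <= variation_control s t.
Proof.
by move=> s0 st tT pl; apply: (ub_le_sup (sums_has_sup s0 st tT).2); exists l.
Qed.

Lemma variation_controlP : control_function `[0, T] variation_control.
Proof.
have mem x : `[0, T]%classic x -> 0 <= x /\ x <= T by rewrite /= in_itv /= => /andP.
split=> [s t /mem[s0 _] /mem[_ tT] st|s u t /mem[s0 _] /mem[u0 uT] /mem[_ tT] su ut].
  have [l pl _] := exists_fine_partition st ltr01.
  apply: le_trans (variation_control_ge s0 st tT pl).
  by apply: sumr_ge0 => w _; exact: powR_ge0.
rewrite -lerBrDr; apply: ge_sup.
  by have [] := sums_has_sup s0 su uT.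
move=> _ [l1 pl1 <-]; rewrite lerBrDr addrC -lerBrDr; apply: ge_sup.
  by have [] := sums_has_sup u0 ut tT.
move=> _ [l2 pl2 <-]; rewrite lerBrDr addrC.
have := variation_control_ge s0 (le_trans su ut) tT (itv_partition_cat pl1 pl2).
by rewrite steps_cat big_cat /= (eqP pl1.2).
Qed.

Lemma variation_control_bound s t : 0 <= s -> s <= t -> t <= T -> A s s = 0 ->
  enorm (A s t) <= variation_control s t `^ a^-1.
Proof.
move=> s0 st tT A0; apply: powR_le_root => //; first exact: enorm_ge0.
have [ts|st'] := leP t s.
  have {ts} ts : t = s by apply/le_anti; rewrite ts st.
  rewrite ts in tT *; rewrite A0 enorm0 powR0 ?gt_eqF//.
  have := @variation_control_ge s s [::] s0 (lexx s) tT.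
  by rewrite big_nil; apply; split.
have := variation_control_ge s0 st tT (itv_partition1 st').
by rewrite steps_cons big_cons big_nil addr0.
Qed.

End variation_controls.

Section finite_variation.
Context {R : realType}.

Lemma pvar_finite {m n} a T w (A : R -> R -> 'M[R]_(m, n)) : 0 < a -> 0 <= T ->
  control_function `[0, T] w ->
  (forall i j, ord T w a^-1 (fun (_ : unit) s t => A s t i j)) ->
  (pvar a A 0 T < +oo)%E.
Proof.
move=> a0 T0 hw h.
have /choice[k hk] : forall ij : 'I_m * 'I_n, exists k, 0 <= k /\ forall s t,
    0 <= s -> s <= t -> t <= T -> `|A s t ij.1 ij.2| <= k * w s t `^ a^-1.
  move=> [i j]; have [k k0 hk] := h i j; exists k; split=> // s t.
  exact: hk tt s t.
set kk := \sum_ij k ij.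
have kk0 : 0 <= kk by apply: sumr_ge0 => ij _; case: (hk ij).
set C := Num.sqrt (m * n)%:R * kk.
have C0 : 0 <= C by rewrite mulr_ge0// sqrtr_ge0.
have hA s t : 0 <= s -> s <= t -> t <= T -> enorm (A s t) `^ a <= C `^ a * w s t.
  move=> s0 st tT; have w0 := control_ge0 hw s0 st tT.
  have h1 : enorm (A s t) <= C * w s t `^ a^-1.
    rewrite /C -mulrA; apply: enorm_le; first by rewrite mulr_ge0// powR_ge0.
    move=> i j; apply: (le_trans ((hk (i, j)).2 s t s0 st tT)).
    rewrite ler_wpM2r ?powR_ge0// /kk (bigD1 (i, j))//= lerDl.
    by apply: sumr_ge0 => ij _; case: (hk ij).
  rewrite [w s t in leRHS](_ : _ = (w s t `^ a^-1) `^ a); last first.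
    by rewrite -powRrM mulVf ?powRr1// gt_eqF.
  by rewrite -powRM ?powR_ge0// ler_powR2 ?enorm_ge0// ltW.
apply: (@le_lt_trans _ _ (((C `^ a * w 0 T) `^ a^-1)%:E)); last exact: ltry.
apply: ge_ereal_sup => _ [l pl <-]; rewrite lee_fin; apply: ler_powR2.
- by rewrite invr_ge0 ltW.
- by apply: sumr_ge0 => w' _; exact: powR_ge0.
- have := @riemann_sum_control R `[0, T]%classic w (fun s t => enorm (A s t) `^ a)
    (C `^ a) hw (powR_ge0 _ _) 0 l.
  rewrite (eqP pl.2) => H; apply: le_trans (H _ _ _ _).
  + exact: ler_norm.
  + by rewrite /= in_itv /= lexx.
  + by move=> y; apply: chain_itv; [exact: path_lt_le pl.1|exact/eqP/pl.2].
  + exact: path_lt_le pl.1.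
  + move=> u v uv; have [u0 uv' vT _ _] := steps_itv pl.1 uv.
    rewrite (eqP pl.2) in vT.
    by rewrite ger0_norm ?powR_ge0// hA// ltW.
Qed.

End finite_variation.

Section portfolios.
Context {R : realType} {d : nat}.
Variables (p q r : R) (S : R -> 'cV[R]_d).
Hypotheses (p0 : 0 < p) (q0 : 0 < q) (r0 : 0 < r) (hpqr : 1 / r = 1 / p + 1 / q).

Lemma inv_r : r^-1 = p^-1 + q^-1.
Proof. by move: hpqr; rewrite !div1r. Qed.

Lemma remainderE (F : @cpath R d) s t i : remainder S F s t i ord0 =
  rem S (fun (_ : unit) t => F.1 t i ord0) (fun j _ t => F.2 t i j) tt s t.
Proof.
rewrite /remainder /incr /rem /inc /coord !mxE; congr (_ - _).
by apply: eq_bigr => j _; rewrite !mxE.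
Qed.

Lemma econt_inf T (f : R -> R) : 0 <= T -> econt T f ->
  (forall t, 0 <= t -> t <= T -> 0 < f t) ->
  exists2 k, 0 < k & forall t, 0 <= t -> t <= T -> k <= `|f t|.
Proof.
move=> T0 hf f0; have /within_continuousP hc := hf.
have [x xI hx] := EVT_min T0 hc; move: xI; rewrite in_itv /= => /andP[x0 xT].
exists (f x); first exact: f0.
move=> t t0 tT; rewrite gtr0_norm ?f0//; apply: hx.
by rewrite in_itv /= t0.
Qed.

(** A controlled path in the sense of finite variation norms comes with its own
    control, to be added to that of the rough path. *)
Lemma controlled_ctl T (F : @cpath R d) : 0 <= T -> controlled q r S T F ->
  exists2 w, control_function `[0, T] w & forall w', control_function `[0, T] w' ->
    (forall s t, 0 <= s -> s <= t -> t <= T -> w s t <= w' s t) ->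
    forall i, ctl S T w' p^-1 q^-1 (fun (_ : unit) t => F.1 t i ord0) (fun j _ t => F.2 t i j).
Proof.
move=> T0 [cF cF' vF' vR].
have [w1 hw1 b1] : exists2 w1, control_function `[0, T] w1 & forall s t,
    0 <= s -> s <= t -> t <= T -> enorm (incr F.2 s t) <= w1 s t `^ q^-1.
  exists (variation_control q (incr F.2)); first exact: variation_controlP.
  move=> s t s0 st tT; apply: (variation_control_bound q0 vF' s0 st tT _).
  by rewrite /incr subrr.
have [w2 hw2 b2] : exists2 w2, control_function `[0, T] w2 & forall s t,
    0 <= s -> s <= t -> t <= T -> enorm (remainder S F s t) <= w2 s t `^ r^-1.
  exists (variation_control r (remainder S F)); first exact: variation_controlP.
  move=> s t s0 st tT; apply: (variation_control_bound r0 vR s0 st tT _).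
  by rewrite /remainder /incr !subrr mulmx0 subrr.
exists (fun s t => w1 s t + w2 s t); first exact: controlD.
move=> w' hw' ww' i; split.
- by apply: econt_bd => //; exact: (within_continuous_mxP T F.1).1.
- by move=> j; apply: econt_bd => //; exact: (within_continuous_mxP T F.2).1.
- move=> j; exists 1 => // x s t s0 st tT; rewrite mul1r.
  have e : `|inc (fun _ t => F.2 t i j) x s t| <= enorm (incr F.2 s t).
    by apply: le_trans (enorm_ge _ i j); rewrite /incr !mxE.
  apply: (le_trans e); apply: (le_trans (b1 s t s0 st tT)).
  have a1 := control_ge0 hw1 s0 st tT; have a2 := control_ge0 hw2 s0 st tT.
  apply: ler_powR2 => //; first by rewrite invr_ge0 ltW.
  by apply: le_trans (ww' s t s0 st tT); rewrite lerDl.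
- exists 1 => // -[] s t s0 st tT; rewrite mul1r -remainderE -inv_r.
  apply: (le_trans (enorm_ge _ i ord0)); apply: (le_trans (b2 s t s0 st tT)).
  have a1 := control_ge0 hw1 s0 st tT; have a2 := control_ge0 hw2 s0 st tT.
  apply: ler_powR2 => //; first by rewrite invr_ge0 ltW.
  by apply: le_trans (ww' s t s0 st tT); rewrite lerDr.
Qed.

Lemma ctl_controlled T w (F : @cpath R d) : 0 <= T -> control_function `[0, T] w ->
  (forall i, econt T (fun t => F.1 t i ord0)) ->
  (forall i j, econt T (fun t => F.2 t i j)) ->
  (forall i, ctl S T w p^-1 q^-1 (fun (_ : unit) t => F.1 t i ord0) (fun j _ t => F.2 t i j)) ->
  controlled q r S T F.
Proof.
move=> T0 hw c1 c2 h; split.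
- by apply/within_continuous_mxP => i j; rewrite (ord1 j); exact: c1.
- exact/within_continuous_mxP.
- apply: (pvar_finite q0 T0 hw) => i j; have [_ _ h3 _] := h i.
  by apply: ord_ext (h3 j) => -[] s t _ _ _; rewrite /incr !mxE.
- apply: (pvar_finite r0 T0 hw) => i j; have [_ _ _ h4] := h i.
  rewrite inv_r; apply: ord_ext h4 => -[] s t _ _ _.
  by rewrite (ord1 j) remainderE.
Qed.

End portfolios.

(** * Weights of admissible portfolios *)

Lemma incrE {R : realType} {m n} (A : R -> 'M[R]_(m, n)) s t i j :
  incr A s t i j = A t i j - A s i j.
Proof. by rewrite /incr !mxE. Qed.

Lemma remainder_entry {R : realType} {d} (y : R -> 'cV[R]_d) (F : @cpath R d) s t i :
  remainder y F s t i ord0 = (F.1 t i ord0 - F.1 s i ord0)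
    - \sum_j F.2 s i j * (y t j ord0 - y s j ord0).
Proof.
rewrite /remainder /incr !mxE; congr (_ - _).
by apply: eq_bigr => j _; rewrite !mxE.
Qed.

Section admissible_families.
Context {R : realType} {d : nat} {X : Type}.
Variables (p q r M : R) (S : R -> 'cV[R]_d) (c : R -> R -> R).
Hypotheses (p0 : 0 < p) (q0 : 0 < q) (r0 : 0 < r) (hpq : p <= q).
Hypothesis hpqr : 1 / r = 1 / p + 1 / q.
Hypothesis S0 : forall t i, 0 <= t -> 0 < S t i ord0.
Variables (T : R) (w : R -> R -> R).
Hypotheses (T0 : 0 <= T) (hw : control_function `[0, T] w).
Hypothesis contS : forall i, econt T (fun t => S t i ord0).
Hypothesis ordS : forall i, ord T w p^-1 (inc (coord (X := X) S i)).
Hypothesis hc : control_function `[0, +oo[ c.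
Hypothesis cw : forall s t, 0 <= s -> s <= t -> t <= T -> c s t <= w s t.
Hypothesis d0 : (0 < d)%N.

Local Notation a := (p^-1).
Local Notation b := (q^-1).
Local Notation ctlX := (@ctl R d X S T w a b).

Let b0 : 0 < b. Proof. by rewrite invr_gt0. Qed.
Let ba : b <= a. Proof. by rewrite lef_pV2 ?posrE. Qed.

Let bdS i : bd T (coord (X := X) S i).
Proof. by apply: econt_bd. Qed.

Definition total_cap (t : R) : R := \sum_k S t k ord0.

Lemma total_cap_gt0 t : 0 <= t -> 0 < total_cap t.
Proof.
move=> t0; rewrite /total_cap (bigD1 (Ordinal d0))//= ltr_wpDr ?S0//.
by apply: sumr_ge0 => i _; rewrite ltW ?S0.
Qed.

Lemma market_gt0 t i : 0 <= t -> 0 < market S t i ord0.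
Proof. by move=> t0; rewrite mxE divr_gt0 ?S0//; exact: total_cap_gt0. Qed.

Lemma ctl_total_cap : ctlX (fun _ t => total_cap t) (fun _ _ _ => 1).
Proof.
apply: ctl_ext (ctl_sum (index_enum 'I_d) (fun i => ctl_coord w a b bdS i)) => [x t _ _ //|j x t _ _].
rewrite (bigD1 j)//= eqxx big1 ?addr0// => k kj.
by rewrite (negbTE kj).
Qed.

Lemma ctl_total_capV :
  ctlX (fun _ t => (total_cap t)^-1) (fun _ _ t => - (total_cap t ^+ 2)^-1).
Proof.
have ct : econt T total_cap by exact: econt_sum.
have [k k0 hk] := econt_inf T0 ct (fun t t0 _ => total_cap_gt0 t0).
apply: ctl_ext (ctlV hw b0 ba ordS k0 _ ctl_total_cap) => [x t _ _ //|j x t _ _|x t].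
  by rewrite mulN1r.
exact: hk.
Qed.

Lemma ctl_market k :
  ctlX (fun _ t => market S t k ord0) (fun j _ t => Dmarket S t k j).
Proof.
apply: ctl_ext (ctlM hw b0 ba ordS (ctl_coord w a b bdS k) ctl_total_capV) => [x t _ _|j x t _ _].
  by rewrite mxE.
by rewrite /Dmarket mxE /coord /total_cap; ring.
Qed.

Variable F : X -> @cpath R d.
Hypothesis hF : forall x, admissible q r (market S) M c (F x).

Definition ratio_path (x : X) := Defs.over (market S) (F x).

Let cT s t : 0 <= s -> s <= t -> 0 <= c s t.
Proof. by move=> s0 st; apply: hc.1; rewrite /= ?in_itv /= ?andbT// (le_trans s0). Qed.

Let sup_split (u v : \bar R) : (0 <= u)%E -> (0 <= v)%E -> (u + v <= 1)%E ->
  (u <= 1)%E /\ (v <= 1)%E.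
Proof.
by move=> u0 v0 h; split; apply: le_trans h; [rewrite leeDl|rewrite leeDr].
Qed.

Let adm_bounds x s t : 0 <= s -> s <= t ->
  enorm (incr (ratio_path x).2 s t) <= c s t `^ b /\
  enorm (remainder (market S) (ratio_path x) s t) <= c s t `^ r^-1.
Proof.
move=> s0 st; have [_ [_ _ _ h]] := hF x.
have D00 : (fun s t : R => 0 <= s <= t : Prop) 0 0 by rewrite lexx.
have c00 : 0 <= c 0 0 by rewrite cT.
have [h1 h2] := sup_split (sup_ratio_ge0 _ _ D00 c00) (sup_ratio_ge0 _ _ D00 c00) h.
have Dst : (fun s t : R => 0 <= s <= t : Prop) s t by rewrite s0 st.
split; apply: powR_le_root => //; try exact: enorm_ge0.
- exact: (sup_ratio_le1 h1 Dst (cT s0 st)).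
- exact: (sup_ratio_le1 h2 Dst (cT s0 st)).
Qed.

Let c_le s t e : 0 <= e -> 0 <= s -> s <= t -> t <= T -> c s t `^ e <= w s t `^ e.
Proof. by move=> e0 s0 st tT; rewrite ler_powR2 ?cw ?cT. Qed.

(** The bounds defining the admissible set hold for the quotient by the market
    portfolio, uniformly over the set; the chain rule turns control by the market
    into control by S. *)
Lemma ctl_ratio i : ctlX (fun x t => (ratio_path x).1 t i ord0)
  (fun j x t => \sum_k (ratio_path x).2 t i k * Dmarket S t k j).
Proof.
have ir0 : 0 <= r^-1 by rewrite invr_ge0 ltW.
have h0 x : enorm ((ratio_path x).1 0) + enorm ((ratio_path x).2 0) <= M.
  by have [_ [_ _ h _]] := hF x; exact: h.
have M0 x k : `|(ratio_path x).2 0 i k| <= `|M| /\ `|(ratio_path x).1 0 i ord0| <= `|M|.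
  have := h0 x; have := enorm_ge ((ratio_path x).2 0) i k.
  have := enorm_ge ((ratio_path x).1 0) i ord0; have := ler_norm M.
  have := normr_ge0 ((ratio_path x).2 0 i k); have := normr_ge0 ((ratio_path x).1 0 i ord0).
  by move=> ? ? ? ? ? ?; split; lra.
have o2 k : ord T w b (inc (fun x t => (ratio_path x).2 t i k)).
  exists 1 => // x s t s0 st tT; rewrite mul1r.
  apply: (le_trans _ (c_le (ltW b0) s0 st tT)).
  apply: le_trans (adm_bounds x s0 st).1.
  by apply: le_trans (enorm_ge _ i k); rewrite incrE.
have b2 k : bd T (fun x t => (ratio_path x).2 t i k).
  apply: (ord_inc_bd hw b0 (o2 k)); exists `|M| => // x.
  by case: (M0 x k).
pose rest x s t := inc (fun x t => (ratio_path x).1 t i ord0) x s t -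
  \sum_k (ratio_path x).2 s i k * inc (fun (_ : X) t => market S t k ord0) x s t.
have o1 : ord T w (a + b) rest.
  exists 1 => // x s t s0 st tT; rewrite mul1r -(inv_r hpqr).
  apply: (le_trans _ (c_le ir0 s0 st tT)); apply: le_trans (adm_bounds x s0 st).2.
  by apply: le_trans (enorm_ge _ i ord0); rewrite remainder_entry.
apply: (ctl_chain _ b2 o2 o1 ctl_market).
have ab0 : 0 < a + b by rewrite addr_gt0 ?invr_gt0.
have os k : ord T w a (inc (fun (_ : X) t => market S t k ord0)).
  exact: (ctl_inc hw b0 ba ordS (ctl_market k)).
have a0 : 0 < a by rewrite invr_gt0.
apply: (ord_inc_bd hw a0 (f := fun x t => (ratio_path x).1 t i ord0)).
  have o1' : ord T w a rest by apply: (ord_le hw a0 _ o1); rewrite lerDl ltW.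
  apply: ord_ext (ordD o1' (ord_sum (index_enum 'I_d) (fun k => ord_bdl (b2 k) (os k)))) => x s t _ _ _.
  by rewrite /rest subrK.
by exists `|M| => // x; case: (M0 x i).
Qed.

Definition weight (x : X) := cmul (to_S_controlled S (F x)) (cinv S).

(** pi / S = (pi / mu) / (S^1 + ... + S^d), and the derivatives agree. *)
Lemma ctl_weight i : ctlX (fun x t => (weight x).1 t i ord0) (fun j x t => (weight x).2 t i j).
Proof.
apply: ctl_ext (ctlM hw b0 ba ordS (ctl_ratio i) ctl_total_capV) => [x t t0 tT|j x t t0 tT].
  rewrite /ratio_path overE1 /weight /= !mxE -/(total_cap t).
  by field; rewrite !gt_eqF ?total_cap_gt0 ?S0.
have s0 := total_cap_gt0 t0; have Si := S0 i t0.
have -> : (weight x).2 t i j = (\sum_k (F x).2 t i k * Dmarket S t k j) / S t i ord0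
    - (F x).1 t i ord0 * (S t i ord0) ^- 2 *+ (i == j).
  by rewrite /weight /= !mxE; case: eqP => _; rewrite ?mulr1n ?mulr0n; ring.
have -> : \sum_k (ratio_path x).2 t i k * Dmarket S t k j =
    (\sum_k (F x).2 t i k * Dmarket S t k j) / market S t i ord0
    - (F x).1 t i ord0 * (market S t i ord0) ^- 2 * Dmarket S t i j.
  rewrite mulr_suml (bigD1 i)//= [in RHS](bigD1 i)//= /ratio_path overE2 eqxx mulr1n.
  rewrite (eq_bigr (fun k => (F x).2 t i k * Dmarket S t k j / market S t i ord0)); last first.
    by move=> k ki; rewrite overE2 eq_sym (negbTE ki) mulr0n subr0; ring.
  by ring.
set Q := \sum_k _; rewrite /ratio_path overE1 /Dmarket !mxE -/(total_cap t).
by case: eqP => _; rewrite ?mulr1n ?mulr0n; field; rewrite !gt_eqF.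
Qed.

End admissible_families.

(** * The averaged wealth *)

Section averaged_orders.
Context {R : realType} {d : nat} {K : pmetricType R}.
Hypothesis hK : compact [set: K].
Variable m : probability (g_sigma_algebraType (@open K)) R.
Variables (T : R) (w : R -> R -> R).
Implicit Types (E : K -> R -> R -> R) (f : K -> R -> R).

Local Notation avg := (average m).

Lemma ord_average al E :
  (forall s t, 0 <= s -> s <= t -> t <= T -> continuous (fun x => E x s t)) ->
  ord T w al E -> ord T w al (fun (_ : unit) s t => avg (fun x => E x s t)).
Proof.
move=> cE [k k0 h]; exists k => // _ s t s0 st tT.
by apply: (average_norm hK) => [|x]; [exact: cE|exact: h].
Qed.

Lemma van_average E :
  (forall s t, 0 <= s -> s <= t -> t <= T -> continuous (fun x => E x s t)) ->
  van T E -> van T (fun (_ : unit) s t => avg (fun x => E x s t)).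
Proof.
move=> cE h e /h[dl dl0 {}h]; exists dl => // _ s t s0 st tT l.
by apply: (average_norm hK) => [|x]; [exact: cE|exact: h].
Qed.

Lemma bd_average f : (forall t, 0 <= t -> t <= T -> continuous (f ^~ t)) ->
  bd T f -> bd T (fun (_ : unit) t => avg (f ^~ t)).
Proof.
move=> cf [k k0 h]; exists k => // _ t t0 tT.
by apply: (average_norm hK) => [|x]; [exact: cf|exact: h].
Qed.

(** Averaging preserves controlled paths because the bounds are uniform in the
    index and the remainder is linear. *)
Lemma ctl_average (S : R -> 'cV[R]_d) a b f (df : 'I_d -> K -> R -> R) :
  (forall t, 0 <= t -> t <= T -> continuous (f ^~ t)) ->
  (forall j t, 0 <= t -> t <= T -> continuous (df j ^~ t)) ->
  ctl S T w a b f df ->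
  ctl S T w a b (fun (_ : unit) t => avg (f ^~ t)) (fun j _ t => avg (df j ^~ t)).
Proof.
move=> cf cdf [h1 h2 h3 h4].
have sT s t : s <= t -> t <= T -> s <= T by exact: le_trans.
have t0 (s t : R) : 0 <= s -> s <= t -> 0 <= t by exact: le_trans.
have cinc (g : K -> R -> R) : (forall t, 0 <= t -> t <= T -> continuous (g ^~ t)) ->
    forall s t, 0 <= s -> s <= t -> t <= T -> continuous (fun x => inc g x s t).
  move=> cg s t s0 st tT; rewrite /inc; refine (continuous_add _ _); first by apply: cg => //; exact: t0 st.
  by refine (continuous_opp _); apply: cg => //; exact: sT tT.
have csum s t : 0 <= s -> s <= t -> t <= T ->
    continuous (fun x => \sum_j df j x s * inc (coord (X := unit) S j) tt s t).
  move=> s0 st tT; refine (@continuous_sum R K _ _ _ _) => j; apply: continuous_mul.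
    by apply: cdf => //; exact: sT tT.
  exact: (@cst_continuous K R (inc (coord (X := unit) S j) tt s t)).
split; first exact: bd_average.
- by move=> j; apply: bd_average => //; exact: cdf.
- move=> j; apply: ord_ext (ord_average (cinc _ (cdf j)) (h3 j)) => -[] s t s0 st tT.
  by rewrite /inc averageB//; apply: cdf => //; [exact: t0 st|exact: sT tT].
- have ce s t : 0 <= s -> s <= t -> t <= T -> continuous (fun x => rem S f df x s t).
    move=> s0 st tT; rewrite /rem; refine (continuous_add _ _); first exact: cinc.
    by refine (continuous_opp _); exact: csum.
  apply: ord_ext (ord_average ce h4) => -[] s t s0 st tT.
  rewrite /rem averageB; [|exact: hK|exact: cinc|exact: csum].
  rewrite {1}/inc averageB; [|exact: hK|by apply: cf => //; exact: t0 st|by apply: cf => //; exact: sT tT].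
  congr (_ - _); rewrite average_sum; [|exact: hK|]; last first.
    move=> j; refine (continuous_mul _ _); last exact: (@cst_continuous K R (inc (coord (X := unit) S j) tt s t)).
    by apply: cdf => //; exact: sT tT.
  apply: eq_bigr => j _; rewrite mulrC -averageZ; [|exact: hK|by apply: cdf => //; exact: sT tT].
  by apply: average_eq => x; rewrite mulrC.
Qed.

End averaged_orders.

Lemma van_econt {R : realType} {X : Type} (T : R) (f : X -> R -> R) : van T (inc f) ->
  forall x, econt T (f x).
Proof.
move=> h x t e t0 tT e0; have e20 : 0 < e / 2 by rewrite divr_gt0.
have [dl dl0 {}h] := h _ e20; exists dl => // s s0 sT st.
have le2 : e / 2 < e by rewrite gtr_pMr// invf_lt1// ltr1n.
have [ts|ts] := leP t s.
  apply: le_lt_trans le2; apply: h => //.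
  by apply: le_lt_trans st; exact: ler_norm.
rewrite distrC; apply: le_lt_trans le2; apply: h => //; first exact: ltW.
by apply: le_lt_trans st; rewrite distrC; exact: ler_norm.
Qed.

Section mixed_wealth.
Context {R : realType} {d : nat} {K : pmetricType R}.
Hypothesis hK : compact [set: K].
Variable m : probability (g_sigma_algebraType (@open K)) R.
Variables (p : R) (S : R -> 'cV[R]_d) (P : nat -> nat -> R).
Hypotheses (hS : price_path_along p S P).
Variables (G : 'I_d -> K -> R -> R) (G' : 'I_d -> 'I_d -> K -> R -> R).

Local Notation avg := (average m).
Local Notation L := (log_wealth S P G G').

Definition wealth_of (x : K) (t : R) : R := expR (L x t).

Definition mix_wealth (t : R) : R := avg (wealth_of ^~ t).

(** The weight pi / S of the wealth-weighted average of the portfolios. *)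
Definition mix_weight (i : 'I_d) (t : R) : R :=
  avg (fun x => G i x t * wealth_of x t) / mix_wealth t.

(** The derivative of the quotient E(W G) / E(W), given W' = W G. *)
Definition mix_weight' (i j : 'I_d) (t : R) : R :=
  avg (fun x => wealth_of x t * (G' i j x t + G i x t * G j x t)) / mix_wealth t
  - mix_weight i t * mix_weight j t.

Variables (T b : R) (w : R -> R -> R).
Hypotheses (T0 : 0 < T) (hlift : lift_control p S P T w).
Hypotheses (b0 : 0 < b) (ba : b <= p^-1) (th1 : 1 < p^-1 + p^-1 + b).
Hypothesis hG : forall i, ctl S T w p^-1 b (G i) (G' i).
Hypothesis cG : forall i t, 0 <= t -> t <= T -> continuous (G i ^~ t).
Hypothesis cG' : forall i j t, 0 <= t -> t <= T -> continuous (G' i j ^~ t).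
Hypothesis cW : forall t, 0 <= t -> t <= T -> continuous (wealth_of ^~ t).
Hypothesis tG : forall i x, econt T (G i x).
Hypothesis tG' : forall i j x, econt T (G' i j x).

Local Notation a := (p^-1).

Let hw : control_function `[0, T] w. Proof. by case: hlift. Qed.
Let T0' : 0 <= T. Proof. exact: ltW. Qed.
Let a0 : 0 < a. Proof. exact: lt_le_trans ba. Qed.

Let ordS (X : Type) i : ord T w a (inc (coord (X := X) S i)).
Proof. exact: ord_coord hlift i. Qed.

Let hWc : ctl S T w a b wealth_of (fun j x t => wealth_of x t * G j x t).
Proof. exact: (ctl_wealth hS T0 hlift b0 ba th1 hG). Qed.

Let hGW i : ctl S T w a b (fun x t => G i x t * wealth_of x t)
  (fun j x t => G' i j x t * wealth_of x t + G i x t * (wealth_of x t * G j x t)).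
Proof. exact: (ctlM hw b0 ba (ordS _) (hG i) hWc). Qed.

Let mid s t : 0 <= s -> s <= t -> t <= T -> 0 <= t /\ s <= T.
Proof. by move=> s0 st tT; split; [exact: le_trans st|exact: le_trans tT]. Qed.

Let cWG i t : 0 <= t -> t <= T -> continuous (fun x => wealth_of x t * G i x t).
Proof. by move=> t0 tT; refine (continuous_mul _ _); [exact: cW|exact: cG]. Qed.

Let cGW i t : 0 <= t -> t <= T -> continuous (fun x => G i x t * wealth_of x t).
Proof. by move=> t0 tT; refine (continuous_mul _ _); [exact: cG|exact: cW]. Qed.

Let cGG i j t : 0 <= t -> t <= T -> continuous (fun x => G' i j x t + G i x t * G j x t).
Proof.
move=> t0 tT; refine (continuous_add _ _); first exact: cG'.
by refine (continuous_mul _ _); exact: cG.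
Qed.

Let cWGG i j t : 0 <= t -> t <= T ->
  continuous (fun x => wealth_of x t * (G' i j x t + G i x t * G j x t)).
Proof. by move=> t0 tT; refine (continuous_mul _ _); [exact: cW|exact: cGG]. Qed.

Let ctl_mix_wealth : ctl S T w a b (fun (_ : unit) t => mix_wealth t)
  (fun j _ t => avg (fun x => wealth_of x t * G j x t)).
Proof. by apply: (ctl_average hK m cW _ hWc) => j t; exact: cWG. Qed.

Let ctl_mix_num i : ctl S T w a b (fun (_ : unit) t => avg (fun x => G i x t * wealth_of x t))
  (fun j _ t => avg (fun x => wealth_of x t * (G' i j x t + G i x t * G j x t))).
Proof.
have e j x t : G' i j x t * wealth_of x t + G i x t * (wealth_of x t * G j x t) =
    wealth_of x t * (G' i j x t + G i x t * G j x t) by ring.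
apply: (ctl_average hK m (f := fun x t => G i x t * wealth_of x t)
  (df := fun j x t => wealth_of x t * (G' i j x t + G i x t * G j x t))) => [t|j t|].
- exact: cGW.
- exact: cWGG.
- by apply: ctl_ext (hGW i) => //= j x t _ _; exact: e.
Qed.

(** The log-wealths are bounded uniformly in the index. *)
Lemma mix_wealth_bound : exists2 k, 0 < k & forall t, 0 <= t -> t <= T -> k <= mix_wealth t.
Proof.
have [k k0 hk] := bd_log_wealth hS T0 hlift b0 ba th1 hG.
exists (expR (- k)); first exact: expR_gt0.
move=> t t0 tT; rewrite -[leLHS](average_cst m); apply: (average_le hK).
- exact: cst_continuous.
- exact: cW.
- move=> x; rewrite /wealth_of ler_expR.
  by have := hk x t t0 tT; rewrite ler_norml => /andP[].
Qed.

Let Z0 t : 0 <= t -> t <= T -> mix_wealth t != 0.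
Proof.
move=> t0 tT; have [k k0 hk] := mix_wealth_bound.
by rewrite gt_eqF// (lt_le_trans k0)// hk.
Qed.

Lemma ctl_mix_weight i : ctl S T w a b (fun (_ : unit) t => mix_weight i t)
  (fun j _ t => mix_weight' i j t).
Proof.
have [k k0 hk] := mix_wealth_bound.
have hk' (x : unit) t : 0 <= t -> t <= T -> k <= `|mix_wealth t|.
  by move=> t0 tT; apply: le_trans (hk t t0 tT) (ler_norm _).
have hV := ctlV hw b0 ba (ordS _) k0 hk' ctl_mix_wealth.
apply: ctl_ext (ctlM hw b0 ba (ordS _) (ctl_mix_num i) hV) => [x t _ _ //|j x t t0 tT].
have -> : avg (fun x => wealth_of x t * G j x t) = mix_weight j t * mix_wealth t.
  rewrite /mix_weight divfK ?Z0//; apply: average_eq => y.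
  by rewrite mulrC.
rewrite /mix_weight'; have := Z0 t0 tT => zt.
rewrite /mix_weight; set N1 := avg _; set N2 := avg _; set N3 := avg _.
by field.
Qed.

Let tW x : econt T (wealth_of x).
Proof.
apply: econt_comp => [t t0 tT|]; first exact: continuous_expR.
exact: (van_econt (van_log_wealth hS T0 hlift b0 ba th1 hG)).
Qed.

Let bW : bd T wealth_of. Proof. by case: hWc. Qed.
Let bG i : bd T (G i). Proof. by case: (hG i). Qed.
Let bG' i j : bd T (G' i j). Proof. by case: (hG i). Qed.

Let econt_Z : econt T mix_wealth.
Proof. by apply: (econt_average hK m bW). Qed.

Lemma econt_mix_weight i : econt T (mix_weight i).
Proof.
apply: econtM; last by apply: econtV => //; exact: Z0.
apply: (econt_average hK m (f := fun x t => G i x t * wealth_of x t)).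
- exact: bdM.
- by move=> t; exact: cGW.
- by move=> x; apply: econtM.
Qed.

Lemma econt_mix_weight' i j : econt T (mix_weight' i j).
Proof.
apply: econtB; last by apply: econtM; exact: econt_mix_weight.
apply: econtM; last by apply: econtV => //; exact: Z0.
apply: (econt_average hK m (f := fun x t => wealth_of x t * (G' i j x t + G i x t * G j x t))).
- by apply: bdM => //; apply: bdD => //; exact: bdM.
- by move=> t; exact: cWGG.
- by move=> x; apply: econtM => //; apply: econtD => //; exact: econtM.
Qed.

Let H (i : 'I_d) (_ : K) (t : R) := mix_weight i t.
Let H' (i j : 'I_d) (_ : K) (t : R) := mix_weight' i j t.
Let LH := log_wealth S P (fun i (_ : unit) => mix_weight i) (fun i j _ => mix_weight' i j) tt.

Let hH i : ctl S T w a b (H i) (H' i).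
Proof.
have [[k1 k10 h1] h2 h3 [k4 k40 h4]] := ctl_mix_weight i; split.
- by exists k1 => // x t; exact: h1 tt t.
- by move=> j; have [k k0 h] := h2 j; exists k => // x t; exact: h tt t.
- by move=> j; have [k k0 h] := h3 j; exists k => // x s t; exact: h tt s t.
- by exists k4 => // x s t; exact: h4 tt s t.
Qed.

Let rr := ratio_rem S P G H G' H'.
Let linH s t := \sum_i mix_weight i s * inc (coord (X := unit) S i) tt s t.

(* The first and second order coefficients of W_x (exp(L_x - L_nu) - 1): both
   have average 0 by the choice of mix_weight and mix_weight'. *)
Let delta s i x := wealth_of x s * G i x s - mix_weight i s * wealth_of x s.
Let gam s i j x := wealth_of x s * (G' i j x s + G i x s * G j x s)
  - (mix_weight' i j s + mix_weight i s * mix_weight j s) * wealth_of x s.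

Let cdelta s i : 0 <= s -> s <= T -> continuous (delta s i).
Proof.
move=> s0 sT; refine (continuous_add _ _); first exact: cWG.
refine (continuous_opp _); refine (continuous_mul _ _); first exact: cst_continuous.
exact: cW.
Qed.

Let cgam s i j : 0 <= s -> s <= T -> continuous (gam s i j).
Proof.
move=> s0 sT; refine (continuous_add _ _); first exact: cWGG.
refine (continuous_opp _); refine (continuous_mul _ _); first exact: cst_continuous.
exact: cW.
Qed.

Let avg_centred (u : K -> R) k s : 0 <= s -> s <= T -> continuous u ->
  avg u = k * mix_wealth s -> avg (fun x => u x - k * wealth_of x s) = 0.
Proof.
move=> s0 sT cu hu; rewrite averageB//; last first.
  by refine (continuous_mul _ _); [exact: cst_continuous|exact: cW].
by rewrite averageZ ?hu ?subrr//; exact: cW.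
Qed.

Let avg_delta s i : 0 <= s -> s <= T -> avg (delta s i) = 0.
Proof.
move=> s0 sT; apply: avg_centred => //; first exact: cWG.
rewrite /mix_weight divfK ?Z0//; apply: average_eq => x.
by rewrite mulrC.
Qed.

Let avg_gam s i j : 0 <= s -> s <= T -> avg (gam s i j) = 0.
Proof.
move=> s0 sT; apply: avg_centred => //; first exact: cWGG.
by rewrite /mix_weight' subrK divfK ?Z0.
Qed.

Let main s t x :=
  \sum_i (inc (coord (X := unit) S i) tt s t * (1 - linH s t)) * delta s i x
  + \sum_i \sum_j area S P j i tt s t * gam s i j x.

Let cmain s t : 0 <= s -> s <= T -> continuous (main s t).
Proof.
move=> s0 sT; refine (continuous_add _ _).
  refine (@continuous_sum R K _ _ _ _) => i.
  by refine (continuous_mul _ _); [exact: cst_continuous|exact: cdelta].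
refine (@continuous_sum R K _ _ _ _) => i; refine (@continuous_sum R K _ _ _ _) => j.
by refine (continuous_mul _ _); [exact: cst_continuous|exact: cgam].
Qed.

Let avg_main s t : 0 <= s -> s <= T -> avg (main s t) = 0.
Proof.
move=> s0 sT.
have c1 k i : continuous (fun x => k * delta s i x).
  by refine (continuous_mul _ _); [exact: cst_continuous|exact: cdelta].
have c2 k i j : continuous (fun x => k * gam s i j x).
  by refine (continuous_mul _ _); [exact: cst_continuous|exact: cgam].
rewrite averageD//; last 2 first.
- by refine (@continuous_sum R K _ _ _ _) => i.
- refine (@continuous_sum R K _ _ _ _) => i; refine (@continuous_sum R K _ _ _ _) => j.
  exact: c2.
rewrite average_sum// big1 ?add0r => [|i _]; last first.
  by rewrite averageZ ?avg_delta ?mulr0//; exact: cdelta.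
rewrite average_sum// => [|i]; last first.
  by refine (@continuous_sum R K _ _ _ _) => j; exact: c2.
rewrite big1// => i _; rewrite average_sum// big1// => j _.
by rewrite averageZ ?avg_gam ?mulr0//; exact: cgam.
Qed.

Let mainE s t x : wealth_of x s * rr x s t =
  wealth_of x s * expR (inc L x s t - (LH t - LH s)) - wealth_of x s - main s t x.
Proof.
have linHE : lin S H x s t = linH s t by [].
have e1 : wealth_of x s * (lin S G x s t - linH s t) =
    \sum_i inc (coord (X := unit) S i) tt s t * delta s i x.
  rewrite /lin /linH -sumrB mulr_sumr; apply: eq_bigr => i _.
  by rewrite /delta /inc /coord; ring.
have e2 : wealth_of x s * (quad S P G G' x s t - quad S P H H' x s t) =
    \sum_i \sum_j area S P j i tt s t * gam s i j x.
  rewrite /quad -sumrB mulr_sumr; apply: eq_bigr => i _.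
  rewrite -sumrB mulr_sumr; apply: eq_bigr => j _.
  by rewrite /gam /H /H' /area; ring.
have -> : main s t x = wealth_of x s * (lin S G x s t - linH s t) * (1 - linH s t)
    + wealth_of x s * (quad S P G G' x s t - quad S P H H' x s t).
  rewrite e1 e2 /main; congr (_ + _); rewrite mulr_suml; apply: eq_bigr => i _.
  by rewrite mulrAC.
rewrite /rr /ratio_rem linHE.
have -> : inc (log_wealth S P H H') x s t = LH t - LH s by [].
by set E := expR _; ring.
Qed.

Let shiftE s t x : wealth_of x s * expR (inc L x s t - (LH t - LH s)) =
  expR (LH s - LH t) * wealth_of x t.
Proof.
by rewrite /wealth_of -!expRD; congr expR; rewrite /inc; ring.
Qed.

Let crr s t : 0 <= s -> s <= t -> t <= T -> continuous (fun x => wealth_of x s * rr x s t).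
Proof.
move=> s0 st tT; have [t0 sT] := mid s0 st tT.
have -> : (fun x => wealth_of x s * rr x s t) =
    (fun x => expR (LH s - LH t) * wealth_of x t - wealth_of x s - main s t x).
  by apply/funext => x; rewrite mainE shiftE.
refine (continuous_add _ _); last by refine (continuous_opp _); exact: cmain.
refine (continuous_add _ _); last by refine (continuous_opp _); exact: cW.
by refine (continuous_mul _ _); [exact: cst_continuous|exact: cW].
Qed.

(** W^nu = E(W): the family exp(L_x - L_nu) is averaged against m.  With
    E(W_x G_x) = E(W_x) G_nu and the choice of the derivative of G_nu, the first
    and second order terms of the increment average to 0; what is left has order
    above 1 and is small near the diagonal, so that the average is constant. *)
Lemma mix_wealthE : mix_wealth T = expR (LH T).
Proof.
pose Y (_ : unit) t := mix_wealth t * expR (- LH t).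
have incY s t : 0 <= s -> s <= t -> t <= T ->
    inc Y tt s t = expR (- LH s) * avg (fun x => wealth_of x s * rr x s t).
  move=> s0 st tT; have [t0 sT] := mid s0 st tT.
  have -> : avg (fun x => wealth_of x s * rr x s t) =
      expR (LH s - LH t) * mix_wealth t - mix_wealth s.
    rewrite (average_eq m (g := fun x =>
      (expR (LH s - LH t) * wealth_of x t - wealth_of x s) - main s t x)); last first.
      by move=> x; rewrite mainE shiftE.
    have c1 : continuous (fun x => expR (LH s - LH t) * wealth_of x t).
      by refine (continuous_mul _ _); [exact: cst_continuous|exact: cW].
    rewrite averageB//; last 2 first.
    - by refine (continuous_add _ _) => //; refine (continuous_opp _); exact: cW.
    - exact: cmain.
    by rewrite avg_main// subr0 averageB ?averageZ//; exact: cW.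
  have e1 : expR (- LH s) * expR (LH s) = 1 by rewrite -expRD addNr expR0.
  rewrite (expRD (LH s) (- LH t)) /inc /Y; move: e1.
  move: (expR (- LH s)) (expR (LH s)) (expR (- LH t)) (mix_wealth s) (mix_wealth t).
  by move=> u v z x y uv; rewrite mulrBr !mulrA uv mul1r; ring.
have bE : bd T (fun (_ : unit) t => expR (- LH t)).
  apply: bd_expR; apply: bdN.
  exact: (bd_log_wealth hS T0 hlift b0 ba th1 ctl_mix_weight).
have oY : ord T w (p^-1 + p^-1 + b) (inc Y).
  apply: ord_ext (ord_bdl bE (ord_average hK m crr
    (ord_bdl bW (ord_ratio_rem hS T0 hlift b0 ba th1 hG hH)))) => -[] s t s0 st tT.
  by rewrite incY.
have vY : van T (inc Y).
  apply: van_ext (van_bdl bE (van_average hK m crr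
    (van_bdl bW (van_ratio_rem hS T0 hlift b0 ba th1 hG hH)))) => -[] s t s0 st tT.
  by rewrite incY.
have LH0 : LH 0 = 0 by exact: log_wealth0.
have Z1 : mix_wealth 0 = 1.
  rewrite /mix_wealth -[RHS](average_cst m 1); apply: average_eq => x.
  by rewrite /wealth_of log_wealth0 expR0.
have h : mix_wealth T * expR (- LH T) = mix_wealth 0 * expR (- LH 0).
  exact: (inc_negligible hw th1 oY vY tt T0' (lexx T)).
move: h; rewrite LH0 Z1 oppr0 expR0 mulr1 (expRN (LH T)).
have := expR_gt0 (LH T); move: (mix_wealth T) (expR (LH T)) => y z z0 h.
by rewrite -[LHS](divfK (lt0r_neq0 z0)) h mul1r.
Qed.

End mixed_wealth.

(** * Wealth processes *)

Section wealth_as_log_wealth.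
Context {R : realType} {d : nat}.
Variables (S : R -> 'cV[R]_d) (P : nat -> nat -> R).

Lemma mesh_lim_ext (g h : R -> R -> R) T :
  (forall s t, 0 <= s -> s <= t -> t <= T -> g s t = h s t) ->
  mesh_lim g T = mesh_lim h T.
Proof.
move=> gh.
have e : \forall l \near mesh_to_0 0 T, riemann_sum g 0 l = riemann_sum h 0 l.
  exists 1; first by rewrite /= ltr01.
  move=> l [pl _]; apply: eq_big_seq => -[u v] uv.
  have [h1 h2 h3 _ _] := steps_itv pl.1 uv.
  by apply: gh => //; [exact: ltW|rewrite -(eqP pl.2)].
have FF : Filter (mesh_to_0 0 T).
  apply: filter_from_filter; first by exists 1; rewrite /= ltr01.
  move=> e1 e2 h1 h2; exists (Num.min e1 e2); first by rewrite /= lt_min h1 h2.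
  by move=> l /= [pl]; rewrite lt_min => /andP[].
rewrite /mesh_lim; congr (lim _); apply/seteqP; split.
  by apply: near_eq_cvg; apply: filterS e => l /esym.
by apply: near_eq_cvg; apply: filterS e.
Qed.

Lemma log_wealth_ext {X : Type} (G H : 'I_d -> X -> R -> R)
    (G' H' : 'I_d -> 'I_d -> X -> R -> R) x T :
  (forall i t, 0 <= t -> t <= T -> G i x t = H i x t) ->
  (forall i j t, 0 <= t -> t <= T -> G' i j x t = H' i j x t) ->
  log_wealth S P G G' x T = log_wealth S P H H' x T.
Proof.
move=> gh gh'; rewrite /log_wealth; congr (_ - _ * _).
  apply: mesh_lim_ext => s t s0 st tT; have sT := le_trans st tT; rewrite /rough_germ.
  congr (_ + _); first by apply: eq_bigr => i _; rewrite gh.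
  by apply: eq_bigr => i _; apply: eq_bigr => j _; rewrite gh'.
apply: eq_bigr => i _; apply: eq_bigr => j _.
apply: mesh_lim_ext => s t s0 st tT; have sT := le_trans st tT.
by rewrite /bracket_germ !gh.
Qed.

Lemma wealthE {X : Type} (F : X -> @cpath R d) x t : wealth S P (F x) t =
  expR (log_wealth S P (fun i x t => (cmul (F x) (cinv S)).1 t i ord0)
    (fun i j x t => (cmul (F x) (cinv S)).2 t i j) x t).
Proof.
set G := fun i x t => (cmul (F x) (cinv S)).1 t i ord0.
set G' := fun i j x t => (cmul (F x) (cinv S)).2 t i j.
have e1 : rough_integral S P (cmul (F x) (cinv S)) t = mesh_lim (rough_germ S P G G' x) t.
  rewrite /rough_integral; congr (mesh_lim _ t); apply/funext => u; apply/funext => v.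
  rewrite /rough_germ; congr (_ + _); apply: eq_bigr => i _.
  by rewrite incrE.
have e2 i j : stieltjes (fun s => (F x).1 s i ord0 * (F x).1 s j ord0 / (S s i ord0 * S s j ord0))
    (fun s => bracket S P s i j) t = mesh_lim (bracket_germ S P G i j x) t.
  rewrite /stieltjes; congr (mesh_lim _ t); apply/funext => u; apply/funext => v.
  rewrite /bracket_germ; congr (_ * _).
  by rewrite /G /cmul /= !mxE invfM; ring.
rewrite /wealth e1 /log_wealth.
under eq_bigr do under eq_bigr do rewrite e2.
by [].
Qed.

End wealth_as_log_wealth.

(** * Laplace's method on a compact metric space *)

Section ball_masses.
Context {R : realType} {K : pmetricType R}.
Hypothesis hK : compact [set: K].
Variable m : probability (g_sigma_algebraType (@open K)) R.
Hypothesis hm : forall U : set K, open U -> U !=set0 -> (0 < m U)%E.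

Lemma near_mdist (x : K) (P : set K) : (\forall y \near x, P y) <->
  exists2 e : R, 0 < e & forall y, mdist x y < e -> P y.
Proof.
split.
  move=> /nbhs_ballP[e /= e0 h]; exists e => // y xy.
  by apply: h; rewrite ballEmdist.
move=> [e e0 h]; apply/nbhs_ballP; exists e => //= y.
by rewrite ballEmdist; exact: h.
Qed.

Lemma lipschitz_continuous (f : K -> R) k :
  (forall x y, `|f x - f y| <= k * mdist x y) -> continuous f.
Proof.
move=> h x; apply/cvgrPdist_lt => e e0; apply/near_mdist.
have k10 : 0 < `|k| + 1 by rewrite ltr_wpDl.
exists (e / (`|k| + 1)); first by rewrite divr_gt0.
move=> y xy; apply: (le_lt_trans (h x y)).
apply: (@le_lt_trans _ _ (`|k| * mdist x y)).
  by rewrite ler_wpM2r ?mdist_ge0// ler_norm.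
apply: (@le_lt_trans _ _ ((`|k| + 1) * mdist x y)).
  by rewrite ler_wpM2r ?mdist_ge0// lerDl.
by rewrite mulrC -ltr_pdivlMr.
Qed.

(** Compactness makes the mass of balls of a given radius bounded below. *)
Lemma ball_mass eta : 0 < eta -> exists2 k, 0 < k & forall x, exists2 U : set K,
  open U /\ U `<=` [set y | mdist x y < eta] & (k%:E <= m U)%E.
Proof.
move=> eta0; have eta20 : 0 < eta / 2 by rewrite divr_gt0.
have := (compact_near_coveringP _).1 hK R (0 : R)^'+
  (fun k x => exists2 U : set K,
    open U /\ U `<=` [set y | mdist x y < eta] & (k%:E <= m U)%E).
case.
  move=> x _.
  have nx : \forall y \near x, mdist x y < eta / 2 by apply/near_mdist; exists (eta / 2).
  pose U : set K := interior [set y | mdist x y < eta / 2].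
  have oU : open U by exact: open_interior.
  have Ux : U x by exact: nx.
  have mU : (0 < m U)%E by apply: hm => //; exists x.
  have mUf : m U \is a fin_num by rewrite fin_num_measure//; exact: sub_sigma_algebra.
  have fU : 0 < fine (m U) by rewrite -lte_fin fineK.
  exists ([set y | mdist x y < eta / 2], [set k | k < fine (m U)]); first split => //=.
    exact: nbhs_right_lt.
  move=> [x' k] /= [xx' kU]; exists U; last by rewrite -(fineK mUf) lee_fin ltW.
  split => // y /interior_subset /= xy.
  by rewrite (le_lt_trans (metric_triangle x' x y))// [ltRHS]splitr metric_sym ltrD// metric_sym.
move=> k /= k0 h; have k20 : 0 < k / 2 by rewrite divr_gt0.
exists (k / 2) => // x; apply: (h (k / 2)) => //.
by rewrite /ball_ /= sub0r normrN gtr0_norm// gtr_pMr// invf_lt1// ltr1n.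
Qed.

(** Markov's inequality on U. *)
Lemma average_ge_mass (f : K -> R) (U : set K) k l : continuous f -> (forall x, 0 <= f x) ->
  open U -> 0 <= l -> (forall x, U x -> l <= f x) -> (k%:E <= m U)%E -> l * k <= average m f.
Proof.
move=> cf f0 oU l0 hl kU.
have mU : measurable (U : set (g_sigma_algebraType (@open K))) by exact: sub_sigma_algebra.
have mf : measurable_fun [set: g_sigma_algebraType (@open K)] (EFin \o f).
  by apply/measurable_EFinP; exact: measurable_continuous.
have fi := integrable_fin_num measurableT (integrable_continuous hK m cf).
rewrite -lee_fin /average fineK//.
apply: (@le_trans _ _ (\int[m]_(x in U) (l%:E))%E).
  by rewrite integral_cst//= EFinM lee_wpmul2l ?lee_fin.
apply: (@le_trans _ _ (\int[m]_(x in U) (f x)%:E)%E).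
  apply: ge0_le_integral => //.
  exact: measurable_funTS.
apply: ge0_subset_integral => //.
by move=> x _; rewrite lee_fin.
Qed.

(** Laplace's method: a function with log-Lipschitz constant k is within
    exp(- k eta) of its maximum on a ball of radius eta, whose mass is bounded
    below. *)
Lemma log_sup_average eta : 0 < eta -> exists k0 : R, forall (f : K -> R) k,
  continuous f -> (forall x, 0 < f x) -> 0 <= k ->
  (forall x y, `|ln (f x) - ln (f y)| <= k * mdist x y) ->
  0 <= ln (sup [set f x | x in [set: K]]) - ln (average m f) <= k * eta + k0.
Proof.
move=> eta0; have [kap kap0 hkap] := ball_mass eta0.
exists (- ln kap) => f k cf f0 k0 hf.
have cw : {within [set: K], continuous f} by exact: continuous_subspaceT.
have [|z _ hz] := compact_EVT_max _ hK cw; first by exists point.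
have {}hz x : f x <= f z by apply: hz; rewrite inE.
have -> : sup [set f x | x in [set: K]] = f z.
  apply/eqP; rewrite eq_le; apply/andP; split.
    apply: ge_sup; first by exists (f z), z.
    by move=> _ [x _ <-].
  apply: ub_le_sup; last by exists z.
  by exists (f z) => _ [x _ <-].
have [U [oU hU] kU] := hkap z.
have lo : f z * expR (- (k * eta)) * kap <= average m f.
  apply: (average_ge_mass (U := U)) => //.
  - by move=> x; exact: ltW.
  - by rewrite mulr_ge0 ?expR_ge0// ltW.
  - move=> x Ux; rewrite -[f z](lnK (f0 z)) -[f x in leRHS](lnK (f0 x)) -expRD ler_expR.
    have := hf z x; rewrite ler_norml => /andP[_].
    have : k * mdist z x <= k * eta by rewrite ler_wpM2l// ltW// hU.
    by lra.
have lo0 : 0 < f z * expR (- (k * eta)) * kap by rewrite !mulr_gt0 ?expR_gt0.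
have up : average m f <= f z.
  by rewrite -[leRHS](average_cst m); apply: (average_le hK) => //; exact: cst_continuous.
have av0 := lt_le_trans lo0 lo.
apply/andP; split; first by rewrite subr_ge0 ler_ln ?posrE.
move: lo; rewrite -ler_ln ?posrE//.
rewrite lnM ?posrE ?mulr_gt0 ?expR_gt0// lnM ?posrE ?expR_gt0// expRK.
by lra.
Qed.

End ball_masses.

(** * The universal portfolio *)

Section universal_portfolio.
Context {R : realType} {d : nat} {K : pmetricType R}.
Variables (p q r q' r' M : R) (S : R -> 'cV[R]_d) (P : nat -> nat -> R).
Variables (c : R -> R -> R) (beta : nat -> R) (iota : K -> @cpath R d).
Hypotheses (p2 : 2 < p) (hpq : p <= q) (hr : 1 < r) (hpq1 : 1 < 2 / p + 1 / q).
Hypotheses (hrpq : 1 / r = 1 / p + 1 / q) (hqq' : q < q') (hrr' : r < r').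
Hypothesis hS : price_path_along p S P.
Hypothesis hc : control_function `[0, +oo[ c.
Hypothesis hM : 0 < M.
Hypothesis hbeta : forall N, (0 < N)%N -> 0 < beta N.
Hypothesis hK : compact [set: K].
Variable m : probability (g_sigma_algebraType (@open K)) R.

Let A := admissible q r (market S) M c.
Let dist := dbeta beta q r q' r' (market S) M c.
Let V (x : K) := relative_wealth S P (to_S_controlled S (iota x)).

Hypothesis hiotaA : forall x, A (iota x).
Hypothesis hiota_inj : injective iota.
Hypothesis hiota_cont : forall x (e : R), 0 < e ->
  \forall y \near x, (dist (iota x) (iota y) < e%:E)%E.
Hypothesis hLip : forall T, 0 < T -> exists k, forall x y,
  `|ln (V x T) - ln (V y T)| <= k * mdist x y.

Let nu : set (borel_in A dist) -> \bar R :=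
  pushforward m (iota : g_sigma_algebraType (@open K) -> borel_in A dist).
Let pinu := universal_portfolio S P nu.

Let p0 : 0 < p. Proof. exact: lt_trans p2. Qed.
Let q0 : 0 < q. Proof. exact: lt_le_trans hpq. Qed.
Let r0 : 0 < r. Proof. exact: lt_trans hr. Qed.
Let b0 : 0 < q^-1. Proof. by rewrite invr_gt0. Qed.
Let ba : q^-1 <= p^-1. Proof. by rewrite lef_pV2 ?posrE. Qed.
Let th1 : 1 < p^-1 + p^-1 + q^-1.
Proof. by move: hpq1; rewrite mulr2n mulrDl !div1r. Qed.

Let d0 : (0 < d)%N.
Proof.
case: (posnP d) => [d0|//]; have [_ [_ h _ _]] := hiotaA point.
have := h 0 (lexx 0); rewrite /in_simplex big1 => [/eqP|i _].
  by rewrite eq_sym oner_eq0.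
by move: (leq_ltn_trans (leq0n i) (ltn_ord i)); rewrite {1}d0.
Qed.

Let S0 t i : 0 <= t -> 0 < S t i ord0.
Proof. by have [_ h _ _] := hS; exact: h. Qed.

Let mu0 t i : 0 <= t -> 0 < market S t i ord0.
Proof. exact: market_gt0. Qed.

Let cont_eval j : continuous (evaluation j \o iota).
Proof.
apply: (continuous_functional hiota_cont) => k.
by apply: (evaluation_lip q r c _ _ hM hbeta mu0); [exact: lt_trans hqq'|exact: lt_trans hrr'].
Qed.

Let c1 t i : 0 <= t -> continuous (fun x => (iota x).1 t i ord0).
Proof. by move=> t0; have := @cont_eval (t, inl i); rewrite /evaluation /= max_r. Qed.

Let c2 t i j : 0 <= t -> continuous (fun x => (iota x).2 t i j).
Proof. by move=> t0; have := @cont_eval (t, inr (i, j)); rewrite /evaluation /= max_r. Qed.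

Let G (i : 'I_d) (x : K) t := (weight S iota x).1 t i ord0.
Let G' (i j : 'I_d) (x : K) t := (weight S iota x).2 t i j.

Let GE i x t : G i x t = (iota x).1 t i ord0 * (S t i ord0)^-1.
Proof. by rewrite /G /weight /= !mxE. Qed.

Let G'E i j x t : G' i j x t =
  (\sum_k (iota x).2 t i k * Dmarket S t k j) * (S t i ord0)^-1
  + (iota x).1 t i ord0 * (- (S t i ord0) ^- 2 *+ (i == j)).
Proof. by rewrite /G' /weight /= !mxE. Qed.

Let WE x t : wealth S P (to_S_controlled S (iota x)) t = wealth_of S P G G' x t.
Proof. exact: (wealthE S P (fun x => to_S_controlled S (iota x))). Qed.

Let Wmu t := wealth S P (market S, Dmarket S) t.
Let Wmu0 t : 0 < Wmu t. Proof. exact: expR_gt0. Qed.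

Let VE x t : V x t = wealth_of S P G G' x t / Wmu t.
Proof. by rewrite /V /relative_wealth WE. Qed.

Let V0 x t : 0 < V x t.
Proof. by rewrite VE divr_gt0// expR_gt0. Qed.

Let cG i t : 0 <= t -> continuous (G i ^~ t).
Proof.
move=> t0; have -> : G i ^~ t = (fun x => (iota x).1 t i ord0 * (S t i ord0)^-1).
  by apply/funext => x; rewrite GE.
by refine (continuous_mul _ _); [exact: c1|exact: cst_continuous].
Qed.

Let cG' i j t : 0 <= t -> continuous (G' i j ^~ t).
Proof.
move=> t0; have -> : G' i j ^~ t = (fun x => (\sum_k (iota x).2 t i k * Dmarket S t k j) * (S t i ord0)^-1
    + (iota x).1 t i ord0 * (- (S t i ord0) ^- 2 *+ (i == j))).
  by apply/funext => x; rewrite G'E.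
refine (continuous_add _ _); refine (continuous_mul _ _); try exact: cst_continuous.
  refine (@continuous_sum R K _ _ _ _) => k.
  by refine (continuous_mul _ _); [exact: c2|exact: cst_continuous].
exact: c1.
Qed.

(* Wealth is continuous in the index because its logarithm is Lipschitz. *)
Let cV t : 0 < t -> continuous (V ^~ t).
Proof.
move=> t0; have [k hk] := hLip t0.
have cl := @lipschitz_continuous R K (fun x => ln (V x t)) k hk.
have -> : V ^~ t = (fun x => expR (ln (V x t))).
  by apply/funext => x; rewrite lnK ?posrE.
by move=> x; apply: continuous_comp; [exact: cl|exact: continuous_expR].
Qed.

Let cW t : 0 <= t -> continuous ((wealth_of S P G G') ^~ t).
Proof.
rewrite le_eqVlt => /predU1P[<-|t0].
  have -> : (wealth_of S P G G') ^~ 0 = (fun=> 1).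
    by apply/funext => x; rewrite /wealth_of log_wealth0 expR0.
  exact: cst_continuous.
have -> : (wealth_of S P G G') ^~ t = (fun x => V x t * Wmu t).
  by apply/funext => x; rewrite VE divfK// gt_eqF.
by refine (continuous_mul _ _); [exact: cV|exact: cst_continuous].
Qed.

Let econtS T i : econt T (fun t => S t i ord0). Proof. exact: (econt_S hS). Qed.

Let econt_SV T i : econt T (fun t => (S t i ord0)^-1).
Proof. by apply: econtV => // t t0 _; rewrite gt_eqF ?S0. Qed.

Let econt_Dmarket T i j : econt T (fun t => Dmarket S t i j).
Proof.
have cs : econt T (total_cap S) by exact: econt_sum.
have cv : econt T (fun t => (total_cap S t)^-1).
  by apply: econtV => // t t0 _; rewrite gt_eqF// total_cap_gt0.
have h := econtB (econtM (econt_cst (i == j)%:R) cv) (econtM (@econtS T i) (econtM cv cv)).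
refine (econt_ext _ h) => t t0 _.
by rewrite /Dmarket mxE -/(total_cap S t) expr2 invfM.
Qed.

Let econt_iota T x : 0 < T ->
  (forall i, econt T (fun t => (iota x).1 t i ord0)) /\
  (forall i j, econt T (fun t => (iota x).2 t i j)).
Proof.
move=> T0; have [_ [h _ _ _]] := hiotaA x; have [h1 h2 _ _] := h T T0.
by split=> [i|i j]; [exact: (within_continuous_mxP T _).1|exact: (within_continuous_mxP T _).1].
Qed.

Let tG T i x : 0 < T -> econt T (G i x).
Proof.
move=> T0; have [h1 _] := econt_iota x T0.
by apply: econt_ext (econtM (h1 i) (@econt_SV T i)) => t _ _; rewrite GE.
Qed.

Let tG' T i j x : 0 < T -> econt T (G' i j x).
Proof.
move=> T0; have [h1 h2] := econt_iota x T0.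
have cv2 : econt T (fun t => - (S t i ord0) ^- 2 *+ (i == j)).
  have cv := @econt_SV T i.
  apply: econt_ext (econtM (econt_cst (- (i == j)%:R)) (econtM cv cv)) => t _ _.
  by rewrite expr2 invfM; case: (i == j); rewrite ?mulr1n ?mulr0n; ring.
apply: econt_ext (econtD (econtM (econt_sum (index_enum 'I_d) (fun k =>
  econtM (h2 i k) (@econt_Dmarket T k j))) (@econt_SV T i)) (econtM (h1 i) cv2)) => t _ _.
by rewrite G'E.
Qed.

Let horizon T : 0 < T -> exists2 w, lift_control p S P T w &
  forall s t, 0 <= s -> s <= t -> t <= T -> c s t <= w s t.
Proof.
move=> T0; have [cT hT] := rough_path_bound p2 hS T0.
have lT : lift_control p S P T cT by [].
have hcT : control_function `[0, T] c.
  have sub x : `[0, T]%classic x -> `[0, +oo[%classic x.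
    by rewrite /= !in_itv /= andbT => /andP[].
  have [h1 h2] := hc; split=> [s t /sub ? /sub ?|s u t /sub ? /sub ? /sub ?].
    exact: h1.
  exact: h2.
have [hcT' _ _ _] := lT.
exists (fun s t => cT s t + c s t).
  apply: (lift_control_le p2 hS T0 lT); first exact: controlD.
  by move=> s t s0 st tT; rewrite lerDl (control_ge0 hcT).
by move=> s t s0 st tT; rewrite lerDr (control_ge0 hcT').
Qed.

Let ctlG T w : 0 < T -> lift_control p S P T w ->
  (forall s t, 0 <= s -> s <= t -> t <= T -> c s t <= w s t) ->
  forall i, ctl S T w p^-1 q^-1 (G i) (G' i).
Proof.
move=> T0 hw cw i; have [hw' _ _ _] := hw.
apply: (ctl_weight p0 q0 r0 hpq hrpq S0 (ltW T0) hw' (@econtS T) _ hc cw d0 hiotaA).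
exact: (ord_coord hw).
Qed.

Let Z := mix_wealth m S P G G'.
Let N := mix_weight m S P G G'.
Let N' := mix_weight' m S P G G'.

Let Zne t : 0 <= t -> Z t != 0.
Proof.
move=> t0; have T0 : 0 < t + 1 by rewrite ltr_wpDl.
have [w hw cw] := horizon T0.
have [k k0 hk] := mix_wealth_bound hK m hS T0 hw b0 ba th1 (ctlG T0 hw cw)
  (fun t t0 _ => cW t0).
by rewrite gt_eqF// (lt_le_trans k0)// hk// lerDl.
Qed.

Let pinuE t i : 0 <= t -> pinu t i ord0 = S t i ord0 * N i t.
Proof.
move=> t0; rewrite /pinu /universal_portfolio mxE.
have lip j : exists2 k, 0 <= k & forall F H e, 0 < e -> (dist F H < e%:E)%E ->
    `|evaluation j F - evaluation j H| <= k * e.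
  by apply: (evaluation_lip q r c _ _ hM hbeta mu0 j); [exact: lt_trans hqq'|exact: lt_trans hrr'].
have sep F H : A F -> A H -> (forall j, evaluation j F = evaluation j H) -> F = H.
  exact: evaluation_sep.
pose VF (F : @cpath R d) := relative_wealth S P (to_S_controlled S F) t.
have VFE : VF \o iota = (fun x => (Wmu t)^-1 * wealth_of S P G G' x t).
  by apply/funext => x /=; rewrite /VF -/(V x t) VE mulrC.
have cVF : continuous (VF \o iota).
  by rewrite VFE; refine (continuous_mul _ _); [exact: cst_continuous|exact: cW].
have e1 := integral_iota hK m hiotaA hiota_inj hiota_cont lip sep cVF.
pose FV (F : @cpath R d) := F.1 t i ord0 * VF F.
have FVE : FV \o iota = (fun x => (S t i ord0 / Wmu t) * (G i x t * wealth_of S P G G' x t)).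
  apply/funext => x; rewrite /FV /VF /= -/(V x t) VE GE.
  by field; rewrite !gt_eqF// ?S0.
have cFV : continuous (FV \o iota).
  rewrite FVE; refine (continuous_mul _ _); first exact: cst_continuous.
  by refine (continuous_mul _ _); [exact: cG|exact: cW].
have e2 := integral_iota hK m hiotaA hiota_inj hiota_cont lip sep cFV.
rewrite -/nu in e1 e2; rewrite e1 e2 FVE VFE.
rewrite (averageZ hK); last by refine (continuous_mul _ _); [exact: cG|exact: cW].
rewrite (averageZ hK); last exact: cW.
have z0 := Zne t0; rewrite /N /mix_weight; rewrite -/(Z t).
rewrite -/(mix_wealth m S P G G' t) -/(Z t); set X1 := average _ _.
by field; rewrite z0 gt_eqF.
Qed.

(** The derivative of S N, as a product of controlled paths. *)
Definition natural_derivative (t : R) : 'M[R]_d :=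
  \matrix_(i, j) (S t i ord0 * N' i j t + N i t *+ (i == j)).

Let ctl_pinu T w : 0 < T -> lift_control p S P T w ->
  (forall s t, 0 <= s -> s <= t -> t <= T -> c s t <= w s t) ->
  forall i, ctl S T w p^-1 q^-1 (fun (_ : unit) => N i) (fun j _ => N' i j).
Proof.
move=> T0 hw cw i.
apply: (ctl_mix_weight hK m hS T0 hw b0 ba th1 (ctlG T0 hw cw)) => *.
- exact: cG.
- exact: cG'.
- exact: cW.
Qed.

(** pi^nu = S N, where N averages the weights pi / S against the wealths; both
    factors are controlled, and the weights of every portfolio add up to 1. *)
Lemma universal_portfolio_controlled : portfolio q r S (pinu, natural_derivative).
Proof.
split=> [T T0|t t0].
  have [w hw cw] := horizon T0; have [hw' _ _ _] := hw.
  have cN i : econt T (N i).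
    by apply: (econt_mix_weight hK m hS T0 hw b0 ba th1 (ctlG T0 hw cw)) => *;
      [exact: cG|exact: cW|exact: tG].
  have cN' i j : econt T (N' i j).
    by apply: (econt_mix_weight' hK m hS T0 hw b0 ba th1 (ctlG T0 hw cw)) => *;
      [exact: cG|exact: cG'|exact: cW|exact: tG|exact: tG'].
  apply: (ctl_controlled q0 r0 hrpq (ltW T0) hw').
  - move=> i; apply: econt_ext (econtM (@econtS T i) (cN i)) => t t0 _.
    by rewrite /= pinuE.
  - move=> i j; apply: econt_ext (econtD (econtM (@econtS T i) (cN' i j))
      (econtM (cN i) (econt_cst (i == j)%:R))) => t t0 _.
    by rewrite /natural_derivative /= mxE mulr_natr.
  - move=> i; have cc := ctl_coord w p^-1 q^-1 (fun i => @econt_bd R T unit _ (ltW T0) (@econtS T i)) i.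
    apply: ctl_ext (ctlM hw' b0 ba (ord_coord hw) cc (ctl_pinu T0 hw cw i)) => [x t t0 _|j x t t0 _].
      by rewrite /= pinuE.
    by rewrite /natural_derivative /= mxE /coord mulr_natl addrC.
rewrite /in_simplex /=.
under eq_bigr do rewrite pinuE// /N /mix_weight mulrA.
rewrite -mulr_suml -/(Z t); apply: (canLR (mulfK (Zne t0))); rewrite mul1r.
rewrite (eq_bigr (fun i => average m (fun x => (iota x).1 t i ord0 * wealth_of S P G G' x t))); last first.
  move=> i _; rewrite -(averageZ hK)//; last first.
    by refine (continuous_mul _ _); [exact: cG|exact: cW].
  apply: average_eq => x; rewrite GE; field.
  by rewrite gt_eqF ?S0.
rewrite -(average_sum hK)//; last first.
  by move=> i; refine (continuous_mul _ _); [exact: c1|exact: cW].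
apply: average_eq => x; rewrite -mulr_suml.
by have [_ [_ h _ _]] := hiotaA x; rewrite (h t t0) mul1r.
Qed.

(** For the natural derivative the wealth is the average of the individual
    wealths; any other derivative gives the same rough integral. *)
Lemma universal_wealth dpinu T : 0 < T -> portfolio q r S (pinu, dpinu) ->
  relative_wealth S P (pinu, dpinu) T = average m (V ^~ T).
Proof.
move=> T0 [hport _]; have [w1 hw1 cw1] := horizon T0; have [hw1' _ _ _] := hw1.
have [wF hwF hctl] := controlled_ctl q0 r0 hrpq (ltW T0) (hport T T0).
pose w s t := w1 s t + wF s t.
have hw' : control_function `[0, T] w by exact: controlD.
have le1 s t : 0 <= s -> s <= t -> t <= T -> w1 s t <= w s t.
  by move=> s0 st tT; rewrite lerDl (control_ge0 hwF).
have leF s t : 0 <= s -> s <= t -> t <= T -> wF s t <= w s t.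
  by move=> s0 st tT; rewrite lerDr (control_ge0 hw1').
have hw : lift_control p S P T w by exact: (lift_control_le p2 hS T0 hw1 hw' le1).
have cw s t : 0 <= s -> s <= t -> t <= T -> c s t <= w s t.
  by move=> s0 st tT; apply: le_trans (cw1 s t s0 st tT) (le1 s t s0 st tT).
pose F (_ : unit) : @cpath R d := (pinu, dpinu).
pose GF i (x : unit) t := (cmul (F x) (cinv S)).1 t i ord0.
pose GF' i j (x : unit) t := (cmul (F x) (cinv S)).2 t i j.
have GFE i t : 0 <= t -> t <= T -> GF i tt t = N i t.
  move=> t0 tT; have -> : GF i tt t = pinu t i ord0 * (S t i ord0)^-1.
    by rewrite /GF [LHS]mxE [X in _ * X]mxE.
  rewrite pinuE//.
  by field; rewrite gt_eqF ?S0.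
have cN := ctl_pinu T0 hw cw.
have cGF i : ctl S T w p^-1 q^-1 (GF i) (GF' i).
  have [k k0 hk] := econt_inf (ltW T0) (@econtS T i) (fun t t0 _ => S0 i t0).
  have cc := ctl_coord w p^-1 q^-1 (fun i => @econt_bd R T unit _ (ltW T0) (@econtS T i)) i.
  have hV := ctlV hw' b0 ba (ord_coord hw) k0 (fun _ => hk) cc.
  apply: ctl_ext (ctlM hw' b0 ba (ord_coord hw) (hctl w hw' leF i) hV) => [x t _ _|j x t _ _].
    by rewrite /GF [RHS]mxE [X in _ = _ * X]mxE.
  rewrite /GF' [RHS]mxE [X in _ = _ + _ * X]mxE [X in _ = _ * X + _]mxE /coord.
  by case: (i == j); rewrite ?mulr1n ?mulr0n /=; ring.
have cGN i : ctl S T w p^-1 q^-1 (GF i) (fun j _ => N' i j).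
  by apply: ctl_ext (cN i) => [[] t t0 tT|//]; rewrite GFE.
have e1 := rough_integral_derivative p2 hS T0 hw b0 ba th1 cGF cGN.
have e2 : log_wealth S P GF GF' tt T = log_wealth S P (fun i (_ : unit) => N i)
    (fun i j _ => N' i j) tt T.
  rewrite -(@log_wealth_ext _ _ _ _ unit GF (fun i _ => N i)
    (fun i j _ => N' i j) (fun i j _ => N' i j) tt T) => [|i t t0 tT|//]; last first.
    by rewrite GFE.
  by rewrite /log_wealth e1.
have e3 : wealth S P (pinu, dpinu) T = Z T.
  rewrite (wealthE S P F tt T) -/GF -/GF' e2.
  by rewrite /Z (mix_wealthE hK m hS T0 hw b0 ba th1 (ctlG T0 hw cw)) => *;
    [|exact: cG|exact: cG'|exact: cW].
rewrite /relative_wealth e3 -/(Wmu T) mulrC /Z /mix_wealth -(averageZ hK)//; last exact/cW/ltW.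
by apply: average_eq => x; rewrite VE mulrC.
Qed.

Lemma continuous_relative_wealth T : 0 < T -> continuous (V ^~ T).
Proof. exact: cV. Qed.

Lemma relative_wealth_gt0 x T : 0 < V x T.
Proof. exact: V0. Qed.

End universal_portfolio.

Theorem theorem4p9 (R : realType) (d : nat) (p q r q' r' : R)
  (hp : 2 < p < 3) (hpq : p <= q) (hr : 1 < r)
  (hpq1 : 1 < 2 / p + 1 / q) (hrpq : 1 / r = 1 / p + 1 / q)
  (hqq' : q < q') (hrr' : r < r')
  (hpq1' : 1 < 2 / p + 1 / q') (hrpq' : 1 / r' = 1 / p + 1 / q')
  (S : R -> 'cV[R]_d) (P : nat -> nat -> R) (hS : price_path_along p S P)
  (c : R -> R -> R) (hc : control_function `[0, +oo[ c)
  (hcmu : forall s t, 0 <= s <= t -> enorm (incr (market S) s t) `^ p <= c s t)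
  (M : R) (hM : 0 < M)
  (beta : nat -> R) (hbeta : forall N, (0 < N)%N -> 0 < beta N)
  (hbetaoo : beta @ \oo --> +oo)
  (K : pmetricType R) (hK : compact [set: K])
  (iota : K -> @cpath R d) :
  let A := admissible q r (market S) M c in
  let dist := dbeta beta q r q' r' (market S) M c in
  let V (x : K) := relative_wealth S P (to_S_controlled S (iota x)) in
  forall (hiotaA : forall x, A (iota x))
    (hiota_inj : injective iota)
    (hiota_cont : forall x (e : R), 0 < e ->
       \forall y \near x, (dist (iota x) (iota y) < e%:E)%E)
    (lambda : R -> R) (hlambda : forall T, 0 < T -> 0 < lambda T) (C : R)
    (hLip : forall T x y, 0 < T ->
       `|ln (V x T) - ln (V y T)| <= C * lambda T * mdist x y)
    (m : probability (g_sigma_algebraType (@open K)) R)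
    (hm : forall U : set K, open U -> U !=set0 -> (0 < m U)%E)
    (hlambdaoo : lambda T @[T --> +oo] --> +oo),
  let Vstar T := sup [set V x T | x in [set: K]] in
  let nu : set (borel_in A dist) -> \bar R :=
    pushforward m (iota : g_sigma_algebraType (@open K) -> borel_in A dist) in
  let pinu := universal_portfolio S P nu in
  (exists dpinu, portfolio q r S (pinu, dpinu)) /\
  (forall dpinu, portfolio q r S (pinu, dpinu) ->
     (lambda T)^-1 *
       (ln (Vstar T) - ln (relative_wealth S P (pinu, dpinu) T))
       @[T --> +oo] --> 0).
Proof.
move=> A dist V hA hinj hcont lambda hlambda C hLip m hm hoo Vstar nu pinu.
have p2 : 2 < p by case/andP: hp.
have lip T : 0 < T -> exists k, forall x y, `|ln (V x T) - ln (V y T)| <= k * mdist x y.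
  by move=> T0; exists (C * lambda T) => x y; exact: hLip.
split.
  by eexists; exact: (universal_portfolio_controlled p2 hpq hr hpq1 hrpq hqq' hrr' hS hc hM
    hbeta hK m hA hinj hcont lip).
move=> dpinu hport; apply/cvgrPdist_lt => e e0.
(* The radius eta makes the Lipschitz term at most e / 2 times lambda T; the
   constant k0 is absorbed by the other half once lambda T is large. *)
have C10 : 0 < 2 * (`|C| + 1) by rewrite mulr_gt0// ltr_wpDl.
have eta0 : 0 < e / (2 * (`|C| + 1)) by rewrite divr_gt0.
have [k0 hk0] := log_sup_average hK hm eta0.
have : \forall T \near +oo, 0 < T /\ 2 * `|k0| / e < lambda T.
  have h1 : \forall T \near (+oo : set_system R), 0 < T by exact: nbhs_pinfty_gt.
  have h2 : \forall T \near (+oo : set_system R), 2 * `|k0| / e < lambda T.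
    by move/cvgryPgt : hoo; apply.
  exact: filterI.
apply: filterS => T [T0 lT]; rewrite sub0r normrN.
have l0 := hlambda T T0.
rewrite (universal_wealth p2 hpq hr hpq1 hrpq hqq' hrr' hS hc hM hbeta hK hA hinj hcont lip T0 hport).
have hL x y : `|ln (V x T) - ln (V y T)| <= `|C| * lambda T * mdist x y.
  apply: (le_trans (hLip T x y T0)).
  by rewrite ler_wpM2r ?mdist_ge0// ler_wpM2r ?(ltW l0)// ler_norm.
have cV := continuous_relative_wealth lip T0.
have := hk0 (V ^~ T) (`|C| * lambda T) cV (fun x => relative_wealth_gt0 S P iota x T) _ hL.
have L0 : 0 <= `|C| * lambda T by rewrite mulr_ge0// ltW.
move=> /(_ L0); rewrite -/(Vstar T).
move: (ln (Vstar T) - _) => D /andP[D0 DT].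
rewrite ger0_norm; last by rewrite mulr_ge0// invr_ge0 ltW.
rewrite mulrC ltr_pdivrMr//.
have k0T : k0 < lambda T * e / 2.
  apply: (le_lt_trans (ler_norm k0)).
  by rewrite ltr_pdivlMr// mulrC -ltr_pdivrMr.
have CT : `|C| * lambda T * (e / (2 * (`|C| + 1))) <= lambda T * e / 2.
  rewrite -mulrA [X in _ <= X](_ : _ = (`|C| + 1) * (lambda T * (e / (2 * (`|C| + 1))))).
    rewrite ler_wpM2r ?lerDl//.
    exact/ltW/mulr_gt0.
  by field; rewrite gt_eqF// ltr_wpDl.
apply: (le_lt_trans DT).
have -> : e * lambda T = lambda T * e / 2 + lambda T * e / 2 by field.
exact: ler_ltD.
Qed.
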